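(* Let $N$ be a positive integer and let $L$ be a finite set of even cardinality at least $10$ but not $12$. Assume that for all sets $L'$ of even cardinality smaller than that of $L$, $I_{L'}^{(2)}\otimes_{\mathbb{Z}}\mathbb{Z}[\tfrac{1}{2N}]$ is generated as a $\mathbb{Z}[\tfrac{1}{2N}]$-module by the simple binomial relations. Then $I_L^{(2)}\otimes_{\mathbb{Z}}\mathbb{Z}[\tfrac{1}{2N}]$ is generated as a $\mathbb{Z}[\tfrac{1}{2N}]$-module by the simple binomial relations.
   Context: Let $L$ be a finite nonempty set of even cardinality. Consider directed graphs with vertex set $L$, loops and multiple edges allowed. A graph is regular of degree $k$ if every vertex has valence $k$ (a loop contributes $2$ to the valence). Regular graphs form a semigroup $\mathcal{G}$: $\Gamma\cdot\Gamma'$ is the graph on $L$ whose edge set is the disjoint union of those of $\Gamma$ and $\Gamma'$. Write $X_\Gamma$ for the element of the semigroup algebra $\mathbb{Z}[\mathcal{G}]$ corresponding to $\Gamma$. The ring $R_L$ is the quotient of $\mathbb{Z}[\mathcal{G}]$ by the relations: (1) Loop relation: $X_\Gamma=0$ if $\Gamma$ has a loop. (2) Sign relation: $X_\Gamma=-X_{\Gamma'}$ if $\Gamma'$ is obtained from $\Gamma$ by reversing the direction of one edge. (3) Plücker relation: if $\overrightarrow{ab}$ and $\overrightarrow{cd}$ are two edges of $\Gamma$, and $\Gamma'$ (resp. $\Gamma''$) is obtained from $\Gamma$ by replacing them with $\overrightarrow{ad},\overrightarrow{cb}$ (resp. $\overrightarrow{ac},\overrightarrow{bd}$), then $X_\Gamma=X_{\Gamma'}+X_{\Gamma''}$.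 The image of $X_\Gamma$ in $R_L$ is still written $X_\Gamma$; $R_L^{(k)}$ is the $\mathbb{Z}$-span of the $X_\Gamma$ with $\Gamma$ regular of degree $k$. A matching is a regular graph of degree one. Put $V_L=R_L^{(1)}$, spanned by the $X_\Gamma$ with $\Gamma$ a matching; $V_L$ generates $R_L$ (Kempe). The ideal of relations $I_L$ is the kernel of the surjection $\operatorname{Sym}(V_L)\to R_L$; $I_L^{(2)}\subset\operatorname{Sym}^2(V_L)$ is its degree-two part. Simple binomial relations: let $U\subset L$ have cardinality $4$, $L'=L\setminus U$, let $\Delta,\Delta'$ be matchings on $U$ and $\Gamma,\Gamma'$ matchings on $L'$ (empty if $L'=\emptyset$). Writing $\Gamma\Delta$ for the matching on $L$ that is the union of $\Gamma$ and $\Delta$ (and similarly for the others), the associated simple binomial relation is $X_{\Gamma\Delta}X_{\Gamma'\Delta'}-X_{\Gamma\Delta'}X_{\Gamma'\Delta}\in I_L^{(2)}$. *)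

(* Defs.v *)
From HB Require Import structures.
From mathcomp Require Import all_boot all_order all_algebra.
From mathcomp Require Import finmap boolp.
From mathcomp Require Import xfinmap monalg.

Set Implicit Arguments.
Unset Strict Implicit.
Unset Printing Implicit Defensive.

Import GRing.Theory Num.Theory BigEnoughFSet.
Local Open Scope fset_scope.
Local Open Scope quotient_scope.
Local Open Scope ring_scope.

Definition zspan (M : zmodType) (P : M -> Prop) : {pred M} := fun x =>
  `[< exists (n : nat) (c : 'I_n -> int) (g : 'I_n -> M),
        (forall i, P (g i)) /\ x = \sum_(i < n) g i *~ c i >].

Definition ideal_gen (R : comNzRingType) (P : R -> Prop) : {pred R} := fun x =>
  `[< exists (n : nat) (a g : 'I_n -> R),
        (forall i, P (g i)) /\ x = \sum_(i < n) a i * g i >].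

Lemma zspan_closed (M : zmodType) (P : M -> Prop) : zmod_closed (zspan P).
Proof.
split=> [|x y /asboolP[n [c [g [Pg ->]]]] /asboolP[m [d [h [Ph ->]]]]].
  apply/asboolP; exists 0%N, (fun=> 0), (fun=> 0); split; first by case.
  by rewrite big_ord0.
apply/asboolP; exists (n + m)%N.
exists (fun i => match split i with inl j => c j | inr k => - d k end).
exists (fun i => match split i with inl j => g j | inr k => h k end).
split; first by move=> i; case: (split i).
rewrite big_split_ord /= -sumrN; congr (_ + _); apply: eq_bigr => i _.
  by rewrite (unsplitK (inl i)).
by rewrite (unsplitK (inr i)) mulrNz.
Qed.

HB.instance Definition _ (M : zmodType) (P : M -> Prop) :=
  GRing.isZmodClosed.Build M (zspan P) (zspan_closed P).

Lemma mem_zspan (M : zmodType) (P : M -> Prop) x : P x -> x \in zspan P.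
Proof.
move=> Px; apply/asboolP; exists 1%N, (fun=> 1), (fun=> x); split=> //.
by rewrite big_ord1 mulr1z.
Qed.

Lemma zspan_ind (M A : zmodType) (P : M -> Prop) (f : {additive M -> A}) x :
  (forall g, P g -> f g = 0) -> x \in zspan P -> f x = 0.
Proof.
move=> fP /asboolP[n [c [g [Pg ->]]]]; rewrite raddf_sum big1 // => i _.
by rewrite raddfMz fP // mul0rz.
Qed.

Lemma ideal_gen_idealr (R : comNzRingType) (P : R -> Prop) :
  1 \notin ideal_gen P -> idealr_closed (ideal_gen P).
Proof.
move=> P1; split=> //.
  apply/asboolP; exists 0%N, (fun=> 0), (fun=> 0); split; first by case.
  by rewrite big_ord0.
move=> a x y /asboolP[n [c [g [Pg ->]]]] /asboolP[m [d [h [Ph ->]]]].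
apply/asboolP; exists (n + m)%N.
exists (fun i => match split i with inl j => a * c j | inr k => d k end).
exists (fun i => match split i with inl j => g j | inr k => h k end).
split; first by move=> i; case: (split i).
rewrite big_split_ord /= mulr_sumr; congr (_ + _); apply: eq_bigr => i _.
  by rewrite (unsplitK (inl i)) mulrA.
by rewrite (unsplitK (inr i)).
Qed.

Lemma mem_ideal_gen (R : comNzRingType) (P : R -> Prop) x :
  P x -> x \in ideal_gen P.
Proof.
move=> Px; apply/asboolP; exists 1%N, (fun=> 1), (fun=> x); split=> //.
by rewrite big_ord1 mul1r.
Qed.

Lemma ideal_gen_ind (R S : comNzRingType) (P : R -> Prop)
    (f : {rmorphism R -> S}) x :
  (forall g, P g -> f g = 0) -> x \in ideal_gen P -> f x = 0.
Proof.
move=> fP /asboolP[n [c [g [Pg ->]]]]; rewrite rmorph_sum big1 // => i _.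
by rewrite rmorphM /= (fP _ (Pg i)) mulr0.
Qed.

Lemma ideal_gen_proper (K : conomType) (P : {malg int[K]} -> Prop) :
  (forall g, P g -> g@_(@mone K) = 0) -> 1 \notin ideal_gen P.
Proof.
move=> P0; apply/negP => /(@ideal_gen_ind _ _ P (mcoeff (@mone K)) _ P0).
by move/eqP; rewrite rmorph1 oner_eq0.
Qed.

Lemma mcoeff_subr3 (K : choiceType) (k : K) (p q r : {malg int[K]}) :
  p@_k = 0 -> q@_k = 0 -> r@_k = 0 -> (p - q - r)@_k = 0.
Proof. by move=> p0 q0 r0; rewrite !mcoeffB p0 q0 r0 !subr0. Qed.

Lemma raddf_subr3 (M A : zmodType) (f : {additive M -> A}) (p q r : M) :
  f (p - q - r) = f p - f q - f r.
Proof. by rewrite !raddfB. Qed.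

(* Sym V is the polynomial ring over Z in indeterminates indexed by the elements
   of V, modulo additivity of v |-> 'X_v. *)
Section Sym.
Variable V : zmodType.

Definition sym_var (v : V) : {malg int[{cmonom V}]} := << ucm v >>.

Definition sym_relation (p : {malg int[{cmonom V}]}) : Prop :=
  exists u v, p = sym_var (u + v) - sym_var u - sym_var v.

Definition sym_ideal : {pred {malg int[{cmonom V}]}} := ideal_gen sym_relation.

Lemma sym_ideal_closed : idealr_closed sym_ideal.
Proof.
apply/ideal_gen_idealr/ideal_gen_proper => _ [u [v ->]].
have var0 w : (sym_var w)@_(@mone {cmonom V}) = 0.
  by rewrite /sym_var mcoeffU1 cm1_eq1.
by apply: mcoeff_subr3; apply: var0.
Qed.

HB.instance Definition _ :=
  isIdealr.Build {malg int[{cmonom V}]} sym_ideal sym_ideal_closed.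

Definition Sym := {ideal_quot sym_ideal}.
HB.instance Definition _ := GRing.ComNzRing.on Sym.
End Sym.

(* The generators of the quotients below are locked: otherwise unification
   compares them with products by unfolding the quotient structure. *)
HB.lock Definition sym (V : zmodType) (v : V) : Sym V :=
  \pi_(Sym V) (sym_var v).

Definition sym_part (V : zmodType) (n : nat) : {pred Sym V} :=
  zspan (fun s => exists v : 'I_n -> V, s = \prod_(i < n) sym (v i)).
HB.instance Definition _ V n := GRing.ZmodClosed.on (@sym_part V n).

Section SymLift.
Variables (V : zmodType) (A : comNzRingType) (f : V -> A).

Definition cmonom_eval (m : {cmonom V}) : A :=
  \prod_(v <- finsupp (cmonom_val m)) f v ^+ m v.

Lemma cmonom_evalEw (d : {fset V}) (m : {cmonom V}) :
  finsupp (cmonom_val m) `<=` d -> cmonom_eval m = \prod_(v <- d) f v ^+ m v.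
Proof.
move=> le; rewrite /cmonom_eval (big_fset_incl _ le) //= => v _ vm.
by rewrite (fsfun_dflt vm) expr0.
Qed.

Lemma cmonom_eval_mmorphism : mmorphism cmonom_eval.
Proof.
split=> [m1 m2|]; last by rewrite /cmonom_eval mdom1 big_seq_fset0.
pose d := finsupp (cmonom_val m1) `|` finsupp (cmonom_val m2).
rewrite (@cmonom_evalEw d) ?(mdomD m1 m2) //.
rewrite (@cmonom_evalEw d m1) ?fsubsetUl // (@cmonom_evalEw d m2) ?fsubsetUr //.
by rewrite -big_split; apply: eq_bigr => v _; rewrite cmM exprD.
Qed.

HB.instance Definition _ :=
  isMultiplicative.Build {cmonom V} A cmonom_eval cmonom_eval_mmorphism.

Definition sym_eval (p : {malg int[{cmonom V}]}) : A :=
  mmap (intmul 1 : int -> A) cmonom_eval p.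
HB.instance Definition _ := GRing.RMorphism.copy sym_eval
  (mmap (intmul 1 : int -> A) cmonom_eval).

Definition sym_lift (s : Sym V) : A := sym_eval (repr s).

Lemma sym_eval_var v : sym_eval (sym_var v) = f v.
Proof.
rewrite /sym_eval /sym_var mmapU mul1r /cmonom_eval mdomU.
by rewrite big_seq_fset1 cmUU expr1.
Qed.
End SymLift.

Section SymLiftTheory.
Variables (V : zmodType) (A : comNzRingType) (f : {additive V -> A}).

Lemma sym_lift_pi p : sym_lift f (\pi p) = sym_eval f p.
Proof.
apply/eqP; rewrite -subr_eq0 /sym_lift -rmorphB; apply/eqP.
apply: (@ideal_gen_ind _ _ (@sym_relation V)).
  move=> _ [u [v ->]]; apply: etrans (raddf_subr3 _ _ _ _) _.
  transitivity (f (u + v) - f u - f v); last by rewrite raddfD addrAC addrK subrr.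
  by congr (_ - _ - _); apply: sym_eval_var.
suff: repr (\pi_(Sym V) p) - p \in @sym_ideal V by [].
by rewrite Quotient.idealrBE reprK.
Qed.

Lemma sym_lift_sym v : sym_lift f (sym v) = f v.
Proof. by rewrite sym.unlock sym_lift_pi sym_eval_var. Qed.

Lemma sym_lift_zmod : zmod_morphism (sym_lift f).
Proof.
move=> s t; rewrite -[s]reprK -[t]reprK -rmorphB /= !sym_lift_pi.
exact: rmorphB.
Qed.

Lemma sym_lift_monoid : monoid_morphism (sym_lift f).
Proof.
split; first by rewrite -[1](rmorph1 (\pi_(Sym V))) sym_lift_pi; exact: rmorph1.
move=> s t; rewrite -[s]reprK -[t]reprK -rmorphM /= !sym_lift_pi.
exact: rmorphM.
Qed.

HB.instance Definition _ :=
  GRing.isZmodMorphism.Build (Sym V) A (sym_lift f) sym_lift_zmod.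
HB.instance Definition _ :=
  GRing.isMonoidMorphism.Build (Sym V) A (sym_lift f) sym_lift_monoid.
End SymLiftTheory.

Section FreeLift.
Variables (K : choiceType) (M : zmodType) (h : K -> M).

Definition free_lift (p : {malg int[K]}) : M := \sum_(k <- msupp p) h k *~ p@_k.

Lemma free_liftEw (d : {fset K}) p :
  msupp p `<=` d -> free_lift p = \sum_(k <- d) h k *~ p@_k.
Proof.
move=> le; rewrite /free_lift (big_fset_incl _ le) //= => k _.
by move/mcoeff_outdom ->; rewrite mulr0z.
Qed.

Lemma free_lift_zmod : zmod_morphism free_lift.
Proof.
move=> p q; pose_big_fset K E; rewrite 3?(free_liftEw (d := E)) //.
  by rewrite -sumrB; apply: eq_bigr => k _; rewrite mcoeffB mulrzBr.
by close.
Qed.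

HB.instance Definition _ :=
  GRing.isZmodMorphism.Build {malg int[K]} M free_lift free_lift_zmod.

Lemma free_liftU k : free_lift << k >> = h k.
Proof. by rewrite (free_liftEw msuppU_le) big_seq_fset1 mcoeffUU mulr1z. Qed.
End FreeLift.

Lemma malg_additive_eq (K : choiceType) (M : zmodType)
    (f g : {additive {malg int[K]} -> M}) :
  (forall k, f << k >> = g << k >>) -> f =1 g.
Proof.
move=> fg p; rewrite [p]monalgE !raddf_sum; apply: eq_bigr => k _.
suff -> : << p@_k *g k >> = << k >> *~ p@_k :> {malg int[K]}.
  by rewrite !raddfMz fg.
rewrite -[in LHS](intz p@_k); exact: (raddfMz (mkmalgU k)).
Qed.

(* Tensor product over Z: the free abelian group on A * B modulo biadditivity
   (which implies that integers can be moved across). *)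
Section Tensor.
Variables A B : zmodType.

Definition tensor_relation (p : {malg int[(A * B)%type]}) : Prop :=
  (exists a a' b, p = << (a + a', b) >> - << (a, b) >> - << (a', b) >>) \/
  (exists a b b', p = << (a, b + b') >> - << (a, b) >> - << (a, b') >>).

Definition tensor_kernel : {pred {malg int[(A * B)%type]}} := zspan tensor_relation.
HB.instance Definition _ := GRing.ZmodClosed.on tensor_kernel.

Definition tensor := Quotient.quot tensor_kernel.
HB.instance Definition _ := GRing.Zmodule.on tensor.

Lemma pi_tensor_relation p : tensor_relation p -> \pi_tensor p = 0.
Proof.
move=> rp; rewrite -[0](raddf0 (\pi_tensor)); apply/eqP.
have := Quotient.idealrBE tensor_kernel p 0; rewrite subr0 => <-.
exact: mem_zspan.
Qed.
End Tensor.

HB.lock Definition pure_tensor (A B : zmodType) (a : A) (b : B) : tensor A B :=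
  \pi_(tensor A B) << (a, b) >>.

Section TensorTheory.
Variables A B : zmodType.
Implicit Types (a : A) (b : B).

Lemma pure_tensorDl a a' b :
  pure_tensor (a + a') b = pure_tensor a b + pure_tensor a' b.
Proof.
apply/eqP; rewrite -subr_eq0 opprD addrA; apply/eqP.
rewrite pure_tensor.unlock -raddf_subr3; apply: pi_tensor_relation.
by left; exists a, a', b.
Qed.

Lemma pure_tensorDr a b b' :
  pure_tensor a (b + b') = pure_tensor a b + pure_tensor a b'.
Proof.
apply/eqP; rewrite -subr_eq0 opprD addrA; apply/eqP.
rewrite pure_tensor.unlock -raddf_subr3; apply: pi_tensor_relation.
by right; exists a, b, b'.
Qed.
End TensorTheory.

Section BaseChange.
Variables (K : comNzRingType) (A : zmodType).

Definition base_change := tensor A K.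
HB.instance Definition _ := GRing.Zmodule.on base_change.

(* c acts by a (x) b |-> a (x) (c * b). *)
Definition scale_free (c : K) : {malg int[(A * K)%type]} -> base_change :=
  free_lift (fun ab => pure_tensor ab.1 (c * ab.2)).
HB.instance Definition _ c := GRing.Additive.copy (scale_free c)
  (free_lift (fun ab => pure_tensor ab.1 (c * ab.2))).

Definition scale_tensor (c : K) (t : base_change) : base_change :=
  scale_free c (repr t).

Lemma scale_freeU c a b : scale_free c << (a, b) >> = pure_tensor a (c * b).
Proof. exact: free_liftU. Qed.

Lemma scale_tensor_pi c p : scale_tensor c (\pi p) = scale_free c p.
Proof.
apply/eqP; rewrite -subr_eq0 /scale_tensor -raddfB; apply/eqP.
apply: (@zspan_ind _ _ (@tensor_relation A K)).
  move=> _ [[a [a' [b ->]]]|[a [b [b' ->]]]].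
    transitivity (pure_tensor (a + a') (c * b) - pure_tensor a (c * b)
                  - pure_tensor a' (c * b)).
      by rewrite raddf_subr3; congr (_ - _ - _); apply: scale_freeU.
    by rewrite pure_tensorDl addrAC addrK subrr.
  transitivity (pure_tensor a (c * (b + b')) - pure_tensor a (c * b)
                - pure_tensor a (c * b')).
    by rewrite raddf_subr3; congr (_ - _ - _); apply: scale_freeU.
  by rewrite mulrDr pure_tensorDr addrAC addrK subrr.
suff: repr (\pi_(tensor A K) p) - p \in @tensor_kernel A K by [].
by rewrite Quotient.idealrBE reprK.
Qed.

Lemma scale_tensor_zmod c : zmod_morphism (scale_tensor c).
Proof.
move=> s t; rewrite -[s]reprK -[t]reprK.
rewrite -[X in scale_tensor c X](raddfB \pi_(tensor A K)) !scale_tensor_pi.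
exact: raddfB.
Qed.
HB.instance Definition _ c := GRing.isZmodMorphism.Build base_change base_change
  (scale_tensor c) (scale_tensor_zmod c).

Lemma scale_pure_tensor c a b :
  scale_tensor c (pure_tensor a b) = pure_tensor a (c * b).
Proof. by rewrite {1}pure_tensor.unlock scale_tensor_pi scale_freeU. Qed.

Lemma tensor_additive_eq (M : zmodType) (f g : {additive base_change -> M}) :
  (forall a b, f (pure_tensor a b) = g (pure_tensor a b)) -> f =1 g.
Proof.
move=> fg t; rewrite -[t]reprK.
apply: (@malg_additive_eq _ _ (f \o \pi_(tensor A K)) (g \o \pi_(tensor A K))).
by case=> a b; have := fg a b; rewrite pure_tensor.unlock.
Qed.

Lemma scale_tensorA c d t :
  scale_tensor c (scale_tensor d t) = scale_tensor (c * d) t.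
Proof.
apply: (@tensor_additive_eq _ (scale_tensor c \o scale_tensor d)) t => a b /=.
by rewrite !scale_pure_tensor mulrA.
Qed.

Lemma scale_tensor1 : left_id 1 scale_tensor.
Proof.
by move=> t; apply: (@tensor_additive_eq _ _ idfun) t => a b /=; rewrite scale_pure_tensor mul1r.
Qed.

Lemma scale_tensorDr : right_distributive scale_tensor +%R.
Proof. by move=> c s t; rewrite raddfD. Qed.

Lemma scale_tensorDl t : {morph scale_tensor^~ t : c d / c + d}.
Proof.
move=> c d; apply: (@tensor_additive_eq _ _ (scale_tensor c \+ scale_tensor d)) t.
by move=> a b /=; rewrite !scale_pure_tensor mulrDl pure_tensorDr.
Qed.

HB.instance Definition _ := GRing.Zmodule_isLmodule.Build K base_change
  scale_tensorA scale_tensor1 scale_tensorDr scale_tensorDl.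

Definition extend_scalars (a : A) : base_change := pure_tensor a 1.

Definition generates_base_change (S : A -> Prop) : Prop :=
  forall t : base_change,
    exists (n : nat) (c : 'I_n -> K) (s : 'I_n -> A),
      (forall i, S (s i)) /\ t = \sum_(i < n) c i *: extend_scalars (s i).
End BaseChange.

(* Z[1/m] as a subring of the rationals, for m > 0. *)
Definition inv_pred (m : nat) : {pred rat} := fun x =>
  `[< exists (a : int) (k : nat), x = a%:~R / m%:R ^+ k >].

Lemma inv_pred_subring m : subring_closed (inv_pred m).
Proof.
have inv0 k : (0 : rat) ^+ k.+1 = 0 by rewrite expr0n.
split.
- by apply/asboolP; exists 1, 0%N; rewrite expr0 divr1.
- move=> x y /asboolP[a [k ->]] /asboolP[b [l ->]]; apply/asboolP.
  case: m => [|m].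
    case: k => [|k]; case: l => [|l]; rewrite ?inv0 ?expr0 ?invr0 ?mulr0 ?divr1.
    + by exists (a - b), 0%N; rewrite divr1 rmorphB.
    + by exists a, 0%N; rewrite divr1 subr0.
    + by exists (- b), 0%N; rewrite divr1 sub0r rmorphN.
    + by exists 0, 0%N; rewrite subr0 mul0r.
  exists (a * m.+1%:R ^+ l - b * m.+1%:R ^+ k), (k + l)%N.
  have m0 n : (m.+1%:R : rat) ^+ n != 0 by rewrite expf_neq0 // pnatr_eq0.
  rewrite rmorphB !rmorphM !rmorphXn /= !rmorph_nat exprD.
  by rewrite -[in LHS]mulNr addf_div // mulNr.
- move=> x y /asboolP[a [k ->]] /asboolP[b [l ->]]; apply/asboolP.
  exists (a * b), (k + l)%N; rewrite rmorphM exprD invfM; exact: mulrACA.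
Qed.

HB.instance Definition _ m :=
  GRing.isSubringClosed.Build rat (inv_pred m) (inv_pred_subring m).

Record Zinv (m : nat) := MkZinv { Zinv_val :> rat; _ : Zinv_val \in inv_pred m }.
HB.instance Definition _ m := [isSub for @Zinv_val m].
HB.instance Definition _ m := [Choice of Zinv m by <:].
HB.instance Definition _ m := [SubChoice_isSubComNzRing of Zinv m by <:].

Section Graphs.
Variable L : finType.

(* g (a, b) is the number of edges from a to b. *)
Definition graph := {ffun L * L -> nat}.

Definition edge (a b : L) : graph := [ffun e => nat_of_bool (e == (a, b))].

Definition graph_union (g h : graph) : graph := [ffun e => (g e + h e)%N].

Definition empty_graph : graph := [ffun=> 0%N].

(* A loop at v is counted twice, once as outgoing and once as incoming. *)
Definition valence (g : graph) (v : L) : nat :=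
  (\sum_(w : L) g (v, w) + \sum_(w : L) g (w, v))%N.

Definition regular_of_degree (k : nat) (g : graph) : Prop :=
  forall v, valence g v = k.

Definition is_regular : {pred graph} := fun g =>
  `[< exists k, regular_of_degree k g >].

Record regular_graph :=
  RegularGraph { graph_of :> {ffun L * L -> nat}; _ : is_regular graph_of }.
HB.instance Definition _ := [isSub for graph_of].
HB.instance Definition _ := [Choice of regular_graph by <:].

Lemma valence_union g h v :
  valence (graph_union g h) v = (valence g v + valence h v)%N.
Proof.
have sumU (e : L -> L * L) : (\sum_(w : L) graph_union g h (e w) =
    \sum_(w : L) g (e w) + \sum_(w : L) h (e w))%N.
  by rewrite -big_split; apply: eq_bigr => w _; rewrite ffunE.
by rewrite /valence (sumU (fun w => (v, w))) (sumU (fun w => (w, v))) addnACA.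
Qed.

Lemma valence_empty v : valence empty_graph v = 0%N.
Proof. by rewrite /valence !big1 // => w _; rewrite ffunE. Qed.

Lemma regular_empty : is_regular empty_graph.
Proof. by apply/asboolP; exists 0%N => v; rewrite valence_empty. Qed.

Lemma regular_union (g h : regular_graph) : is_regular (graph_union g h).
Proof.
have /asboolP[k gk] := valP g; have /asboolP[l hl] := valP h; apply/asboolP.
by exists (k + l)%N => v; rewrite valence_union gk hl.
Qed.

(* The semigroup includes the empty graph, of degree 0, as its unit. *)
Definition regular_one : regular_graph := RegularGraph regular_empty.
Definition regular_mul (g h : regular_graph) : regular_graph :=
  RegularGraph (regular_union g h).

Lemma regular_mulC : commutative regular_mul.
Proof. by move=> g h; apply/val_inj/ffunP => e; rewrite !ffunE addnC. Qed.

Lemma regular_mulA : associative regular_mul.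
Proof. by move=> g h l; apply/val_inj/ffunP => e; rewrite !ffunE addnA. Qed.

Lemma regular_mul1g : left_id regular_one regular_mul.
Proof. by move=> g; apply/val_inj/ffunP => e; rewrite !ffunE. Qed.

Lemma regular_mulg1 : right_id regular_one regular_mul.
Proof. by move=> g; rewrite regular_mulC regular_mul1g. Qed.

Lemma regular_mul_eq1 g h :
  regular_mul g h = regular_one -> g = regular_one /\ h = regular_one.
Proof.
move=> /(congr1 val)/ffunP gh; split; apply/val_inj/ffunP => e;
  move: (gh e); rewrite !ffunE => /eqP; rewrite addn_eq0 => /andP[/eqP ? /eqP ?] //.
Qed.

HB.instance Definition _ := Choice_isMonomialDef.Build regular_graph
  regular_mulA regular_mul1g regular_mulg1 regular_mul_eq1.
HB.instance Definition _ :=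
  MonomialDef_isConomialDef.Build regular_graph regular_mulC.

Definition semigroup_algebra := {malg int[regular_graph]}.
HB.instance Definition _ := GRing.ComNzRing.on semigroup_algebra.

Definition loop_relation (p : semigroup_algebra) : Prop :=
  exists (g : regular_graph) (a : L), (0 < g (a, a))%N /\ p = << g >>.

Definition sign_relation (p : semigroup_algebra) : Prop :=
  exists (g g' : regular_graph) (h : graph) (a b : L),
    [/\ g = graph_union h (edge a b) :> graph,
        g' = graph_union h (edge b a) :> graph
      & p = << g >> + << g' >>].

Definition plucker_relation (p : semigroup_algebra) : Prop :=
  exists (g g' g'' : regular_graph) (h : graph) (a b c d : L),
    [/\ g = graph_union h (graph_union (edge a b) (edge c d)) :> graph,
        g' = graph_union h (graph_union (edge a d) (edge c b)) :> graph,
        g'' = graph_union h (graph_union (edge a c) (edge b d)) :> graph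
      & p = << g >> - << g' >> - << g'' >>].

Definition ring_relation (p : semigroup_algebra) : Prop :=
  [\/ loop_relation p, sign_relation p | plucker_relation p].

Definition ring_ideal : {pred semigroup_algebra} := ideal_gen ring_relation.

Lemma has_edge_neq1 (g : regular_graph) e : (0 < g e)%N -> (g == mone) = false.
Proof. by move=> ge; apply/eqP => g1; move: ge; rewrite g1 ffunE. Qed.

Lemma ring_ideal_closed : idealr_closed ring_ideal.
Proof.
apply/ideal_gen_idealr/ideal_gen_proper => p.
have coef0 (g : regular_graph) e : (0 < g e)%N ->
    (<< g >> : semigroup_algebra)@_(@mone regular_graph) = 0.
  by move=> ge; rewrite mcoeffU1 (has_edge_neq1 ge).
case=> [[g [a [ga ->]]]|[g [g' [h [a [b [gE g'E ->]]]]]]|].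
- exact: coef0 ga.
- rewrite mcoeffD (coef0 g (a, b)) ?(coef0 g' (b, a)) ?addr0 //.
    by rewrite g'E !ffunE eqxx addn1.
  by rewrite gE !ffunE eqxx addn1.
- move=> [g [g' [g'' [h [a [b [c [d [gE g'E g''E ->]]]]]]]]].
  apply: mcoeff_subr3.
  + by apply: (coef0 _ (a, b)); rewrite gE !ffunE eqxx addnCA.
  + by apply: (coef0 _ (a, d)); rewrite g'E !ffunE eqxx addnCA.
  + by apply: (coef0 _ (a, c)); rewrite g''E !ffunE eqxx addnCA.
Qed.

HB.instance Definition _ :=
  isIdealr.Build semigroup_algebra ring_ideal ring_ideal_closed.

Definition Rring := {ideal_quot ring_ideal}.
HB.instance Definition _ := GRing.ComNzRing.on Rring.
End Graphs.

HB.lock Definition graph_class (L : finType) (g : regular_graph L) : Rring L :=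
  \pi_(Rring L) << g >>.

Section Relations.
Variable L : finType.
Local Notation graph := (graph L).
Local Notation regular_graph := (regular_graph L).
Local Notation Rring := (Rring L).

Lemma graph_classM (g h : regular_graph) :
  graph_class (mmul g h) = graph_class g * graph_class h.
Proof.
rewrite graph_class.unlock -[RHS](rmorphM \pi_Rring); congr (\pi_Rring _).
exact: esym (fgmulUU 1 1 g h).
Qed.

(* The degree k part R_L^(k), and V_L = R_L^(1). *)
Definition Rpart (k : nat) : {pred Rring} :=
  zspan (fun x => exists g : regular_graph, regular_of_degree k g /\ x = graph_class g).
HB.instance Definition _ k := GRing.ZmodClosed.on (Rpart k).

Record matching_space := MatchingSpace
  { matching_space_val :> Rring; _ : matching_space_val \in Rpart 1 }.
HB.instance Definition _ := [isSub for matching_space_val].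
HB.instance Definition _ := [Choice of matching_space by <:].
HB.instance Definition _ := [SubChoice_isSubZmodule of matching_space by <:].

Definition Sym_to_Rring : Sym matching_space -> Rring :=
  sym_lift (val : matching_space -> Rring).
HB.instance Definition _ := GRing.RMorphism.copy Sym_to_Rring
  (sym_lift (val : matching_space -> Rring)).

Definition relation_ideal : {pred Sym matching_space} :=
  fun s => Sym_to_Rring s == 0.

Definition relation_ideal2 : {pred Sym matching_space} :=
  fun s => (s \in relation_ideal) && (s \in @sym_part matching_space 2).

Lemma relation_ideal2_closed : zmod_closed relation_ideal2.
Proof.
split=> [|s t /andP[/eqP s0 s2] /andP[/eqP t0 t2]]; apply/andP; split.
- by apply/eqP; exact: raddf0.
- exact: rpred0.
- by apply/eqP; rewrite raddfB /= s0 t0 subrr.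
- exact: rpredB.
Qed.

HB.instance Definition _ :=
  GRing.isZmodClosed.Build (Sym matching_space) relation_ideal2
    relation_ideal2_closed.

(* I_L^(2) as an abelian group. *)
Record I2 := MkI2 { I2_val :> Sym matching_space; _ : I2_val \in relation_ideal2 }.
HB.instance Definition _ := [isSub for I2_val].
HB.instance Definition _ := [Choice of I2 by <:].
HB.instance Definition _ := [SubChoice_isSubZmodule of I2 by <:].

(* A matching on A \subset L, seen as a graph on L with no edge touching the
   complement of A. *)
Definition matching_on (A : {set L}) (g : graph) : Prop :=
  forall v, valence g v = (v \in A).

(* v is the element X_g of V_L, where g is a matching on L. *)
Definition is_class_of (g : graph) (v : matching_space) : Prop :=
  exists m : regular_graph,
    [/\ m = g :> graph, regular_of_degree 1 g & val v = graph_class m].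

Definition simple_binomial (s : Sym matching_space) : Prop :=
  exists (U : {set L}) (D D' G G' : graph) (x y z t : matching_space),
    [/\ #|U| = 4%N,
        matching_on U D /\ matching_on U D',
        matching_on (~: U) G /\ matching_on (~: U) G',
        [/\ is_class_of (graph_union G D) x, is_class_of (graph_union G' D') y,
            is_class_of (graph_union G D') z & is_class_of (graph_union G' D) t]
      & s = sym x * sym y - sym z * sym t].

Lemma simple_binomial_relation s : simple_binomial s -> s \in relation_ideal2.
Proof.
case=> U [D [D' [G [G' [x [y [z [t [_ _ _ [[mx [xE _ xX]] [my [yE _ yX]] [mz [zE _ zX]] [mt [tE _ tX]]] ->]]]]]]]]].
apply/andP; split.
  apply/eqP; transitivity (val x * val y - val z * val t).
    by rewrite rmorphB !rmorphM /= /Sym_to_Rring !sym_lift_sym.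
  rewrite xX yX zX tX -!graph_classM; apply/eqP; rewrite subr_eq0; apply/eqP.
  congr (graph_class _); apply/val_inj/ffunP => e.
  rewrite !ffunE xE yE zE tE !ffunE.
  by rewrite addnACA [RHS]addnACA [(D e + _)%N]addnC.
have sym2 u v : sym u * sym v \in @sym_part matching_space 2.
  apply: mem_zspan; exists (fun i : 'I_2 => if i == 0 then u else v).
  by rewrite big_ord_recl big_ord1.
by rewrite rpredB.
Qed.

Lemma class_of_union (U : {set L}) (D G : graph) :
  matching_on U D -> matching_on (~: U) G ->
  exists v, is_class_of (graph_union G D) v.
Proof.
move=> DU GU.
have GD1 : regular_of_degree 1 (graph_union G D).
  by move=> v; rewrite valence_union DU GU inE; case: (v \in U).
have GDr : is_regular (graph_union G D) by apply/asboolP; exists 1%N.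
pose m := RegularGraph GDr.
have mV : graph_class m \in Rpart 1 by apply: mem_zspan; exists m.
by exists (MatchingSpace mV), m.
Qed.
End Relations.

Definition generated_by_simple_binomials (N : nat) (L : finType) : Prop :=
  @generates_base_change (Zinv (2 * N)%N) (I2 L)
    (fun r => simple_binomial (val r)).

(* Main.v *)
Require Import Defs.
From HB Require Import structures.
From mathcomp Require Import all_boot all_order all_algebra.
From mathcomp Require Import boolp zify.
From mathcomp Require Import monalg.
Set Implicit Arguments.
Unset Strict Implicit.
Unset Printing Implicit Defensive.
Import GRing.Theory Num.Theory.
Local Open Scope quotient_scope.
Local Open Scope ring_scope.

(** Let [Q] be the quotient of [Sym V_L] by the elements that some power of
[2N] carries into the span of the simple binomial relations ([Squot]). It has
no 2-torsion, and the theorem says that a quadratic element which vanishes in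
[R_L] vanishes in [Q] ([saturated_generated]).

A loopless graph of degree two is a disjoint union of cycles, so it is recorded
as a list of cyclic words. In [R_L] the class of such a list behaves like the
product of the traces of its words, the letters being traceless 2 x 2 matrices:
it is invariant under rotation of a word, gets the sign (-1)^|u| when [u] is
reversed, and tr(u) tr(v) = tr(u v) + (-1)^|u| tr(u' v) where u' is [u]
reversed. These are the sign and Pluecker relations ([trace],
[graph_trace_trace]). Conversely a function on lists of words that satisfies
them is a function on graphs that satisfies the loop, sign and Pluecker
relations ([graph_function_plucker]): a graph determines its cycles up to
rotation, reversal and order ([word_value_unique]), and exchanging two edges
either joins two words or cuts a word in two. It therefore defines a map on
[R_L] ([Rring_lift]).

The edges of a list of even words can be coloured alternately, which gives a
product of two matchings in [Q] ([color_trace]). It is enough to extend this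
function to a trace on all lists, for then the resulting map from [R_L]
recovers each product of two matchings in [Q] ([Psi_pair]) and the map
from quadratic elements to [Q] factors through [R_L] ([relation_saturated]).
The number of odd words being even, they can be joined in pairs, with the value
tr(o) tr(p) = tr(o p) - tr(o' p) that the trace relation forces
([extend_trace]). Three things must be proved: changing the colours of a single
word does not matter ([colored_rot1]), an odd word may be rotated
([splice_rot]), and the choice of the pairs does not matter
([colored_exchanges]).

Each is the vanishing of a defect, and one argument serves for all of them
([antisymmetric_vanish], [even_trace_vanish], [window_vanish]). The assumption
on the complement of two vertices [a] and [b], multiplied by the square of the
edge [ab], says that the three properties hold for lists that contain the
two-letter word [ab] ([pair_trace]). By the trace relation, exchanging two
adjacent letters of a word changes the sign of the defect up to a term with a
two-letter word, which vanishes. Reversing a block of four letters is an even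
permutation, hence leaves the defect unchanged. But reversing it also changes
the sign, up to a term where the block is a separate word, and twice a
four-letter word is a combination of products of two-letter words
([four_expand]). For a block of four letters the only relation used is the
simple binomial one. So twice the defect is zero.

The argument needs a word of at least four letters. The pairing defect involves
four odd words, of at least three letters each because one-letter words are
loops. If they are all triangles and exhaust [L] then [L] has twelve elements;
in all other cases the defect vanishes. *)

(** * Linear identities in abelian groups *)

Inductive zmod_expr : Type :=
| ZVar of nat | ZZero | ZAdd of zmod_expr & zmod_expr | ZOpp of zmod_expr.

Fixpoint zmod_eval (Q : zmodType) (env : seq Q) (x : zmod_expr) : Q :=
  match x with
  | ZVar i => env`_i
  | ZZero => 0
  | ZAdd a b => zmod_eval env a + zmod_eval env b
  | ZOpp a => - zmod_eval env a
  end.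

Fixpoint zmod_coef (x : zmod_expr) (i : nat) : int :=
  match x with
  | ZVar j => (i == j)%:Z
  | ZZero => 0
  | ZAdd a b => zmod_coef a i + zmod_coef b i
  | ZOpp a => - zmod_coef a i
  end.

Lemma zmod_eval_coef (Q : zmodType) (env : seq Q) x :
  zmod_eval env x = \sum_(i < size env) env`_i *~ zmod_coef x i.
Proof.
elim: x => [j||a IHa b IHb|a IHa] /=.
- have [lt_j|le_j] := ltnP j (size env); last first.
    rewrite nth_default // big1 // => i _; rewrite ltn_eqF ?mulr0z //.
    exact: leq_trans (ltn_ord i) le_j.
  rewrite (bigD1 (Ordinal lt_j)) //= eqxx mulr1z big1 ?addr0 // => i ne_ij.
  by rewrite -[j]/(val (Ordinal lt_j)) (inj_eq val_inj) (negPf ne_ij) mulr0z.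
- by rewrite big1 // => i _; rewrite mulr0z.
- by rewrite IHa IHb -big_split; apply: eq_bigr => i _; rewrite mulrzDr.
- by rewrite IHa -sumrN; apply: eq_bigr => i _; rewrite mulrNz.
Qed.

Lemma zmod_eval_eq (Q : zmodType) (env : seq Q) x y :
  all (fun i => zmod_coef x i == zmod_coef y i) (iota 0 (size env)) ->
  zmod_eval env x = zmod_eval env y.
Proof.
move=> /allP eq_xy; rewrite !zmod_eval_coef; apply: eq_bigr => i _.
by rewrite (eqP (eq_xy i _)) // mem_iota /=.
Qed.

Ltac zmod_mem x env :=
  lazymatch env with
  | nil => constr:(false)
  | x :: _ => constr:(true)
  | _ :: ?env' => zmod_mem x env'
  end.
Ltac zmod_index x env :=
  lazymatch env with
  | x :: _ => constr:(0%N)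
  | _ :: ?env' => let n := zmod_index x env' in constr:(n.+1)
  end.
Ltac zmod_atoms t env :=
  lazymatch t with
  | (?a + ?b)%R => let env := zmod_atoms a env in zmod_atoms b env
  | (- ?a)%R => zmod_atoms a env
  | (0)%R => env
  | _ => lazymatch zmod_mem t env with true => env | false => constr:(t :: env) end
  end.
Ltac zmod_reify t env :=
  lazymatch t with
  | (?a + ?b)%R =>
      let a := zmod_reify a env in let b := zmod_reify b env in constr:(ZAdd a b)
  | (- ?a)%R => let a := zmod_reify a env in constr:(ZOpp a)
  | (0)%R => constr:(ZZero)
  | _ => let n := zmod_index t env in constr:(ZVar n)
  end.
(** Compares the integer coefficients of the atoms of the two sides. *)
Ltac zmod :=
  lazymatch goal with
  | |- @eq ?Q ?x ?y =>
    let env := zmod_atoms x (@nil Q) in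
    let env := zmod_atoms y env in
    let x' := zmod_reify x env in
    let y' := zmod_reify y env in
    exact (@zmod_eval_eq _ env x' y' isT)
  end.

Lemma eq_of_sub (Q : zmodType) (a b x y : Q) : x - y = a - b -> a = b -> x = y.
Proof. by move=> e ab; apply/eqP; rewrite -subr_eq0 e ab subrr. Qed.

(** * Traces on lists of cyclic words *)

Definition signed (Q : zmodType) (b : bool) (x : Q) : Q := if b then - x else x.

Section Signed.
Variable A : zmodType.
Implicit Types (b : bool) (x y : A).

Lemma signedN b x : signed b (- x) = - signed b x.
Proof. by case: b. Qed.
Lemma signed_neg b x : signed (~~ b) x = - signed b x.
Proof. by case: b; rewrite /= ?opprK. Qed.
Lemma signedK b : involutive (@signed A b).
Proof. by case: b => x; rewrite /= ?opprK. Qed.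
Lemma signed_signed b b' x : signed b (signed b' x) = signed (b (+) b') x.
Proof. by case: b; case: b'; rewrite /= ?opprK. Qed.
Lemma signedMn b x n : signed b (x *+ n) = signed b x *+ n.
Proof. by case: b; rewrite //= mulNrn. Qed.
Lemma signedD b x y : signed b (x + y) = signed b x + signed b y.
Proof. by case: b; rewrite //= opprD. Qed.
End Signed.

Definition even_word (T : Type) (w : seq T) : bool := ~~ odd (size w).

Lemma rot_invariant (T A : Type) (F : seq T -> A) : (forall w, F (rot 1 w) = F w) ->
  forall k w, F (rot k w) = F w.
Proof.
move=> F1 k w; have [le_k|lt_k] := leqP k (size w); last by rewrite rot_oversize // ltnW.
elim: k le_k => [|k IHk] lt_k; first by rewrite rot0.
by rewrite -[k.+1]add1n rotD // F1 IHk // ltnW.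
Qed.

Lemma rot_invariant_catC (T A : Type) (F : seq T -> A) u v : (forall w, F (rot 1 w) = F w) ->
  F (u ++ v) = F (v ++ u).
Proof. by move=> F1; rewrite -(rot_size_cat u v) rot_invariant. Qed.

Section Words.
Variables (T : eqType) (Q : zmodType).
Implicit Types (f B : seq (seq T) -> Q) (w u v o : seq T) (ws es os : seq (seq T)).

Definition all_even ws := all (@even_word T) ws.

(** The relations between products of traces of words in traceless 2 x 2
matrices, whose adjugate is their opposite. Their consequence for the empty
word is that it stands for the trace 2 of the identity matrix. *)
Record trace f : Prop := Trace {
  tr_perm : forall ws ws', perm_eq ws ws' -> f ws = f ws';
  tr_rot : forall w ws, f (rot 1 w :: ws) = f (w :: ws);
  tr_rev : forall w ws, f (rev w :: ws) = signed (odd (size w)) (f (w :: ws));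
  tr_join : forall u v ws, f (u :: v :: ws) =
    f ((u ++ v) :: ws) + signed (odd (size u)) (f ((rev u ++ v) :: ws)) }.

(** The value 0 on lists with an odd word makes most identities between even
words true without any condition of parity. *)
Record even_trace f : Prop := EvenTrace {
  et_odd : forall ws, ~~ all_even ws -> f ws = 0;
  et_perm : forall ws ws', perm_eq ws ws' -> f ws = f ws';
  et_rot : forall w ws, f (rot 1 w :: ws) = f (w :: ws);
  et_rev : forall w ws, f (rev w :: ws) = f (w :: ws);
  et_join : forall u v ws, even_word u -> even_word v ->
    f (u :: v :: ws) = f ((u ++ v) :: ws) + f ((rev u ++ v) :: ws) }.

(** The value that [tr_join] forces on a pair of odd words. *)
Definition splice B o1 o2 es : Q := B ((o1 ++ o2) :: es) - B ((rev o1 ++ o2) :: es).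

(** The junk value for an odd number of odd words is harmless: the letters of
the lists of interest form a set of even cardinality. *)
Fixpoint pair_up B os es : Q :=
  match os with
  | [::] => B es
  | [:: _] => 0
  | o1 :: o2 :: os' => pair_up (splice B o1 o2) os' es
  end.

Definition odds ws := filter (predC (@even_word T)) ws.
Definition evens ws := filter (@even_word T) ws.
Definition extend_trace B ws : Q := pair_up B (odds ws) (evens ws).

Hypothesis Q2 : forall x : Q, x + x = 0 -> x = 0.

(** Reversing four letters takes six adjacent transpositions, so antisymmetry
makes [f] invariant under a reversal that changes its sign. *)
Lemma antisymmetric_vanish (f : seq T -> Q) :
  (forall p x y t, f (p ++ x :: y :: t) = - f (p ++ y :: x :: t)) ->
  (forall a b c d t, f [:: a, b, c, d & t] + f [:: d, c, b, a & t] = 0) ->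
  forall a b c d t, f [:: a, b, c, d & t] = 0.
Proof.
move=> anti rev4 a b c d t; apply: Q2; rewrite -[RHS](rev4 a b c d t); congr (_ + _).
rewrite (anti [::]) (anti [:: b]) (anti [:: b; c]) /=.
by rewrite (anti [::] b) (anti [:: c] b) (anti [::] c) /= !opprK.
Qed.

(** The identity 2 tr(abcd) = tr(ab) tr(cd) - tr(ac) tr(db) + tr(bc) tr(ad) of
traceless 2 x 2 matrices: each product on the right is the sum of the values of
two of the three cyclic orders of the letters. *)
Lemma four_expand f :
  (forall w ws, f (rev w :: ws) = f (w :: ws)) ->
  (forall u v ws, even_word u -> even_word v ->
    f (u :: v :: ws) = f ((u ++ v) :: ws) + f ((rev u ++ v) :: ws)) ->
  (forall a b c d ws, f ([:: b; c; d; a] :: ws) = f ([:: a; b; c; d] :: ws)) ->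
  forall a b c d ws,
  f ([:: a; b; c; d] :: ws) + f ([:: a; b; c; d] :: ws) =
  f ([:: a; b] :: [:: c; d] :: ws) - f ([:: a; c] :: [:: d; b] :: ws)
  + f ([:: b; c] :: [:: a; d] :: ws).
Proof.
move=> fr fj f4 a b c d ws; rewrite !fj //= /rev /=.
have -> : f ([:: c; b; a; d] :: ws) = f ([:: a; b; c; d] :: ws).
  by rewrite -fr /rev /= (f4 d).
have -> : f ([:: a; c; d; b] :: ws) = f ([:: b; a; c; d] :: ws) by rewrite f4.
have -> : f ([:: c; a; d; b] :: ws) = f ([:: b; c; a; d] :: ws) by rewrite f4.
zmod.
Qed.

Lemma even_trace_catC f u v ws : even_trace f -> f ((u ++ v) :: ws) = f ((v ++ u) :: ws).
Proof. by move=> ft; apply: (rot_invariant_catC (F := fun w => f (w :: ws))) => w; apply: et_rot. Qed.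

Lemma even_trace_swap f u v ws : even_trace f -> f (u :: v :: ws) = f (v :: u :: ws).
Proof. by move=> ft; apply: (et_perm ft); apply: permEl (perm_catCA [:: u] [:: v] ws). Qed.

Lemma even_word_cat u v : even_word (u ++ v) = (even_word u == even_word v).
Proof. by rewrite /even_word size_cat oddD; case: odd; case: odd. Qed.

Lemma even_word_rev u : even_word (rev u) = even_word u.
Proof. by rewrite /even_word size_rev. Qed.

(** Rotation brings the block [s] to the front of the word, where the join
relation applies; when the letters around [s] are in odd number both sides
vanish. *)
Lemma even_trace_window f p s t ws : even_trace f -> even_word s ->
  f ((p ++ s ++ t) :: ws) + f ((p ++ rev s ++ t) :: ws) = f (s :: (p ++ t) :: ws).
Proof.
move=> ft s_even; have [pt_even|pt_odd] := boolP (even_word (p ++ t)); last first.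
  have ps_odd r : even_word r -> ~~ even_word (p ++ r ++ t).
    by move: pt_odd; rewrite !even_word_cat => + ->; case: even_word; case: even_word.
  rewrite !(et_odd ft) ?addr0 //= ?(negPf pt_odd) ?andbF //.
    by rewrite (negPf (ps_odd _ _)) ?even_word_rev.
  by rewrite (negPf (ps_odd _ _)).
have pt_even' : even_word (t ++ p) by rewrite even_word_cat eq_sym -even_word_cat.
by rewrite !(even_trace_catC p) // -!catA -et_join // even_trace_swap // even_trace_catC // even_trace_swap.
Qed.

(** Two-letter words generate: a word of four letters is half a combination of
products of such words, and on longer words [f] is antisymmetric while it changes
sign under the reversal of a block of four letters. *)
Lemma even_trace_vanish f e ws : even_trace f ->
  (forall x y es, f ([:: x; y] :: es) = 0) -> e != [::] -> f (e :: ws) = 0.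
Proof.
move=> ft f2 e0.
have [e_even|e_odd] := boolP (even_word e); last by rewrite et_odd //= (negPf e_odd).
have f4 a b c d us : f ([:: a; b; c; d] :: us) = 0.
  apply: Q2; rewrite four_expand ?f2 ?subr0 ?addr0 //; first exact: et_rev.
    exact: et_join.
  by move=> x y z t vs; rewrite -[RHS](et_rot ft).
case: e e0 e_even => [|a [|b [|c [|d t]]]] // _ _.
apply: (antisymmetric_vanish (f := fun w => f (w :: ws))) => [p x y s|{}a {}b {}c {}d {}t].
  apply/eqP; rewrite -addr_eq0; apply/eqP.
  by rewrite (even_trace_window p (s := [:: x; y])).
have := @even_trace_window f [::] [:: a; b; c; d] t ws ft isT; by rewrite f4.
Qed.

(** [D es z] stands for a combination of values of an even trace on lists made
of [es], fixed words, and one word in which [z] or its reversal is a factor.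
Cutting a block of even length out of [z] then adds it to [es]. *)
Record window (D : seq (seq T) -> seq T -> Q) : Prop := Window {
  win_trace : forall z, even_trace (D^~ z);
  win_split : forall es p s t, even_word s ->
    D es (p ++ s ++ t) + D es (p ++ rev s ++ t) = D (s :: es) (p ++ t) }.

(** Cutting out a block of two letters shows that [D es] is antisymmetric,
cutting out a block of four that reversing it changes the sign. *)
Lemma window_vanish D es z : window D ->
  (forall x y us v, D ([:: x; y] :: us) v = 0) -> (3 < size z)%N -> D es z = 0.
Proof.
move=> Dw D2; case: z => [|a [|b [|c [|d t]]]] // _.
apply: (antisymmetric_vanish (f := D es)) => [p x y s|{}a {}b {}c {}d {}t].
  apply/eqP; rewrite -addr_eq0; apply/eqP.
  by rewrite (win_split Dw es p (s := [:: x; y])).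
have /= -> := win_split Dw es [::] t (s := [:: a; b; c; d]) isT.
exact: (even_trace_vanish (f := D^~ t)) (win_trace Dw t) _ _.
Qed.

Lemma even_traceD f g : even_trace f -> even_trace g -> even_trace (fun es => f es + g es).
Proof.
move=> ft gt; split=> [ws o|ws ws' p|w ws|w ws|u v ws ue ve].
- by rewrite !et_odd // addr0.
- by rewrite (et_perm ft p) (et_perm gt p).
- by rewrite !et_rot.
- by rewrite !et_rev.
- by rewrite (et_join ft) // (et_join gt) //; zmod.
Qed.

Lemma even_traceN f : even_trace f -> even_trace (fun es => - f es).
Proof.
move=> ft; split=> [ws o|ws ws' p|w ws|w ws|u v ws ue ve].
- by rewrite !et_odd // oppr0.
- by rewrite (et_perm ft p).
- by rewrite !et_rot.
- by rewrite !et_rev.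
- by rewrite (et_join ft) //; zmod.
Qed.

Lemma even_trace_cons f u : even_trace f -> even_trace (fun es => f (u :: es)).
Proof.
move=> ft; split=> [ws o|ws ws' p|w ws|w ws|v w ws ve we].
- by rewrite et_odd //= (negPf o) andbF.
- by rewrite (et_perm ft (ws' := u :: ws')) // perm_cons.
- by rewrite !(even_trace_swap u) // et_rot.
- by rewrite !(even_trace_swap u) // et_rev.
- have sw3 : f (u :: v :: w :: ws) = f (v :: w :: u :: ws).
    by apply: (et_perm ft); apply: permEl (perm_catCA [:: u] [:: v; w] ws).
  by rewrite sw3 et_join // !(even_trace_swap u).
Qed.

Lemma even_trace_splice f u v : even_trace f -> even_trace (splice f u v).
Proof.
by move=> ft; apply: even_traceD; [|apply: even_traceN]; apply: even_trace_cons.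
Qed.

Lemma windowD D E : window D -> window E -> window (fun es z => D es z + E es z).
Proof.
move=> Dw Ew; split=> [z|es p s t se]; first exact: even_traceD (win_trace Dw z) (win_trace Ew z).
by rewrite -(win_split Dw) // -(win_split Ew) //; zmod.
Qed.

Lemma windowN D : window D -> window (fun es z => - D es z).
Proof.
move=> Dw; split=> [z|es p s t se]; first exact: even_traceN (win_trace Dw z).
by rewrite -(win_split Dw) //; zmod.
Qed.

Lemma window_atom f u v : even_trace f -> window (fun es z => f ((u ++ z ++ v) :: es)).
Proof.
move=> ft; split=> [z|es p s t se]; first exact: even_trace_cons.
rewrite -!catA !(catA u) even_trace_window // -!catA even_trace_swap //.
Qed.

Lemma window_atom_rev f u v : even_trace f -> window (fun es z => f ((u ++ rev z ++ v) :: es)).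
Proof.
move=> ft; split=> [z|es p s t se]; first exact: even_trace_cons.
rewrite !rev_cat -!catA !(catA u) revK addrC.
have := @even_trace_window f (u ++ rev t) s (rev p ++ v) es ft se.
by rewrite -!catA => ->; rewrite even_trace_swap.
Qed.

(** ** Joining odd words in pairs *)

Lemma pair_up_ext f g os es : f =1 g -> pair_up f os es = pair_up g os es.
Proof.
have [m] := ubnP (size os); elim: m f g os => // m IHm f g [|o1 [|o2 os]] //= lt_m fg.
by apply: IHm => [|ws]; [rewrite -ltnS ltnW | rewrite /splice !fg].
Qed.

Lemma pair_upD f g os es :
  pair_up (fun ws => f ws + g ws) os es = pair_up f os es + pair_up g os es.
Proof.
have [m] := ubnP (size os); elim: m f g os => // m IHm f g [|o1 [|o2 os]] //= lt_m.
  by rewrite addr0.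
rewrite -IHm; last by rewrite -ltnS ltnW.
by apply: pair_up_ext => ws; rewrite /splice; zmod.
Qed.

Lemma pair_upN f os es : pair_up (fun ws => - f ws) os es = - pair_up f os es.
Proof.
have [m] := ubnP (size os); elim: m f os => // m IHm f [|o1 [|o2 os]] //= lt_m.
  by rewrite oppr0.
rewrite -IHm; last by rewrite -ltnS ltnW.
by apply: pair_up_ext => ws; rewrite /splice; zmod.
Qed.

Lemma pair_up_cons f w os es : even_trace f ->
  pair_up (fun ws => f (w :: ws)) os es = pair_up f os (w :: es).
Proof.
have [m] := ubnP (size os); elim: m f os => // m IHm f [|o1 [|o2 os]] //= lt_m ft.
rewrite -IHm; first last.
- exact: even_trace_splice.
- by rewrite -ltnS ltnW.
by apply: pair_up_ext => ws; rewrite /splice !(even_trace_swap w).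
Qed.

Lemma even_trace_pair_up f os : even_trace f -> even_trace (pair_up f os).
Proof.
have [m] := ubnP (size os); elim: m f os => // m IHm f [|o1 [|o2 os]] //= lt_m ft.
- by split=> *; rewrite ?addr0.
- by apply: IHm; [rewrite -ltnS ltnW | apply: even_trace_splice].
Qed.

Lemma splice_sym f u v es : even_trace f -> splice f u v es = splice f v u es.
Proof.
move=> ft; rewrite /splice even_trace_catC //; congr (_ - _).
by rewrite -(et_rev ft) rev_cat revK.
Qed.

Lemma splice_swap f a b c d es : even_trace f ->
  splice (splice f a b) c d es = splice (splice f c d) a b es.
Proof.
move=> ft; rewrite /splice !(even_trace_swap (a ++ b)) // !(even_trace_swap (rev a ++ b)) //.
by zmod.
Qed.

(** The pairs (o1 o2)(o3 o4) may be replaced by (o1 o3)(o2 o4). With the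
symmetry of [splice] this generates all changes of pairs. *)
Definition exchanges f := forall es o1 o2 o3 o4,
  ~~ even_word o1 -> ~~ even_word o2 -> ~~ even_word o3 -> ~~ even_word o4 ->
  splice (splice f o1 o2) o3 o4 es = splice (splice f o1 o3) o2 o4 es.

Lemma exchanges_splice f a b : even_trace f -> exchanges f -> exchanges (splice f a b).
Proof.
move=> ft fx es o1 o2 o3 o4 h1 h2 h3 h4.
have front p q r s : splice (splice (splice f a b) p q) r s es =
    splice (splice f p q) r s ((a ++ b) :: es)
    - splice (splice f p q) r s ((rev a ++ b) :: es).
  have rot3 x y z : f (x :: y :: z :: es) = f (y :: z :: x :: es).
    by apply: (et_perm ft); apply: permEl (perm_catCA [:: x] [:: y; z] es).
  by rewrite /splice !(rot3 (a ++ b)) !(rot3 (rev a ++ b)); zmod.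
by rewrite !front !(fx _ o1 o2).
Qed.

Lemma pair_up_transp f p x y q es : even_trace f -> exchanges f ->
  all (predC (@even_word T)) (p ++ x :: y :: q) ->
  pair_up f (p ++ x :: y :: q) es = pair_up f (p ++ y :: x :: q) es.
Proof.
have [m] := ubnP (size p); elim: m f p q => // m IHm f [|z [|z' p]] q /= lt_m ft fx.
- by move=> _; apply: pair_up_ext => ws; apply: splice_sym.
- case: q => [|w q] //= /and5P[hz hx hy hw _].
  by apply: pair_up_ext => ws; apply: fx.
- case/and3P=> _ _ all_odd; apply: IHm => //.
  + by rewrite -ltnS ltnW.
  + exact: even_trace_splice.
  + exact: exchanges_splice.
Qed.
Lemma even_trace_nil f w ws : even_trace f -> f ([::] :: w :: ws) = f (w :: ws) + f (w :: ws).
Proof.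
move=> ft; have [ev|od] := boolP (even_word w); first by rewrite et_join.
by rewrite !(et_odd ft) ?addr0 //= (negPf od).
Qed.

Lemma splice_nil f u v es : even_trace f ->
  splice f u v ([::] :: es) = splice f u v es + splice f u v es.
Proof.
by move=> ft; rewrite /splice !(even_trace_swap _ [::]) // !even_trace_nil //; zmod.
Qed.

Lemma even_trace_reduce f ws : even_trace f ->
  (forall x y es, f ([:: x; y] :: es) = 0) ->
  (forall es, f ([::] :: es) = f es + f es) -> f [::] = 0 -> f ws = 0.
Proof.
move=> ft f2 fnil f0; elim: ws => [|[|a w] ws IHws] //.
  by rewrite fnil IHws addr0.
exact: even_trace_vanish.
Qed.

Lemma window_ext D E : (forall es z, D es z = E es z) -> window D -> window E.
Proof.
move=> DE Dw; split=> [z|es p s t se]; last by rewrite -!DE win_split.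
have [ode prm rt rv jn] := win_trace Dw z.
by split=> *; rewrite -!DE; [apply: ode | apply: prm | apply: rt | apply: rv | apply: jn].
Qed.
End Words.

Lemma transpositions_generate (T : eqType) (A : Type) (P : pred T) (F : seq T -> A) s s' :
  (forall p x y q, all P (p ++ x :: y :: q) -> F (p ++ x :: y :: q) = F (p ++ y :: x :: q)) ->
  perm_eq s s' -> all P s -> F s = F s'.
Proof.
elim: s F s' => [|x s IHs] F s' swapF; first by move=> /perm_size/esym/size0nil->.
move=> eq_s /= /andP[Px Ps].
have := perm_mem eq_s x; rewrite mem_head => /esym x_s'.
case/splitPr: s' / x_s' eq_s => p q.
rewrite -(cat1s x q) perm_sym perm_catCA /= perm_cons perm_sym => eq_s.
rewrite (IHs (fun s => F (x :: s)) (p ++ q)) //; last first.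
  by move=> p' y z q' all_P; apply: (swapF (x :: p')); rewrite /= Px.
have : all P (p ++ q) by rewrite -(perm_all _ eq_s).
elim/last_ind: p q {eq_s} => // p y IHp q; rewrite cat_rcons => all_P.
rewrite IHp // cat_rcons swapF //.
by move: all_P; rewrite !all_cat /= Px => /and3P[-> -> ->].
Qed.

(** * The induction step for lists of words *)

Section Core.
Variables (T : eqType) (Q : zmodType) (n : nat) (B : seq (seq T) -> Q).
Implicit Types (w u v o : seq T) (ws es os : seq (seq T)).
Hypothesis Q2 : forall x : Q, x + x = 0 -> x = 0.

(** What alternate colouring gives at once. Rotating a word by one letter
exchanges its two colours, which is free when it is done to all words, and is
the simple binomial relation for a word of four letters. *)
Record colored_trace (B : seq (seq T) -> Q) : Prop := ColoredTrace {
  ct_odd : forall ws, ~~ all_even ws -> B ws = 0;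
  ct_perm : forall ws ws', perm_eq ws ws' -> B ws = B ws';
  ct_rotall : forall ws, B (map (rot 1) ws) = B ws;
  ct_rot2 : forall w ws, B (rot 2 w :: ws) = B (w :: ws);
  ct_rev : forall w ws, B (rev w :: ws) = B (w :: ws);
  ct_join : forall u v ws, even_word u -> even_word v ->
    B (u :: v :: ws) = B ((u ++ v) :: ws) + B ((rev u ++ v) :: ws);
  ct_four : forall a b c d ws, B ([:: b; c; d; a] :: ws) = B ([:: a; b; c; d] :: ws) }.

Hypothesis Bc : colored_trace B.
Hypothesis Bsize : forall ws, size (flatten ws) != n -> B ws = 0.
Hypothesis IH : forall a b, trace (fun ws => extend_trace B ([:: a; b] :: ws)).

Lemma trace_rotall (f : seq (seq T) -> Q) us ws : trace f ->
  f (us ++ map (rot 1) ws) = f (us ++ ws).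
Proof.
move=> ft; elim: ws us => [|w ws IHws] us //=.
rewrite -cat_rcons IHws cat_rcons.
rewrite (tr_perm ft (permEl (perm_catCA us [:: rot 1 w] ws))) /= tr_rot //.
exact/(tr_perm ft)/permEl/(perm_catCA [:: w] us ws).
Qed.

Lemma extend_even ws : all_even ws -> extend_trace B ws = B ws.
Proof.
move=> ev_ws; rewrite /extend_trace /evens (all_filterP ev_ws) /odds.
suff -> : filter (predC (@even_word T)) ws = [::] by [].
by apply/eqP; rewrite -(negbK (_ == _)) -has_filter has_predC negbK.
Qed.

Lemma all_even_cat us ws : all_even (us ++ ws) = all_even us && all_even ws.
Proof. exact: all_cat. Qed.

Lemma all_even_rot ws : all_even (map (rot 1) ws) = all_even ws.
Proof.
by rewrite /all_even all_map; apply: eq_all => w; rewrite /even_word /= size_rot.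
Qed.

Lemma pair_rotall x y us ws : all_even us -> all_even ws ->
  B ([:: x; y] :: us ++ map (rot 1) ws) = B ([:: x; y] :: us ++ ws).
Proof.
move=> ev_us ev_ws; have := trace_rotall us ws (IH x y).
by rewrite !extend_even //= all_even_cat ?all_even_rot ev_us.
Qed.

Lemma colored_rot_others w ws : B (rot 1 w :: ws) = B (w :: map (rot 1) ws).
Proof.
rewrite -(ct_rotall Bc) /= -[RHS](ct_rot2 Bc); congr (B (_ :: _)).
by case: w => [|a [|b w]] //; rewrite -rotD.
Qed.

Let swap_defect ws w := B (w :: map (rot 1) ws) - B (w :: ws).

Lemma swap_defect_rot1 ws a w : swap_defect ws (rcons w a) = - swap_defect ws (a :: w).
Proof.
rewrite /swap_defect -rot1_cons (colored_rot_others _ ws).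
rewrite (ct_rotall Bc ((a :: w) :: ws) : B (rot 1 (a :: w) :: _) = _).
by zmod.
Qed.

Lemma swap_defect_cat ws u v : swap_defect ws (u ++ v) =
  signed (odd (size u)) (swap_defect ws (v ++ u)).
Proof.
elim: u v => [|a u IHu] v /=; first by rewrite cats0.
rewrite -[swap_defect ws (a :: _)]opprK -swap_defect_rot1 rcons_cat IHu cat_rcons.
by rewrite /signed; case: odd => //=; rewrite opprK.
Qed.

(** Rotating one word is the same as changing the colours of the other ones.
The defect of the latter is antisymmetric in the letters of the word [w],
because it vanishes in the presence of a word of two letters. *)
Lemma colored_rot1 w ws : B (rot 1 w :: ws) = B (w :: ws).
Proof.
have [ev|] := boolP (all_even (w :: ws)); last first.
  move=> od; rewrite (ct_odd Bc od) (ct_odd Bc) //.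
  by move: od; rewrite /= /even_word size_rot.
suff sw0 : swap_defect ws w = 0.
  by rewrite colored_rot_others; apply: (eq_of_sub (b := 0)) sw0; rewrite subr0.
case/andP: ev => ev_w ev_ws.
have ws2 us x y : all_even us ->
    B ([:: x; y] :: us ++ map (rot 1) ws) - B ([:: x; y] :: us ++ ws) = 0.
  by move=> ev_us; rewrite pair_rotall // subrr.
have four a b c d us : all_even us ->
    B ([:: a; b; c; d] :: us ++ map (rot 1) ws) - B ([:: a; b; c; d] :: us ++ ws) = 0.
  move=> ev_us; apply: Q2; rewrite addrACA -opprD.
  rewrite !(four_expand (ct_rev Bc) (ct_join Bc) (ct_four Bc)).
  have ws2' x y z t : B [:: [:: x; y], [:: z; t] & us ++ map (rot 1) ws] =
      B [:: [:: x; y], [:: z; t] & us ++ ws] by exact: (pair_rotall x y (us := _ :: us)).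
  by rewrite !ws2' subrr.
case: w ev_w => [|a [|b [|c [|d t]]]] // ev_w.
- by rewrite /swap_defect (ct_rotall Bc ([::] :: ws) : B ([::] :: _) = _) subrr.
- exact: (ws2 [::]).
have odd0 z : ~~ even_word z -> swap_defect ws z = 0.
  by move=> od; rewrite /swap_defect !(ct_odd Bc) ?subrr //= (negPf od).
apply: antisymmetric_vanish => // {ev_w} [p x y s|{}a {}b {}c {}d {}t].
  have [ev|od] := boolP (even_word (s ++ p)); last first.
    have od' : ~~ even_word (p ++ s).
      by move: od; rewrite !even_word_cat eq_sym.
    rewrite !odd0 ?oppr0 //; move: od'; by rewrite /even_word !size_cat /= !addnS /= !negbK.
  apply/eqP; rewrite -addr_eq0 (swap_defect_cat ws p (x :: _)) (swap_defect_cat ws p (y :: _)) /=.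
  rewrite (_ : _ + _ = signed (odd (size p)) (0 : Q)); first by rewrite /signed; case: odd; rewrite ?oppr0.
  have := ws2 [:: s ++ p] x y; rewrite /= ev => /(_ isT) <-.
  have := ct_join Bc (u := [:: x; y]) (v := s ++ p) => /(_ _ isT ev) jn.
  by rewrite !jn /swap_defect /rev /= /signed; case: odd; zmod.
have [ev|od] := boolP (even_word t); last first.
  by rewrite !odd0 ?addr0 //; move: od; rewrite /even_word /= !negbK.
have := four a b c d [:: t]; rewrite /= ev => /(_ isT) <-.
have := ct_join Bc (u := [:: a; b; c; d]) (v := t) => /(_ _ isT ev) jn.
by rewrite !jn /swap_defect /rev /=; zmod.
Qed.

Lemma colored_even_trace : even_trace B.
Proof.
split; [exact: ct_odd Bc | exact: ct_perm Bc | exact: colored_rot1 | exact: ct_rev Bc |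
  exact: ct_join Bc].
Qed.

Let splice_odd u v es : odd (size u + size v) -> splice B u v es = 0.
Proof.
move=> od; rewrite /splice !(ct_odd Bc) ?subrr //= negb_and /even_word size_cat ?size_rev od //.
Qed.

Let splice_size u v : (size u + size v)%N != n -> splice B u v [::] = 0.
Proof.
by move=> sz; rewrite /splice !Bsize ?subrr //= cats0 size_cat ?size_rev.
Qed.

Let odd_lists os es : all (predC (@even_word T)) os -> all_even es ->
  odds (os ++ es) = os /\ evens (os ++ es) = es.
Proof.
move=> od ev; rewrite /odds /evens !filter_cat.
have -> : filter (predC (@even_word T)) es = [::].
  by apply/eqP; rewrite -(negbK (_ == _)) -has_filter has_predC negbK.
have -> : filter (@even_word T) os = [::].
  apply/eqP; rewrite -(negbK (_ == _)) -has_filter; apply/hasPn => w /(allP od) //.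
by rewrite cats0 (all_filterP od) (all_filterP ev).
Qed.

Lemma extend_pair x y os es : all (predC (@even_word T)) os -> all_even es ->
  extend_trace B ([:: x; y] :: os ++ es) = pair_up B os ([:: x; y] :: es).
Proof.
move=> od ev; have [os_eq es_eq] := odd_lists od ev.
by rewrite /extend_trace (os_eq : odds ([:: x; y] :: _) = os)
  (congr1 (cons [:: x; y]) es_eq : evens ([:: x; y] :: _) = _).
Qed.

Let splice_not_even u v es : ~~ all_even es -> splice B u v es = 0.
Proof.
move=> od; rewrite /splice !(ct_odd Bc) ?subrr //= -/all_even.
  by rewrite negb_and od orbT.
by rewrite negb_and od orbT.
Qed.

(** The defect [D] is a window both in [v] and in [u]. If [v] has less than
four letters it has one or three; one letter gives equal terms, and three leave
at least four letters to [u]. *)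
Lemma splice_rot es a u v : even_word u -> ~~ even_word v -> (8 <= n)%N ->
  splice B (rcons u a) v es = splice B (a :: u) v es.
Proof.
move=> ev_u od_v n8.
pose D es u v := splice B (rcons u a) v es - splice B (a :: u) v es.
suff D0 : D es u v = 0 by exact: subr0_eq.
have D2 x y us u' v' : even_word u' || ~~ even_word v' -> D ([:: x; y] :: us) u' v' = 0.
  move=> uv'; have [od|ev] := boolP (odd (size u' + size v').+1).
    by rewrite /D !splice_odd ?subrr ?size_rcons.
  have [ev_us|od] := boolP (all_even us); last first.
    by rewrite /D !splice_not_even ?subrr //= (negPf od) andbF.
  have [ev_u' od_v'] : even_word u' /\ ~~ even_word v'.
    by move: ev uv'; rewrite /even_word /= oddD; case: odd; case: odd.
  have := tr_rot (IH x y) (a :: u') (v' :: us); rewrite rot1_cons.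
  rewrite !(@extend_pair x y [:: _; _]) //= ?od_v' /even_word ?size_rcons /= ?negbK ?andbT //.
  by move=> e; rewrite /D e subrr.
have Bt := colored_even_trace.
have Dt u' v' : even_trace (fun es1 => D es1 u' v').
  by apply: even_traceD; [|apply: even_traceN]; apply: even_trace_splice.
have v_window : window (fun es1 => D es1 u).
  apply: (window_ext (D := fun es1 z => (B ((rcons u a ++ z ++ [::]) :: es1)
    - B ((rev (rcons u a) ++ z ++ [::]) :: es1)) - (B (((a :: u) ++ z ++ [::]) :: es1)
    - B ((rev (a :: u) ++ z ++ [::]) :: es1)))) => [es' z|]; first by rewrite !cats0.
  by do ?[apply: windowD | apply: windowN | apply: window_atom].
have u_window : window (fun es1 z => D es1 z v).
  apply: (window_ext (D := fun es1 z => (B (([::] ++ z ++ (a :: v)) :: es1)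
    - B (([:: a] ++ rev z ++ v) :: es1)) - (B (([:: a] ++ z ++ v) :: es1)
    - B (([::] ++ rev z ++ (a :: v)) :: es1)))) => [es' z|].
    by rewrite /D /splice rev_cons rev_rcons /= !cat_rcons.
  by do ?[apply: windowD | apply: windowN | apply: window_atom_rev | apply: window_atom].
apply: (@even_trace_reduce _ _ Q2 (fun es1 => D es1 u v)) => // [x y us|us|].
- by apply: D2; rewrite ev_u.
- by rewrite /D !splice_nil //; zmod.
have [sz|ne] := eqVneq (size u + size v).+1 n; last first.
  by rewrite /D !splice_size ?subrr ?size_rcons.
have [v4|v4] := leqP 4 (size v).
  apply: (@window_vanish _ _ Q2 (fun es1 => D es1 u) _ _ v_window) v4 => x y us z.
  by apply: D2; rewrite ev_u.
case: v od_v v4 {Dt v_window} sz D2 u_window => [|c [|d [|e [|]]]] // od_v v4 sz D2 u_window.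
  by rewrite /D !(splice_sym _ [:: c]) // /splice /= !subrr.
apply: (@window_vanish _ _ Q2 (fun es1 z => D es1 z _) _ _ u_window) => [x y us z|]; last by move: sz n8; rewrite /=; lia.
by apply: D2; rewrite orbT.
Qed.

Let exchange_defect es o1 o2 o3 o4 :=
  splice (splice B o1 o2) o3 o4 es - splice (splice B o1 o3) o2 o4 es.

Lemma exchange_long es o1 o2 o3 o4 : (3 < size o1)%N ->
  ~~ even_word o2 -> ~~ even_word o3 -> ~~ even_word o4 ->
  exchange_defect es o1 o2 o3 o4 = 0.
Proof.
move=> sz h2 h3 h4; have Bt := colored_even_trace.
apply: (@window_vanish _ _ Q2 (fun es1 z => exchange_defect es1 z o2 o3 o4)) sz.
  have spl u x y : window (fun es1 z => splice (splice B z u) x y es1).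
    apply: (window_ext (D := fun es1 z => splice B x y ((z ++ u) :: es1)
        - splice B x y ((rev z ++ u) :: es1))) => [es1 z|].
      by rewrite /splice !(even_trace_swap (x ++ y)) // !(even_trace_swap (rev x ++ y)) //; zmod.
    have Bxy : even_trace (splice B x y) by apply: even_trace_splice.
    exact: windowD (window_atom [::] u Bxy) (windowN (window_atom_rev [::] u Bxy)).
  exact: windowD (spl o2 o3 o4) (windowN (spl o3 o2 o4)).
move=> x y us z; have [ev_us|od] := boolP (all_even us); last first.
  rewrite /exchange_defect; do 2!rewrite {1}/splice !splice_not_even /= ?(negPf od) ?andbF //.
  by rewrite !subrr.
have [ev_z|od_z] := boolP (even_word z).
  have odd0 p q r es1 : ~~ even_word p -> splice (splice B z p) q r es1 = 0.
    move=> od; have := od; rewrite /even_word negbK => od'.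
    by rewrite {1}/splice !splice_odd ?subrr // oddD od' (negPf ev_z).
  by rewrite /exchange_defect !odd0 ?subrr.
have := tr_perm (IH x y) (ws := [:: z; o2; o3; o4] ++ us) (ws' := [:: z; o3; o2; o4] ++ us).
rewrite !extend_pair //= ?od_z ?h2 ?h3 ?h4 // /exchange_defect => ->; first by rewrite subrr.
by rewrite perm_cons; apply: permEl (perm_catCA [:: o2] [:: o3] _).
Qed.

Let splice2_sym a b c d es :
  splice (splice B a b) c d es = splice (splice B b a) d c es.
Proof.
rewrite splice_sym; last exact/even_trace_splice/colored_even_trace.
by apply: (congr2 (fun x y => x - y)); apply/splice_sym/colored_even_trace.
Qed.

(** The symmetries of the defect bring any of the four words to the first
place, so it vanishes as soon as one has four letters. It vanishes by definition
if one has a single letter, and four words of three letters have twelve letters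
in all. *)
Lemma colored_exchanges : n != 12 -> exchanges B.
Proof.
move=> n12 es o1 o2 o3 o4 h1 h2 h3 h4; have Bt := colored_even_trace.
suff : exchange_defect es o1 o2 o3 o4 = 0 by exact: subr0_eq.
have defect2 es1 : exchange_defect es1 o1 o2 o3 o4 = exchange_defect es1 o2 o1 o4 o3.
  by rewrite /exchange_defect (splice2_sym o1 o2) (splice_swap o1 o3).
have defect3 es1 : exchange_defect es1 o1 o2 o3 o4 = exchange_defect es1 o3 o4 o1 o2.
  by rewrite /exchange_defect (splice_swap o1 o2) // (splice2_sym o1 o3).
have defect4 es1 : exchange_defect es1 o1 o2 o3 o4 = - exchange_defect es1 o4 o2 o3 o1.
  rewrite /exchange_defect (splice_swap o4 o2) // splice2_sym (splice_swap o4 o3) //.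
  by rewrite (splice2_sym o2 o1) (splice2_sym o3 o1) opprB.
have Dt : even_trace (fun es1 => exchange_defect es1 o1 o2 o3 o4).
  by apply: even_traceD; [|apply: even_traceN]; do 2!apply: even_trace_splice.
have vanish es1 : (3 < maxn (maxn (size o1) (size o2)) (maxn (size o3) (size o4)))%N ->
    exchange_defect es1 o1 o2 o3 o4 = 0.
  rewrite !leq_max -orbA => /or4P[] sz; first exact: exchange_long.
  - by rewrite defect2 exchange_long.
  - by rewrite defect3 exchange_long.
  - by rewrite defect4 exchange_long // oppr0.
apply: (@even_trace_reduce _ _ Q2 (fun es1 => exchange_defect es1 o1 o2 o3 o4)) => // [x y us|us|].
- have [ev_us|od] := boolP (all_even us); last first.
    by rewrite (et_odd Dt) //= (negPf od) andbF.
  have := tr_perm (IH x y) (ws := [:: o1; o2; o3; o4] ++ us) (ws' := [:: o1; o3; o2; o4] ++ us).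
  rewrite !extend_pair //= ?h1 ?h2 ?h3 ?h4 // /exchange_defect => ->; first by rewrite subrr.
  by rewrite perm_cons; apply: permEl (perm_catCA [:: o2] [:: o3] _).
- rewrite /exchange_defect !splice_nil; try exact: even_trace_splice.
  by zmod.
have [sz|ne] := eqVneq (size o1 + size o2 + (size o3 + size o4))%N n; last first.
  have small_size a b c d : (size a + size b + (size c + size d))%N != n ->
      splice (splice B a b) c d [::] = 0.
    by move=> sz; rewrite /splice !Bsize ?subrr //= cats0 !size_cat ?size_rev // addnC.
  by rewrite /exchange_defect !small_size ?subrr // addnACA.
have [/vanish//|small] := ltnP 3 (maxn (maxn (size o1) (size o2)) (maxn (size o3) (size o4))).
have single c p q r : exchange_defect [::] [:: c] p q r = 0.
  by rewrite /exchange_defect /splice /= !subrr.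
have odd_small o : ~~ even_word o -> (size o < 4)%N -> (exists c, o = [:: c]) \/ size o = 3.
  by case: o => [|a [|b [|c []]]] // _ _; [left; exists a | right].
move: small; rewrite !geq_max => /andP[/andP[s1 s2] /andP[s3 s4]].
have [[c o1E]|sz1] := odd_small _ h1 s1; first by rewrite o1E single.
have [[c o2E]|sz2] := odd_small _ h2 s2; first by rewrite defect2 o2E single.
have [[c o3E]|sz3] := odd_small _ h3 s3; first by rewrite defect3 o3E single.
have [[c o4E]|sz4] := odd_small _ h4 s4; first by rewrite defect4 o4E single oppr0.
by move: n12; rewrite -sz sz1 sz2 sz3 sz4.
Qed.

(** Joining two even words, or two odd ones, is built into the definition; for
an even word and an odd one, the odd word is first joined to its partner. *)
Theorem extend_trace_trace : (8 <= n)%N -> n != 12 -> trace (extend_trace B).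
Proof.
move=> n8 n12; have Bt := colored_even_trace.
have Bx := colored_exchanges n12.
have odd_cons w ws : ~~ even_word w -> odds (w :: ws) = w :: odds ws.
  by rewrite /odds /= => ->.
have odd_skip w ws : even_word w -> odds (w :: ws) = odds ws.
  by rewrite /odds /= => ->.
have even_cons w ws : even_word w -> evens (w :: ws) = w :: evens ws.
  by rewrite /evens /= => ->.
have even_skip w ws : ~~ even_word w -> evens (w :: ws) = evens ws.
  by rewrite /evens /= => /negPf->.
have odd_odds ws : all (predC (@even_word T)) (odds ws) by apply: filter_all.
have prm ws ws' : perm_eq ws ws' -> extend_trace B ws = extend_trace B ws'.
  move=> eq_ws; rewrite /extend_trace.
  rewrite (et_perm (even_trace_pair_up _ Bt) (perm_filter _ eq_ws)).
  apply: (transpositions_generate (P := predC (@even_word T)) (F := fun os => pair_up B os _)) => //.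
    by move=> p x y q all_odd; apply: pair_up_transp.
  exact: perm_filter.
have rt w ws : extend_trace B (rot 1 w :: ws) = extend_trace B (w :: ws).
  rewrite /extend_trace; have rw : even_word (rot 1 w) = even_word w by rewrite /even_word size_rot.
  have [ev|od] := boolP (even_word w).
    rewrite !odd_skip ?even_cons ?rw //; exact/et_rot/even_trace_pair_up.
  rewrite !odd_cons ?even_skip ?rw //; have := odd_odds ws.
  case: (odds ws) => [|v os] //= /andP[od_v _]; apply: pair_up_ext => es.
  case: w od {rw} => [|a u] // od; rewrite rot1_cons splice_rot //.
  by move: od; rewrite /even_word /= negbK.
have rv w ws : extend_trace B (rev w :: ws) = signed (odd (size w)) (extend_trace B (w :: ws)).
  rewrite /extend_trace; have [ev|od] := boolP (even_word w).
    rewrite !odd_skip ?even_cons ?even_word_rev // (et_rev (even_trace_pair_up _ Bt)).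
    by rewrite /signed; move: ev; rewrite /even_word => /negPf->.
  rewrite !odd_cons ?even_skip ?even_word_rev //.
  have -> : odd (size w) by move: od; rewrite /even_word negbK.
  case: (odds ws) => [|v os] /=; first by rewrite oppr0.
  rewrite -pair_upN; apply: pair_up_ext => es.
  by rewrite /splice revK opprB.
have even_odd u v ws : even_word u -> ~~ even_word v -> extend_trace B (u :: v :: ws) =
    extend_trace B ((u ++ v) :: ws) + extend_trace B ((rev u ++ v) :: ws).
  move=> ev_u od_v; rewrite /extend_trace odd_skip // even_cons // !odd_cons ?even_skip //;
    try by rewrite even_word_cat ?even_word_rev ev_u (negPf od_v).
  case: (odds ws) => [|o os] /=; first by rewrite addr0.
  rewrite -pair_up_cons; last exact: even_trace_splice.
  rewrite -pair_upD; apply: pair_up_ext => es; rewrite /splice.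
  rewrite !(even_trace_swap _ u) //.
  have e1 := even_trace_window [::] (v ++ o) es Bt ev_u.
  have e2 := even_trace_window (rev v) o es Bt ev_u.
  rewrite !cat0s in e1; rewrite -e1 -e2 !rev_cat revK -!catA.
  by zmod.
split=> // u v ws.
have [ev_u|od_u] := boolP (even_word u); have [ev_v|od_v] := boolP (even_word v).
- rewrite (negPf ev_u : odd _ = false) /= /extend_trace !odd_skip ?even_cons //;
    try by rewrite even_word_cat ?even_word_rev ev_u ev_v.
  exact: (et_join (even_trace_pair_up _ Bt)).
- by rewrite (negPf ev_u : odd _ = false) even_odd.
- have -> : odd (size u) by move: od_u; rewrite /even_word negbK.
  rewrite (prm _ (v :: u :: ws)); last exact: permEl (perm_catCA [:: u] [:: v] ws).
  rewrite even_odd //=; congr (_ + _).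
    by apply: (rot_invariant_catC (F := fun w => extend_trace B (w :: ws))).
  have := rv (rev u ++ v) ws; rewrite rev_cat revK => ->.
  have -> : odd (size (rev u ++ v)).
    by rewrite -[odd _]negbK -/(even_word _) even_word_cat even_word_rev ev_v (negPf od_u).
  by [].
have odd_u : odd (size u) by move: od_u; rewrite /even_word negbK.
rewrite odd_u /= /extend_trace (odd_cons u) // (odd_cons v) // (even_skip u) // (even_skip v) //.
have ev_uv : even_word (u ++ v) by rewrite even_word_cat (negPf od_u) (negPf od_v).
have ev_ruv : even_word (rev u ++ v) by rewrite even_word_cat even_word_rev (negPf od_u) (negPf od_v).
rewrite !odd_skip // !even_cons //= -!pair_up_cons // -pair_upN -pair_upD.
exact: pair_up_ext.
Qed.
End Core.

(** * Joining odd words in pairs: uniqueness and naturality *)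

Section PairUp.
Variables (T : eqType).
Implicit Types (w u v o : seq T) (ws es os : seq (seq T)).

Lemma trace_cons (Q : zmodType) (f : seq (seq T) -> Q) u : trace f -> trace (fun ws => f (u :: ws)).
Proof.
move=> ft; have sw v w ws : f (v :: w :: ws) = f (w :: v :: ws).
  by apply: (tr_perm ft); apply: permEl (perm_catCA [:: v] [:: w] ws).
split=> [ws ws' p|w ws|w ws|v w ws].
- by apply: (tr_perm ft); rewrite perm_cons.
- by rewrite !(sw u) (tr_rot ft).
- by rewrite !(sw u) (tr_rev ft).
have -> : f (u :: v :: w :: ws) = f (v :: w :: u :: ws).
  by apply: (tr_perm ft); apply: permEl (perm_catCA [:: u] [:: v; w] ws).
by rewrite (tr_join ft) !(sw u).
Qed.

(** A trace is determined by its values on even words: [extend_trace] is the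
only possible extension. *)
Lemma pair_up_trace (Q : zmodType) (B X : seq (seq T) -> Q) os es : trace X ->
  (forall es, all_even es -> B es = X es) ->
  all (predC (@even_word T)) os -> all_even es -> ~~ odd (size os) ->
  pair_up B os es = X (os ++ es).
Proof.
have [m] := ubnP (size os); elim: m B X os => // m IHm B X [|o1 [|o2 os]] //= lt_m Xt BX.
  by move=> _ ev _; apply: BX.
rewrite negbK => /and3P[od1 od2 od] ev size_os.
rewrite (IHm _ (fun ws => X (o1 :: o2 :: ws))) //.
- by rewrite -ltnS ltnW.
- exact: (trace_cons o2 (trace_cons o1 Xt)).
move=> fs ev_fs; rewrite /splice !BX /=; first last.
- by rewrite even_word_cat (negPf od1) (negPf od2).
- by rewrite even_word_cat even_word_rev (negPf od1) (negPf od2).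
have odd1 : odd (size o1) by move: od1; rewrite /even_word /= negbK.
by rewrite (tr_join Xt) odd1.
Qed.

Lemma odds_evens_perm ws : perm_eq (odds ws ++ evens ws) ws.
Proof. by rewrite perm_catC; apply/permEl/(perm_filterC (@even_word T)). Qed.

Lemma odds_size ws : odd (size (odds ws)) = odd (size (flatten ws)).
Proof.
elim: ws => //= w ws IHws; rewrite size_cat oddD -IHws /odds /= /even_word negbK.
by case: (odd (size w)).
Qed.

Lemma odds_odd ws : all (predC (@even_word T)) (odds ws).
Proof. exact: filter_all. Qed.

Lemma evens_even ws : all_even (evens ws).
Proof. exact: filter_all. Qed.

Lemma extend_trace_eq (Q : zmodType) (B X : seq (seq T) -> Q) ws : trace X ->
  (forall es, all_even es -> B es = X es) -> ~~ odd (size (flatten ws)) ->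
  extend_trace B ws = X ws.
Proof.
move=> Xt BX ev; rewrite /extend_trace (pair_up_trace Xt) ?odds_odd ?evens_even ?odds_size //.
exact/(tr_perm Xt)/odds_evens_perm.
Qed.

Lemma pair_up_morph (Q Q' : zmodType) (phi : {additive Q -> Q'}) (B : seq (seq T) -> Q) os es :
  phi (pair_up B os es) = pair_up (phi \o B) os es.
Proof.
have [m] := ubnP (size os); elim: m B os => // m IHm B [|o1 [|o2 os]] //= lt_m.
  by rewrite raddf0.
rewrite IHm; last by rewrite -ltnS ltnW.
by apply: pair_up_ext => fs; rewrite /splice /= raddfB.
Qed.

Lemma pair_up_in (Q : zmodType) (S : zmodClosed Q) (B : seq (seq T) -> Q) os es :
  (forall fs, B fs \in S) -> pair_up B os es \in S.
Proof.
have [m] := ubnP (size os); elim: m B os => // m IHm B [|o1 [|o2 os]] //= lt_m BS.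
  by rewrite rpred0.
by apply: IHm => [|fs]; [rewrite -ltnS ltnW | rewrite /splice rpredB].
Qed.

Lemma pair_up_uncovered (Q : zmodType) (B : seq (seq T) -> Q) (c r : seq T) os es :
  (forall fs, ~~ perm_eq (c ++ flatten fs) r -> B fs = 0) ->
  ~~ perm_eq (c ++ flatten os ++ flatten es) r -> pair_up B os es = 0.
Proof.
have [m] := ubnP (size os); elim: m B c os => // m IHm B c [|o1 [|o2 os]] //= lt_m B0 nr.
  exact: B0.
apply: (IHm _ (c ++ o1 ++ o2)); first by rewrite -ltnS ltnW.
  move=> fs nfs; rewrite /splice !B0 ?subrr //=; move: nfs; rewrite -!catA; apply: contra.
    by move=> p; rewrite -(permPl (_ : perm_eq (c ++ rev o1 ++ o2 ++ flatten fs) _)) //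
      perm_cat2l perm_cat2r perm_rev.
  by [].
by move: nr; rewrite -!catA.
Qed.

Lemma pair_up_map (T' : eqType) (k : T' -> T) (Q Q' : zmodType) (phi : {additive Q' -> Q})
    (B : seq (seq T) -> Q) (B' : seq (seq T') -> Q') u (os es : seq (seq T')) :
  (forall ws ws', perm_eq ws ws' -> B ws = B ws') ->
  (forall fs, B (u :: map (map k) fs) = phi (B' fs)) ->
  pair_up B (map (map k) os) (u :: map (map k) es) = phi (pair_up B' os es).
Proof.
have [m] := ubnP (size os); elim: m B B' os => // m IHm B B' [|o1 [|o2 os]] //= lt_m Bp BB'.
  by rewrite raddf0.
apply: IHm => [|ws ws' p|fs]; first by rewrite -ltnS ltnW.
  by congr (_ - _); apply: Bp; rewrite perm_cons.
have sw v ws : B (v :: u :: ws) = B (u :: v :: ws).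
  by apply: Bp; apply: permEl (perm_catCA [:: v] [:: u] ws).
by rewrite /splice !sw -map_rev -!map_cat -!(map_cons (map k)) !BB' raddfB.
Qed.

(** All relations of [trace] are between lists with the same letters. *)
Lemma trace_restrict (Q : zmodType) (f g : seq (seq T) -> Q) (r : seq T) : trace g ->
  (forall ws, perm_eq (flatten ws) r -> f ws = g ws) ->
  (forall ws, ~~ perm_eq (flatten ws) r -> f ws = 0) -> trace f.
Proof.
move=> gt fg f0.
have same ws ws' : perm_eq (flatten ws) (flatten ws') ->
    perm_eq (flatten ws) r = perm_eq (flatten ws') r by move=> p; rewrite (permPl p).
split=> [ws ws' p|w ws|w ws|u v ws].
- have e := same _ _ (perm_flatten p).
  have [c|n] := boolP (perm_eq (flatten ws) r); last by rewrite !f0 // -e.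
  by rewrite !fg -?e //; apply: (tr_perm gt).
- have e := same (rot 1 w :: ws) (w :: ws) _; rewrite /= perm_cat2r perm_rot in e.
  have {}e := e (perm_refl _).
  have [c|n] := boolP (perm_eq (flatten (w :: ws)) r); last by rewrite !f0 // /= e.
  by rewrite !fg ?(tr_rot gt) //= e.
- have e := same (rev w :: ws) (w :: ws) _; rewrite /= perm_cat2r perm_rev in e.
  have {}e := e (perm_refl _).
  have [c|n] := boolP (perm_eq (flatten (w :: ws)) r); last first.
    by rewrite !f0 // ?/= ?e // /signed; case: odd; rewrite ?oppr0.
  by rewrite !fg ?(tr_rev gt) //= e.
have e1 : flatten (u :: v :: ws) = flatten ((u ++ v) :: ws) by rewrite /= catA.
have e2 := same ((rev u ++ v) :: ws) ((u ++ v) :: ws) _.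
rewrite /= -!catA perm_cat2r perm_rev in e2; have {}e2 := e2 (perm_refl _).
have [c|n] := boolP (perm_eq (flatten (u :: v :: ws)) r); last first.
  by rewrite !f0 /= -?catA ?e2 // /signed; case: odd; rewrite ?oppr0 addr0.
by rewrite !fg ?(tr_join gt) //= -?catA ?e2.
Qed.

Lemma trace_map (T' : eqType) (r : T -> T') (Q : zmodType) (g : seq (seq T') -> Q) :
  trace g -> trace (fun ws => g (map (map r) ws)).
Proof.
move=> gt; split=> [ws ws' p|w ws|w ws|u v ws].
- exact/(tr_perm gt)/perm_map.
- by rewrite /= map_rot (tr_rot gt).
- by rewrite /= map_rev (tr_rev gt) size_map.
- by rewrite /= (tr_join gt) size_map !map_cat map_rev.
Qed.

Lemma traceN (Q : zmodType) (f : seq (seq T) -> Q) : trace f -> trace (fun ws => - f ws).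
Proof.
move=> ft; split=> [ws ws' p|w ws|w ws|u v ws].
- by rewrite (tr_perm ft p).
- by rewrite (tr_rot ft).
- by rewrite (tr_rev ft) signedN.
- by rewrite (tr_join ft) opprD signedN.
Qed.
End PairUp.

(** * Graphs of cyclic words *)

Section GraphFunctionals.
Variable L : finType.
Implicit Types (g h : graph L) (a b c d : L) (w u v : seq L) (ws : seq (seq L)).

Lemma graph_unionE g h : graph_union g h = g + h.
Proof. by apply/ffunP => e; rewrite !ffunE. Qed.

Lemma graphDE g h e : (g + h) e = (g e + h e)%N.
Proof. by rewrite !ffunE. Qed.

Fixpoint matching_graph w : graph L :=
  if w is a :: b :: t then edge a b + matching_graph t else 0.

Fixpoint path_graph a w : graph L :=
  if w is b :: t then edge a b + path_graph b t else 0.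

Definition cycle_graph w : graph L :=
  if w is a :: t then edge (last a t) a + path_graph a t else 0.

Definition matchings_graph ws := \sum_(w <- ws) matching_graph w.
Definition cycles_graph ws := \sum_(w <- ws) cycle_graph w.

(** The functions on graphs that factor through the defining relations of
[R_L]. Sums of graphs are disjoint unions of their edges. *)
Record plucker (A : zmodType) (f : graph L -> A) : Prop := Plucker {
  pl_loop : forall h a, f (h + edge a a) = 0;
  pl_sign : forall h a b, f (h + edge a b) = - f (h + edge b a);
  pl_exchange : forall h a b c d, f (h + (edge a b + edge c d)) =
    f (h + (edge a d + edge c b)) + f (h + (edge a c + edge b d)) }.

(** The empty word has no edges but counts for the trace 2 of the identity. *)
Definition nil_weight ws := (2 ^ count (@nilp L) ws)%N.

Definition graph_trace (A : zmodType) (f : graph L -> A) ws : A :=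
  f (cycles_graph ws) *+ nil_weight ws.

Ltac graph_ac := apply/ffunP => ?; rewrite !graphDE; lia.

Lemma path_graph_cat a u v : path_graph a (u ++ v) = path_graph a u + path_graph (last a u) v.
Proof. by elim: u a => [|b u IHu] a /=; rewrite ?add0r // IHu addrA. Qed.

Lemma path_graph_rcons a u b : path_graph a (rcons u b) = path_graph a u + edge (last a u) b.
Proof. by rewrite -cats1 path_graph_cat /= addr0. Qed.

Lemma last_rev_belast a u : last (last a u) (rev (belast a u)) = a.
Proof. by case: u => //= b u; rewrite rev_cons last_rcons. Qed.

Lemma rev_cons_last a u : rev (a :: u) = last a u :: rev (belast a u).
Proof. by rewrite lastI rev_rcons. Qed.

Lemma cycle_graph_rot w : cycle_graph (rot 1 w) = cycle_graph w.
Proof.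
case: w => [|a [|b w]] //; rewrite rot1_cons /= last_rcons path_graph_rcons.
graph_ac.
Qed.

Lemma nil_weight_cons w ws : nil_weight (w :: ws) = (2 ^ nilp w * nil_weight ws)%N.
Proof. by rewrite /nil_weight /= expnD. Qed.

Section Functional.
Variables (A : zmodType) (f : graph L -> A).
Hypothesis fp : plucker f.

Lemma path_graph_rev h a t : f (h + path_graph (last a t) (rev (belast a t))) =
  signed (odd (size t)) (f (h + path_graph a t)).
Proof.
elim: t a h => [|b t IHt] a h //=.
rewrite rev_cons path_graph_rcons last_rev_belast addrA (pl_sign fp).
rewrite (_ : _ + _ + _ = (h + edge a b) + path_graph (last b t) (rev (belast b t))); last by graph_ac.
by rewrite IHt signed_neg addrA.
Qed.

Lemma cycle_graph_rev h w : f (h + cycle_graph (rev w)) =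
  signed (odd (size w)) (f (h + cycle_graph w)).
Proof.
case: w => [|a t] //; rewrite rev_cons_last /= last_rev_belast addrA path_graph_rev.
rewrite (_ : _ + _ + _ = h + path_graph a t + edge a (last a t)); last by graph_ac.
rewrite (pl_sign fp) signedN signed_neg; congr (- signed _ (f _)); graph_ac.
Qed.

(** The Pluecker relation for the closing edges of the two cycles. *)
Lemma cycle_graph_join h b s d t :
  f (h + (cycle_graph (b :: s) + cycle_graph (d :: t))) =
  f (h + cycle_graph ((b :: s) ++ (d :: t))) +
  signed (odd (size s).+1) (f (h + cycle_graph (rev (b :: s) ++ (d :: t)))).
Proof.
rewrite rev_cons_last /= !last_cat /= !path_graph_cat /= last_rev_belast.
set a := last d t; set c := last b s.
pose h' := h + path_graph b s + path_graph d t.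
rewrite (_ : h + _ = h' + (edge a d + edge c b)); last by rewrite /h'; graph_ac.
rewrite (pl_exchange fp) (_ : h' + _ = h + (edge a b + (path_graph b s + (edge c d + path_graph d t)))); last by rewrite /h'; graph_ac.
congr (_ + _).
rewrite (_ : h + _ = h + edge a c + edge b d + path_graph d t + path_graph c (rev (belast b s))); last by graph_ac.
rewrite path_graph_rev signed_neg signedK.
rewrite addrA (pl_sign fp); congr (- f _); rewrite /h'; graph_ac.
Qed.

Lemma graph_trace_trace : trace (graph_trace f).
Proof.
split=> [ws ws' eq_ws|w ws|w ws|u v ws]; rewrite /graph_trace.
- by rewrite /cycles_graph (perm_big _ eq_ws) /nil_weight (permP eq_ws).
- rewrite /cycles_graph !big_cons cycle_graph_rot !nil_weight_cons.
  by rewrite /nilp size_rot.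
- rewrite /cycles_graph !big_cons ![cycle_graph _ + _]addrC cycle_graph_rev !nil_weight_cons signedMn.
  by rewrite /nilp size_rev.
rewrite /cycles_graph !big_cons !nil_weight_cons.
have nil_rev w : nilp (rev w) = nilp w by rewrite /nilp size_rev.
case: u v => [|b s] [|d t].
- by rewrite !add0r /= -mulrnDr; congr (_ *+ _); lia.
- by rewrite !add0r /= -mulrnDr; congr (_ *+ _); lia.
- rewrite !cats0 add0r (addrC (cycle_graph (rev _))) cycle_graph_rev nil_rev.
  rewrite -signedMn signedK (addrC (cycle_graph (b :: s))).
  by rewrite -mulrnDr; congr (_ *+ _); rewrite /=; lia.
rewrite addrA (addrC _ (\sum_(_ <- _) _)) cycle_graph_join signedMn.
rewrite (addrC (cycle_graph _)) (addrC (cycle_graph (rev _ ++ _))).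
have -> : nilp (rev (b :: s) ++ d :: t) = false by rewrite /nilp size_cat addnS.
by rewrite mulrnDl /= !mul1n.
Qed.
End Functional.

Lemma valence_edge a b (v : L) : valence (edge a b) v = ((v == a) + (v == b))%N.
Proof.
rewrite /valence; congr (_ + _)%N.
  rewrite (bigD1 b) //= big1 => [|w nw]; rewrite ffunE xpair_eqE ?eqxx ?andbT ?addn0 //.
  by rewrite (negPf nw) andbF.
rewrite (bigD1 a) //= big1 => [|w nw]; rewrite ffunE xpair_eqE ?eqxx ?andbT ?addn0 //.
by rewrite (negPf nw).
Qed.

Lemma valenceD g h (v : L) : valence (g + h) v = (valence g v + valence h v)%N.
Proof. by rewrite -graph_unionE valence_union. Qed.

Lemma valence0 (v : L) : valence (0 : graph L) v = 0%N.
Proof. by rewrite /valence !big1 // => w _; rewrite ffunE. Qed.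

Lemma sum_count_mem (s : seq L) : (\sum_(v : L) count_mem v s)%N = size s.
Proof.
elim: s => [|a s IHs] /=; first by rewrite big1.
rewrite big_split /= IHs (bigD1 a) //= eqxx big1 // => v /negPf nv.
by rewrite eq_sym nv.
Qed.

(** ** Pairs of matchings *)

Lemma even_word_ind (P : seq L -> Prop) :
  P [::] -> (forall a b t, even_word t -> P t -> P [:: a, b & t]) ->
  forall w, even_word w -> P w.
Proof.
move=> P0 PS w; have [m] := ubnP (size w); elim: m w => // m IHm [|a [|b t]] //= lt_m.
rewrite /even_word /= negbK => ev; apply: PS => //; apply: IHm => //; lia.
Qed.

Lemma matching_graph_cat u v : even_word u ->
  matching_graph (u ++ v) = matching_graph u + matching_graph v.
Proof.
move=> ev; elim/even_word_ind: u / ev => [|a b t _ IHt] /=; first by rewrite add0r.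
by rewrite IHt addrA.
Qed.

Lemma matching_graph_rot2 w : even_word w -> matching_graph (rot 2 w) = matching_graph w.
Proof.
case: w => [|a [|b t]] // ev; rewrite /rot /= drop0 take0 matching_graph_cat /=.
  by rewrite addr0 addrC.
by move: ev; rewrite /even_word /= negbK.
Qed.

Lemma rot_rot1 w : rot 1 (rot 1 w) = rot 2 w.
Proof. by case: w => [|a [|b t]] //; rewrite -rotD. Qed.

Lemma matching_graph_rotr1 w : even_word w ->
  matching_graph (rotr 1 w) = matching_graph (rot 1 w).
Proof.
move=> ev; rewrite -[in RHS](rotrK 1 w) rot_rot1 matching_graph_rot2 //.
by rewrite /even_word size_rotr.
Qed.

Lemma matching_graph_rev (A : zmodType) (f : graph L -> A) h w : plucker f -> even_word w ->
  f (h + matching_graph (rev w)) = signed (odd (size w)./2) (f (h + matching_graph w)).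
Proof.
move=> fp ev; elim/even_word_ind: w / ev h => [|a b t ev IHt] h //=.
rewrite 2!rev_cons -!cats1 -catA matching_graph_cat; last by rewrite even_word_rev.
rewrite /= addr0 addrA (pl_sign fp) (_ : _ + _ + _ = h + edge a b + matching_graph (rev t)); last by graph_ac.
by rewrite IHt signed_neg addrA.
Qed.

Lemma valence_matching w (v : L) : even_word w -> valence (matching_graph w) v = count_mem v w.
Proof.
move=> ev; elim/even_word_ind: w / ev => [|a b t _ IHt] /=; first by rewrite valence0.
by rewrite valenceD valence_edge IHt ![v == _]eq_sym addnA.
Qed.

Lemma valence_matchings ws (v : L) : all_even ws ->
  valence (matchings_graph ws) v = count_mem v (flatten ws).
Proof.
elim: ws => [|w ws IHws] /=; first by rewrite /matchings_graph big_nil valence0.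
by case/andP=> ev_w ev_ws; rewrite /matchings_graph big_cons valenceD count_cat valence_matching // IHws.
Qed.

Section ColorTrace.
Variables (A : zmodType) (q : graph L -> graph L -> A).
Hypothesis q_sym : forall g h, q g h = q h g.
Hypothesis q_plucker : forall g, plucker (q g).
Hypothesis q_regular : forall g h, q g h != 0 -> regular_of_degree 1 g.
Hypothesis q_four : forall g h a b c d,
  q (g + (edge b c + edge d a)) (h + (edge c d + edge a b)) =
  q (g + (edge a b + edge c d)) (h + (edge b c + edge d a)).

(** The edges of an even cyclic word are coloured alternately, starting with
the pair of its first two letters. The two colours of [w] are the matchings of
[w] and of [rot 1 w]. *)
Definition color_trace ws : A :=
  if all_even ws then
    q (matchings_graph ws) (matchings_graph (map (rot 1) ws)) *+ nil_weight ws
  else 0.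

Lemma matchings_graph_cons w ws : matchings_graph (w :: ws) = matching_graph w + matchings_graph ws.
Proof. exact: big_cons. Qed.

Lemma color_trace_cons w ws : color_trace (w :: ws) =
  if even_word w && all_even ws then
    q (matchings_graph ws + matching_graph w)
      (matchings_graph (map (rot 1) ws) + matching_graph (rot 1 w)) *+ (2 ^ nilp w * nil_weight ws)
  else 0.
Proof. by rewrite /color_trace /= nil_weight_cons !matchings_graph_cons ![matching_graph _ + _]addrC. Qed.

Lemma even_word_rot k w : even_word (rot k w) = even_word w.
Proof. by rewrite /even_word size_rot. Qed.

Lemma q_revr g h w : even_word w ->
  q g (h + matching_graph (rev w)) = signed (odd (size w)./2) (q g (h + matching_graph w)).
Proof. exact/matching_graph_rev/q_plucker. Qed.

Lemma q_revl g h w : even_word w ->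
  q (g + matching_graph (rev w)) h = signed (odd (size w)./2) (q (g + matching_graph w) h).
Proof. by move=> ev; rewrite q_sym q_revr // q_sym. Qed.

Lemma color_trace_rev w ws : color_trace (rev w :: ws) = color_trace (w :: ws).
Proof.
rewrite !color_trace_cons even_word_rev; case: ifP => // /andP[ev _].
have -> : nilp (rev w) = nilp w by rewrite /nilp size_rev.
congr (_ *+ _); rewrite -rev_rotr q_revr; last by rewrite /even_word size_rotr.
by rewrite matching_graph_rotr1 // q_revl // size_rotr signedK.
Qed.

(** The Pluecker relation for the second colour, to which the closing edges of
both words belong. *)
Lemma color_trace_join u v ws : even_word u -> even_word v ->
  color_trace (u :: v :: ws) = color_trace ((u ++ v) :: ws) + color_trace ((rev u ++ v) :: ws).
Proof.
move=> ev_u ev_v; have nil_rev w : nilp (rev w) = nilp w by rewrite /nilp size_rev.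
have [ev_ws|od] := boolP (all_even ws); last first.
  by rewrite /color_trace /= (negPf od) !andbF addr0.
case: u ev_u => [|b s] ev_u.
  rewrite /color_trace /= ev_v ev_ws /= !nil_weight_cons !matchings_graph_cons !add0r -mulrnDr.
  by congr (_ *+ _); rewrite /=; lia.
case: v ev_v => [|d t] ev_v.
  rewrite !cats0 color_trace_rev /color_trace /= ev_ws (_ : even_word (b :: s)) //=.
  rewrite !nil_weight_cons !matchings_graph_cons !add0r -mulrnDr.
  by congr (_ *+ _); rewrite /=; lia.
case/lastP: s ev_u => // s c ev_u; case/lastP: t ev_v => // t a ev_v.
have ev_s : even_word s by move: ev_u; rewrite /even_word /= size_rcons /= negbK.
have ev_t : even_word t by move: ev_v; rewrite /even_word /= size_rcons /= negbK.
have rot_even x r y : even_word r ->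
    matching_graph (rot 1 (x :: rcons r y)) = matching_graph r + edge y x.
  by move=> ev_r; rewrite rot1_cons -!cats1 -catA matching_graph_cat //= addr0.
have rot_join r y z x : even_word r ->
    matching_graph (rot 1 ((x :: rcons r y) ++ z :: rcons t a)) =
    matching_graph r + (edge y z + (matching_graph t + edge a x)).
  move=> ev_r; rewrite cat_cons rot1_cons -!cats1 /= -!catA matching_graph_cat //=.
  by rewrite -catA matching_graph_cat //= addr0.
have -> : color_trace ((b :: rcons s c) :: (d :: rcons t a) :: ws) =
    q (matchings_graph ws + matching_graph (d :: rcons t a) + matching_graph (b :: rcons s c))
      (matchings_graph (map (rot 1) ws) + matching_graph s + matching_graph t
       + (edge a d + edge c b)) *+ nil_weight ws.
  rewrite color_trace_cons ev_u (_ : all_even _); last by apply/andP.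
  rewrite nil_weight_cons !mul1n map_cons !matchings_graph_cons !rot_even //.
  by congr (q _ _ *+ _); graph_ac.
have cat_color w : even_word w -> ~~ nilp w -> color_trace (w :: ws) =
    q (matchings_graph ws + matching_graph w)
      (matchings_graph (map (rot 1) ws) + matching_graph (rot 1 w)) *+ nil_weight ws.
  by move=> ev_w /negPf nw; rewrite color_trace_cons ev_w ev_ws nw mul1n.
have rev_u : rev (b :: rcons s c) = c :: rcons (rev s) b.
  by rewrite rev_cons rev_rcons.
have ev1 : even_word ((b :: rcons s c) ++ d :: rcons t a) by rewrite even_word_cat ev_u ev_v.
have ev2 : even_word (rev (b :: rcons s c) ++ d :: rcons t a).
  by rewrite even_word_cat even_word_rev ev_u ev_v.
have nil2 : ~~ nilp (rev (b :: rcons s c) ++ d :: rcons t a) by rewrite /nilp size_cat addnS.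
rewrite (cat_color _ ev1) // (cat_color _ ev2) //.
rewrite (matching_graph_cat _ ev_u) matching_graph_cat ?even_word_rev //.
rewrite rot_join // (pl_exchange (q_plucker _)) mulrnDl; congr (q _ _ *+ _ + _).
- by graph_ac.
- by graph_ac.
congr (_ *+ _); rewrite rev_u rot_join ?even_word_rev // -rev_u.
set u := b :: rcons s c; set v := d :: rcons t a.
rewrite (_ : _ + (matching_graph (rev u) + _) =
  matchings_graph ws + matching_graph v + matching_graph (rev u)); last by graph_ac.
rewrite (_ : _ + (matching_graph (rev s) + _) = matchings_graph (map (rot 1) ws)
  + matching_graph t + edge a c + edge b d + matching_graph (rev s)); last by graph_ac.
rewrite q_revl // q_revr // signed_signed (_ : _ (+) _ = true); last first.
  by rewrite /u /= size_rcons /= addNb addbb.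
rewrite (addrAC _ (edge b d) (matching_graph s)) [in RHS](pl_sign (q_plucker _)) /signed opprK.
by congr (q _ _); graph_ac.
Qed.

Lemma color_trace_size ws : size (flatten ws) != #|L| -> color_trace ws = 0.
Proof.
rewrite /color_trace; case: ifP => // ev; apply: contraNeq => nz.
have /q_regular reg : q (matchings_graph ws) (matchings_graph (map (rot 1) ws)) != 0.
  by apply: contraNneq nz => ->; rewrite mul0rn.
apply/eqP; rewrite -sum_count_mem -sum1_card; apply: eq_bigr => v _.
by rewrite -(reg v) valence_matchings.
Qed.

Lemma color_trace_colored : colored_trace color_trace.
Proof.
split.
- by move=> ws /negPf od; rewrite /color_trace od.
- move=> ws ws' eq_ws; rewrite /color_trace /all_even (perm_all _ eq_ws).
  by rewrite /matchings_graph !big_map !(perm_big _ eq_ws) /nil_weight (permP eq_ws).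
- move=> ws; rewrite /color_trace; have -> : all_even (map (rot 1) ws) = all_even ws.
    by rewrite /all_even all_map; apply: eq_all => w; apply: even_word_rot.
  case: ifP => // ev; rewrite q_sym; congr (q _ _ *+ _).
    rewrite /matchings_graph !big_map !big_seq; apply: eq_bigr => w w_ws.
    by rewrite rot_rot1 matching_graph_rot2 //; apply: (allP ev).
  by rewrite /nil_weight count_map; congr (2 ^ _)%N; apply: eq_count => w /=; rewrite /nilp size_rot.
- move=> w ws; rewrite !color_trace_cons even_word_rot; case: ifP => // /andP[ev _].
  rewrite -rot_rot1 [rot 1 (rot 1 (rot 1 _))]rot_rot1.
  by rewrite rot_rot1 !matching_graph_rot2 ?even_word_rot // /nilp size_rot.
- exact: color_trace_rev.
- exact: color_trace_join.
- move=> a b c d ws; rewrite !color_trace_cons /=; case: ifP => // _.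
  by rewrite /rot /= !addr0 q_four.
Qed.
End ColorTrace.
End GraphFunctionals.

(** * Functions on the ring of graphs *)

Section RingOfGraphs.
Variable L : finType.
Implicit Types (g h : graph L) (m : regular_graph L).

Definition graph_value (k : nat) g : Rring L :=
  if (insub g : option (regular_graph L)) is Some m then
    if `[< regular_of_degree k g >] then graph_class m else 0
  else 0.

Lemma graph_value_class k m : regular_of_degree k m -> graph_value k m = graph_class m.
Proof. by move=> mk; rewrite /graph_value valK; case: asboolP. Qed.

Lemma graph_value_out k g : ~ regular_of_degree k g -> graph_value k g = 0.
Proof. by move=> gk; rewrite /graph_value; case: insub => // m; case: asboolP. Qed.

Lemma regular_graph_of k g : regular_of_degree k g -> exists m, val m = g.
Proof.
move=> gk; have g_reg : is_regular g by apply/asboolP; exists k.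
by exists (RegularGraph g_reg).
Qed.

Lemma pi_ring_relation p : ring_relation p -> \pi_(Rring L) p = 0.
Proof.
move=> rp; rewrite -[0](raddf0 (\pi_(Rring L))); apply/eqP.
have := Quotient.idealrBE (@ring_ideal L) p 0; rewrite subr0 => <-.
exact: mem_ideal_gen.
Qed.

Lemma regular_edgeC k h (a b : L) :
  regular_of_degree k (h + edge a b) -> regular_of_degree k (h + edge b a).
Proof. by move=> hk v; rewrite -(hk v) !valenceD !valence_edge (addnC (v == b)). Qed.

Lemma graph_value_plucker k : plucker (graph_value k).
Proof.
split=> [h a|h a b|h a b c d].
- have [gk|] := pselect (regular_of_degree k (h + edge a a)); last exact: graph_value_out.
  have [m mE] := regular_graph_of gk; rewrite -mE graph_value_class ?mE //.
  rewrite graph_class.unlock; apply: pi_ring_relation; apply: Or31; exists m, a; split=> //.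
  by rewrite -[graph_of m]/(val m) mE graphDE ffunE eqxx addn1.
- have [gk|ngk] := pselect (regular_of_degree k (h + edge a b)); last first.
    rewrite !graph_value_out ?oppr0 // => gk; apply: ngk; exact: regular_edgeC.
  have gk' := regular_edgeC gk.
  have [m mE] := regular_graph_of gk; have [m' m'E] := regular_graph_of gk'.
  rewrite -mE -m'E !graph_value_class ?mE ?m'E //; apply/eqP; rewrite -addr_eq0.
  rewrite graph_class.unlock -raddfD; apply/eqP; apply: pi_ring_relation; apply: Or32.
  by exists m, m', h, a, b; rewrite !graph_unionE.
have reg3 x y : regular_of_degree k (h + x) -> (forall v, valence x v = valence y v) ->
    regular_of_degree k (h + y).
  by move=> hx xy v; rewrite -(hx v) !valenceD xy.
pose x := edge a b + edge c d; pose y := edge a d + edge c b; pose z := edge a c + edge b d.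
have xy v : valence x v = valence y v by rewrite !valenceD !valence_edge; lia.
have xz v : valence x v = valence z v by rewrite !valenceD !valence_edge; lia.
have [gk|ngk] := pselect (regular_of_degree k (h + x)); last first.
  rewrite !graph_value_out ?addr0 // => gk; apply: ngk.
    by apply: reg3 gk _ => v; rewrite xz.
  by apply: reg3 gk _ => v; rewrite xy.
have gk' := reg3 _ _ gk xy; have gk'' := reg3 _ _ gk xz.
have [m mE] := regular_graph_of gk; have [m' m'E] := regular_graph_of gk'.
have [m'' m''E] := regular_graph_of gk''.
rewrite -/x -/y -/z -mE -m'E -m''E !graph_value_class ?mE ?m'E ?m''E //.
apply/eqP; rewrite -subr_eq0 opprD addrA graph_class.unlock -!raddfB; apply/eqP.
apply: pi_ring_relation; apply: Or33.
by exists m, m', m'', h, a, b, c, d; rewrite !graph_unionE.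
Qed.

Lemma graph_value_part k g : graph_value k g \in Rpart k.
Proof.
have [gk|gk] := pselect (regular_of_degree k g); last by rewrite graph_value_out // rpred0.
have [m mE] := regular_graph_of gk; rewrite -mE graph_value_class ?mE //.
by apply: mem_zspan; exists m; rewrite -[graph_of m]/(val m) mE.
Qed.

Definition matching_class g : matching_space L := MatchingSpace (graph_value_part 1 g).

Lemma matching_class_plucker : plucker matching_class.
Proof.
have [lp sg ex] := graph_value_plucker 1.
split=> *; apply: val_inj; first exact: lp.
  by rewrite [RHS](raddfN (val : matching_space L -> Rring L)); apply: sg.
by rewrite [RHS](raddfD (val : matching_space L -> Rring L)); apply: ex.
Qed.

Lemma matching_class_out g : ~ regular_of_degree 1 g -> matching_class g = 0.
Proof. by move=> gk; apply: val_inj; rewrite /= graph_value_out // raddf0. Qed.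

Lemma matching_class_is g : regular_of_degree 1 g -> is_class_of g (matching_class g).
Proof.
move=> g1; have [m mE] := regular_graph_of g1; exists m; split=> //.
by rewrite /= -mE graph_value_class ?mE.
Qed.

Section RringLift.
Variables (A : zmodType) (f : graph L -> A).
Hypothesis fp : plucker f.

Definition semigroup_lift : semigroup_algebra L -> A := free_lift (fun m => f (graph_of m)).
HB.instance Definition _ := GRing.Additive.copy semigroup_lift
  (free_lift (fun m : regular_graph L => f (graph_of m))).

Lemma semigroup_liftU m : semigroup_lift << m >> = f (graph_of m).
Proof. exact: free_liftU. Qed.

Lemma relation_vanish (F : semigroup_algebra L -> A) (k : graph L) r :
  (forall x y, F (x - y) = F x - F y) ->
  (forall m, F << m >> = f (k + graph_of m)) -> ring_relation r -> F r = 0.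
Proof.
move=> FB FU.
have FD x y : F (x + y) = F x + F y.
  have F0 : F 0 = 0 by have := FB 0 0; rewrite !subrr.
  have FN z : F (- z) = - F z by rewrite -(sub0r z) FB F0 sub0r.
  by rewrite -{1}(opprK y) FB FN opprK.
case=> [[m [a [ma ->]]]|[m [m' [h [a [b [mE m'E ->]]]]]]|].
- rewrite FU; pose h : graph L := [ffun e => (m e - edge a a e)%N].
  have -> : graph_of m = h + edge a a.
    apply/ffunP => e; rewrite graphDE [h e]ffunE subnK //.
    by rewrite ffunE; case: eqP => [->|].
  by rewrite addrA (pl_loop fp).
- by rewrite FD !FU mE m'E !graph_unionE !addrA (pl_sign fp) addNr.
- move=> [m [m' [m'' [h [a [b [c [d [mE m'E m''E ->]]]]]]]]].
  rewrite !FB !FU mE m'E m''E !graph_unionE !(addrA _ h) (pl_exchange fp).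
  by apply/eqP; rewrite !subr_eq add0r; apply/eqP/addrC.
Qed.

Lemma semigroup_lift_relation (p r : semigroup_algebra L) :
  ring_relation r -> semigroup_lift (p * r) = 0.
Proof.
move=> rel; rewrite [p]monalgE mulr_suml raddf_sum big1 // => k _.
have -> : << p@_k *g k >> = << k >> *~ p@_k :> semigroup_algebra L.
  by rewrite -[in LHS](intz p@_k); exact: (raddfMz (mkmalgU k)).
rewrite mulrzAl; apply: etrans (raddfMz _ _ _) _.
suff e0 : semigroup_lift (<< k >> * r) = 0.
  by apply: etrans (congr1 (fun x => x *~ _) e0) _; rewrite mul0rz.
pose F x : A := semigroup_lift (<< k >> * x).
have FB x y : F (x - y) = F x - F y.
  by apply: etrans (congr1 semigroup_lift (mulrBr _ _ _)) _; exact: raddfB.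
have FU (m : regular_graph L) : F << m >> = f (graph_of k + graph_of m).
  apply: etrans (congr1 semigroup_lift (fgmulUU 1 1 k m)) _.
  by apply: etrans (semigroup_liftU (mmul k m)) _; rewrite /= graph_unionE.
exact: (relation_vanish FB FU).
Qed.

Definition Rring_lift (r : Rring L) : A := semigroup_lift (repr r).

Lemma Rring_lift_pi p : Rring_lift (\pi p) = semigroup_lift p.
Proof.
apply/eqP; rewrite -subr_eq0 /Rring_lift -raddfB; apply/eqP.
have : repr (\pi_(Rring L) p) - p \in @ring_ideal L by rewrite Quotient.idealrBE reprK.
move=> /asboolP[n [c [r [rel ->]]]]; rewrite raddf_sum big1 // => i _.
exact: semigroup_lift_relation.
Qed.

Lemma Rring_lift_zmod : zmod_morphism Rring_lift.
Proof.
by move=> s t; rewrite -[s]reprK -[t]reprK -rmorphB /= !Rring_lift_pi raddfB.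
Qed.

Lemma Rring_lift_class m : Rring_lift (graph_class m) = f (graph_of m).
Proof. by rewrite graph_class.unlock Rring_lift_pi semigroup_liftU. Qed.
End RringLift.
End RingOfGraphs.

(** * The quotient by the simple binomial relations *)

Lemma sym_zmod (V : zmodType) : zmod_morphism (@sym V).
Proof.
have pi0 p : sym_relation p -> \pi_(Sym V) p = 0.
  move=> rp; rewrite -[0](raddf0 (\pi_(Sym V))); apply/eqP.
  have := Quotient.idealrBE (@sym_ideal V) p 0; rewrite subr0 => <-.
  exact: mem_ideal_gen.
have symD (u v : V) : sym (u + v) = sym u + sym v.
  apply/eqP; rewrite -subr_eq0 opprD addrA; apply/eqP.
  by rewrite sym.unlock -raddf_subr3; apply: pi0; exists u, v.
by move=> u v; apply/eqP; rewrite eq_sym subr_eq -symD subrK.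
Qed.
HB.instance Definition _ (V : zmodType) :=
  GRing.isZmodMorphism.Build V (Sym V) (@sym V) (@sym_zmod V).

Section Saturation.
Variables (N : nat) (L : finType).
Hypothesis N_gt0 : (0 < N)%N.

(** The elements that vanish modulo simple binomials after [2N] is inverted. *)
Definition saturated : {pred Sym (matching_space L)} := fun s =>
  `[< exists k, s *+ ((2 * N) ^ k)%N \in zspan (@simple_binomial L) >].

Lemma saturated_closed : zmod_closed saturated.
Proof.
split=> [|s t /asboolP[k sk] /asboolP[l tl]]; apply/asboolP.
  by exists 0%N; rewrite mul0rn rpred0.
exists (k + l)%N; rewrite mulrnBl rpredB // expnD.
  by rewrite mulrnA rpredMn.
by rewrite mulnC mulrnA rpredMn.
Qed.
HB.instance Definition _ := GRing.isZmodClosed.Build _ saturated saturated_closed.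

Definition Squot := Quotient.quot saturated.
HB.instance Definition _ := GRing.Zmodule.on Squot.

Lemma Squot_eq0 s : (\pi_Squot s == 0) = (s \in saturated).
Proof.
rewrite -[0 in LHS](raddf0 (\pi_Squot)).
by have := Quotient.idealrBE saturated s 0; rewrite subr0 => ->.
Qed.

Lemma Squot_half (x : Squot) : x + x = 0 -> x = 0.
Proof.
rewrite -[x]reprK -raddfD => /eqP; rewrite Squot_eq0 => /asboolP[k sk].
apply/eqP; rewrite Squot_eq0; apply/asboolP; exists k.+1.
by rewrite expnS mulnC !mulnA mulrnA [(_ * 2)%N]mulnC mulrnA mulr2n rpredMn.
Qed.

Lemma simple_binomial_saturated s : simple_binomial s -> s \in saturated.
Proof. by move=> sb; apply/asboolP; exists 0%N; rewrite expn0 mulr1n mem_zspan. Qed.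

Definition pair_class (g h : graph L) : Sym (matching_space L) :=
  sym (matching_class g) * sym (matching_class h).

Definition pair_value (g h : graph L) : Squot := \pi_Squot (pair_class g h).

Lemma pair_valueC g h : pair_value g h = pair_value h g.
Proof. by rewrite /pair_value /pair_class mulrC. Qed.

Lemma pair_class_plucker g : plucker (pair_class g).
Proof.
have [lp sg ex] := matching_class_plucker L.
split=> *; rewrite /pair_class.
- by rewrite lp raddf0 mulr0.
- by rewrite sg raddfN mulrN.
- by rewrite ex raddfD mulrDr.
Qed.

Lemma pair_value_plucker g : plucker (pair_value g).
Proof.
have [lp sg ex] := pair_class_plucker g.
split=> *; rewrite /pair_value.
- by rewrite lp raddf0.
- by rewrite sg raddfN.
- by rewrite ex raddfD.
Qed.

Lemma pair_value_regular g h : pair_value g h != 0 -> regular_of_degree 1 g.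
Proof.
move=> nz; have [//|ng] := pselect (regular_of_degree 1 g).
by rewrite /pair_value /pair_class matching_class_out // raddf0 mul0r raddf0 eqxx in nz.
Qed.

(** Equality of valences forces a, b, c, d to be distinct as soon as one of
the graphs is a matching, which gives the set [U] of a simple binomial
relation. *)
Lemma pair_value_four (g h : graph L) (a b c d : L) :
  pair_value (g + (edge b c + edge d a)) (h + (edge c d + edge a b)) =
  pair_value (g + (edge a b + edge c d)) (h + (edge b c + edge d a)).
Proof.
pose D := edge b c + edge d a; pose D' := edge a b + edge c d.
have DD' v : valence D v = valence D' v by rewrite !valenceD !valence_edge; lia.
rewrite (addrC (edge c d)) -/D -/D'.
have regD g1 : regular_of_degree 1 (g1 + D) <-> regular_of_degree 1 (g1 + D').
  by split=> rg v; have := rg v; rewrite (valenceD g1 D) (valenceD g1 D') DD'.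
have [gD|ngD] := pselect (regular_of_degree 1 (g + D)); last first.
  have ngD' : ~ regular_of_degree 1 (g + D') by move/regD.
  by rewrite /pair_value /pair_class (matching_class_out ngD) (matching_class_out ngD') raddf0 !mul0r.
have [hD|nhD] := pselect (regular_of_degree 1 (h + D)); last first.
  have nhD' : ~ regular_of_degree 1 (h + D') by move/regD.
  by rewrite /pair_value /pair_class (matching_class_out nhD) (matching_class_out nhD') raddf0 !mulr0.
have gD' := (regD g).1 gD; have hD' := (regD h).1 hD.
apply/eqP; rewrite -subr_eq0 /pair_value -raddfB Squot_eq0; apply: simple_binomial_saturated.
have valD v : valence D v = ((v == a) + (v == b) + (v == c) + (v == d))%N.
  by rewrite valenceD !valence_edge; lia.
have val1 v : ((v == a) + (v == b) + (v == c) + (v == d) <= 1)%N.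
  by rewrite -valD -(gD v) (valenceD g D) leq_addl.
pose U := [set a; b; c; d].
have DU v : valence D v = (v \in U).
  have := val1 v; rewrite valD !inE.
  by case: (v == a); case: (v == b); case: (v == c); case: (v == d).
have gU g1 : regular_of_degree 1 (g1 + D) -> matching_on (~: U) g1.
  by move=> r v; have := r v; rewrite (valenceD g1 D) DU in_setC; case: (v \in U) => /=; lia.
exists U, D, D', g, h.
exists (matching_class (g + D)), (matching_class (h + D')).
exists (matching_class (g + D')), (matching_class (h + D)).
split=> //; last by rewrite !graph_unionE; split; apply: matching_class_is.
- rewrite /U -!setUA !cardsU1 cards1 !inE.
  move: (val1 a) (val1 b) (val1 c); rewrite !eqxx (eq_sym b a) (eq_sym c a) (eq_sym c b).
  by case: (a == b); case: (a == c); case: (a == d); case: (b == c); case: (b == d); case: (c == d).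
- by split=> v; rewrite -?DD' DU.
- by split; apply: gU.
Qed.

Lemma pair_color_trace : colored_trace (color_trace pair_value).
Proof.
apply: color_trace_colored; [exact: pair_valueC | exact: pair_value_plucker | exact: pair_value_four].
Qed.
End Saturation.

(** * Inverting an integer in a tensor product *)

Definition eventually (P : nat -> Prop) := exists k, forall M, (k <= M)%N -> P M.

Lemma eventually_all n (P : 'I_n -> nat -> Prop) :
  (forall i, eventually (P i)) -> eventually (fun M => forall i, P i M).
Proof.
move=> evP; pose k i := projT1 (cid (evP i)).
exists (\max_i k i)%N => M leM i; rewrite /k in leM.
by apply: (projT2 (cid (evP i))); apply: leq_trans leM; apply: leq_bigmax.
Qed.

Lemma sum_split (V : zmodType) (X : Type) (F : X -> V) n l (x : 'I_n -> X) (y : 'I_l -> X) :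
  \sum_i F (x i) + \sum_i F (y i) =
  \sum_(i < n + l) F (match split i with inl j => x j | inr k => y k end).
Proof.
rewrite big_split_ord /=; congr (_ + _); apply: eq_bigr => i _.
  by rewrite (unsplitK (inl i)).
by rewrite (unsplitK (inr i)).
Qed.

Section Localization.
Variables (m : nat) (A : zmodType) (S : A -> Prop).
Hypothesis m_gt0 : (0 < m)%N.
Local Notation K := (Zinv m).

(** The integer [c * m ^ M], provided that it is one. *)
Definition scaled_num (M : nat) (c : K) : int := numq (val c * m%:R ^+ M).

Lemma scaled_numE (c : K) :
  eventually (fun M => (scaled_num M c)%:~R = val c * m%:R ^+ M).
Proof.
case: c => x /= x_in; have /asboolP[a [k xE]] := x_in.
have m0 : (m%:R : rat) != 0 by rewrite pnatr_eq0 -lt0n.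
exists k => M leM; rewrite /scaled_num /= xE -(subnK leM) addnC exprD mulrA divfK ?expf_neq0 //.
rewrite -[m%:R ^+ (M - k)]/((m%:R : rat) ^+ (M - k)).
have -> : (a%:~R * m%:R ^+ (M - k) : rat) = (a * m%:R ^+ (M - k))%:~R.
  by rewrite rmorphM rmorphXn /= rmorph_nat.
by rewrite numq_int.
Qed.

Lemma scaled_numD (c d : K) :
  eventually (fun M => scaled_num M (c + d) = scaled_num M c + scaled_num M d).
Proof.
have [k1 e1] := scaled_numE c; have [k2 e2] := scaled_numE d.
have [k3 e3] := scaled_numE (c + d).
exists (maxn k1 (maxn k2 k3)) => M; rewrite !geq_max => /and3P[h1 h2 h3].
apply: (@intr_inj rat); rewrite rmorphD /= e1 // e2 // e3 //.
by rewrite raddfD mulrDl.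
Qed.

Lemma scaled_num1 M : scaled_num M 1 = (m ^ M)%:Z.
Proof.
rewrite /scaled_num mul1r.
have -> : (m%:R : rat) ^+ M = ((m ^ M)%:Z)%:~R by rewrite -natrX.
by rewrite numq_int.
Qed.

(** Tensor relations only hold after evaluation at a large power: for small
[M] the function [scaled_num M] is not additive. *)
Definition scaled_eval M : {malg int[(A * K)%type]} -> A :=
  free_lift (fun ab => ab.1 *~ scaled_num M ab.2).
HB.instance Definition _ M := GRing.Additive.copy (scaled_eval M)
  (free_lift (fun ab : (A * K)%type => ab.1 *~ scaled_num M ab.2)).

Lemma scaled_evalU M a c : scaled_eval M << (a, c) >> = a *~ scaled_num M c.
Proof. exact: free_liftU. Qed.

Lemma scaled_eval_kernel p : \pi_(tensor A K) p = 0 ->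
  eventually (fun M => scaled_eval M p = 0).
Proof.
move=> p0; have : p \in @tensor_kernel A K.
  rewrite -[p]subr0 Quotient.idealrBE; apply/eqP; rewrite p0; exact/esym/raddf0.
move=> /asboolP[n [c [g [rel ->]]]].
have [k ek] : eventually (fun M => forall i, scaled_eval M (g i) = 0).
  apply: eventually_all => i; case: (rel i) => [[a [a' [b ->]]]|[a [b [b' ->]]]].
    exists 0%N => M _; set z := scaled_num M b.
    transitivity ((a + a') *~ z - a *~ z - a' *~ z); last by rewrite mulrzDl; zmod.
    by rewrite raddf_subr3; congr (_ - _ - _); apply: scaled_evalU.
  have [k ek] := scaled_numD b b'; exists k => M leM.
  transitivity (a *~ scaled_num M (b + b') - a *~ scaled_num M b - a *~ scaled_num M b').
    by rewrite raddf_subr3; congr (_ - _ - _); apply: scaled_evalU.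
  by rewrite ek // mulrzDr; zmod.
exists k => M leM; rewrite raddf_sum big1 // => i _; apply: etrans (raddfMz _ _ _) _.
by apply: etrans (congr1 (fun x => x *~ c i) (ek M leM i)) _; rewrite mul0rz.
Qed.

(** An equality in the tensor product is a finite combination of tensor
relations, and all of them are killed by [scaled_eval M] for [M] large. *)
Lemma generates_span : generates_base_change K S ->
  forall a, exists k, a *+ (m ^ k)%N \in zspan S.
Proof.
move=> gen a; have [n [c [s [Ss sumE]]]] := gen (extend_scalars K a).
pose p : {malg int[(A * K)%type]} := << (a, 1) >> - \sum_(i < n) << (s i, c i) >>.
have p0 : \pi_(tensor A K) p = 0.
  transitivity (pure_tensor a (1 : K) - \sum_(i < n) pure_tensor (s i) (c i)).
    by rewrite /p raddfB raddf_sum pure_tensor.unlock.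
  apply/eqP; rewrite subr_eq0; apply/eqP; apply: etrans sumE _.
  apply: eq_bigr => i _; apply: etrans (scale_pure_tensor _ _ _) _.
  by rewrite mulr1.
have [k ek] := scaled_eval_kernel p0; exists k.
have : scaled_eval k p = a *~ (m ^ k)%N - \sum_(i < n) s i *~ scaled_num k (c i).
  rewrite -scaled_num1; apply: etrans (raddfB (scaled_eval k) _ _) _.
  apply: (congr2 (fun x y : A => x - y)); first exact: scaled_evalU.
  apply: etrans (raddf_sum (scaled_eval k) _ _ _) _.
  by apply: eq_bigr => i _; apply: scaled_evalU.
rewrite ek // => /esym/eqP; rewrite subr_eq0 -pmulrn => /eqP->.
by apply: rpred_sum => i _; rewrite rpredMz // mem_zspan.
Qed.

Let term (z : K * A) : base_change K A := z.1 *: extend_scalars K z.2.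

Definition spanned (t : base_change K A) : Prop :=
  exists (n : nat) (z : 'I_n -> K * A), (forall i, S (z i).2) /\ t = \sum_(i < n) term (z i).

Lemma spanned0 : spanned 0.
Proof. by exists 0%N, (fun=> 0); split=> [[]//|]; rewrite big_ord0. Qed.

Lemma spannedD t u : spanned t -> spanned u -> spanned (t + u).
Proof.
move=> [n [z [Sz ->]]] [l [y [Sy ->]]]; exists (n + l)%N.
exists (fun i => match split i with inl j => z j | inr k => y k end).
by split=> [i|]; [case: (split i) | exact: sum_split].
Qed.

Lemma spannedZ c t : spanned t -> spanned (c *: t).
Proof.
move=> [n [z [Sz ->]]]; exists n, (fun i => (c * (z i).1, (z i).2)); split=> //.
by rewrite scaler_sumr; apply: eq_bigr => i _; rewrite scalerA.
Qed.

Lemma spanned_sum (I : Type) (r : seq I) (F : I -> base_change K A) :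
  (forall i, spanned (F i)) -> spanned (\sum_(i <- r) F i).
Proof. by move=> sF; elim/big_ind: _ => //; [exact: spanned0 | exact: spannedD]. Qed.

Definition extend a : base_change K A := extend_scalars K a.
Lemma extend_zmod : zmod_morphism extend.
Proof.
move=> a b; apply/eqP; rewrite eq_sym subr_eq; apply/eqP.
by apply: etrans (pure_tensorDl _ _ _); rewrite subrK.
Qed.
HB.instance Definition _ := GRing.isZmodMorphism.Build A (base_change K A) extend extend_zmod.

Lemma span_generates : (forall a, exists k, a *+ (m ^ k)%N \in zspan S) ->
  generates_base_change K S.
Proof.
move=> span t.
suff [n [z [Sz tE]]] : spanned t.
  by exists n, (fun i => (z i).1), (fun i => (z i).2).
have m0 : (m%:R : rat) != 0 by rewrite pnatr_eq0 -lt0n.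
have ext a : spanned (extend_scalars K a).
  rewrite -[extend_scalars K a]/(extend a).
  have [k ak] := span a.
  have inv_in : (m%:R ^- k : rat) \in inv_pred m.
    by apply/asboolP; exists 1, k; rewrite mul1r.
  suff -> : extend a = MkZinv inv_in *: extend (a *+ (m ^ k)%N); last first.
    rewrite (raddfMn extend) -scaler_nat scalerA -[LHS]scale1r.
    congr (_ *: _); apply: val_inj.
    rewrite [RHS](_ : _ = (m%:R ^- k : rat) * (val ((m ^ k)%:R : K))); last by [].
    by rewrite (rmorph_nat (val : K -> rat)) natrX mulVf ?expf_neq0.
  apply: spannedZ; move: ak => /asboolP[n [d [g [Sg ->]]]].
  exists n, (fun i => ((d i)%:~R, g i)); split=> //.
  apply: etrans (raddf_sum extend _ _ _) _; apply: eq_bigr => i _.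
  by apply: etrans (raddfMz extend _ _) _; rewrite /term scaler_int.
have pure a c : spanned (pure_tensor a c).
  have -> : pure_tensor a c = c *: extend_scalars K a.
    by apply: esym; apply: etrans (scale_pure_tensor _ _ _) _; rewrite mulr1.
  exact/spannedZ/ext.
have lift p : spanned (\pi_(tensor A K) p).
  rewrite [p]monalgE raddf_sum; apply: spanned_sum => -[a c].
  have -> : << p@_(a, c) *g (a, c) >> = << (a, c) >> *~ p@_(a, c) :> {malg int[(A * K)%type]}.
    by rewrite -[in LHS](intz p@_(a, c)); exact: (raddfMz (mkmalgU (a, c))).
  pose u : base_change K A := pure_tensor a c.
  have : spanned ((p@_(a, c))%:~R *: u) by apply: spannedZ; apply: pure.
  rewrite scaler_int; congr (spanned _); apply: esym.
  by apply: etrans (raddfMz _ _ _) _; rewrite /u pure_tensor.unlock.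
by rewrite -[t]reprK.
Qed.
End Localization.

(** * The cycles of a graph of degree two *)

Section Undirected.
Variable L : finType.
Implicit Types (g h : graph L) (a b c d x y z : L) (w u v s t : seq L) (ws us r : seq (seq L)).

(** A loop counts twice. *)
Definition undirected g : graph L := [ffun e => (g e + g (e.2, e.1))%N].

(** Counts the edges that decrease for a fixed order of the vertices, so that
reversing one edge changes the parity: classes of two orientations of the same
undirected graph differ by the product of their signs. *)
Definition parity g : bool :=
  odd (\sum_(e : L * L | (enum_rank e.1 < enum_rank e.2)%N) g e).

Lemma undirectedE g x y : undirected g (x, y) = (g (x, y) + g (y, x))%N.
Proof. by rewrite ffunE. Qed.

Lemma undirectedD g h : undirected (g + h) = undirected g + undirected h.
Proof. by apply/ffunP => -[x y]; rewrite graphDE !undirectedE !graphDE; lia. Qed.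

Lemma undirected_edge a b x y :
  undirected (edge a b) (x, y) = ((x == a) && (y == b) + (y == a) && (x == b))%N.
Proof. by rewrite undirectedE !ffunE !xpair_eqE. Qed.

Lemma undirected_edgeC a b : undirected (edge a b) = undirected (edge b a).
Proof. by apply/ffunP => -[x y]; rewrite !undirected_edge addnC (andbC (y == a)) (andbC (x == a)). Qed.

Lemma graph_addI g : injective (GRing.add g).
Proof.
by move=> h h' /ffunP e; apply/ffunP => z; move: (e z); rewrite !graphDE => /addnI.
Qed.

Lemma parityD g h : parity (g + h) = parity g (+) parity h.
Proof.
rewrite /parity -oddD -big_split; congr (odd _); apply: eq_bigr => e _.
by rewrite graphDE.
Qed.

Lemma parity_edge a b : parity (edge a b) = (enum_rank a < enum_rank b)%N.
Proof.
rewrite /parity big_mkcond (bigD1 (a, b)) //= big1 => [|e ne].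
  by rewrite addn0 ffunE eqxx; case: ifP.
by rewrite ffunE (negPf ne); case: ifP.
Qed.

Lemma parity_edgeC a b : a != b -> parity (edge a b) = ~~ parity (edge b a).
Proof.
move=> ab; rewrite !parity_edge -leqNgt [RHS]leq_eqVlt; case: eqP => //= e.
by move: ab; rewrite (enum_rank_inj (val_inj e)) eqxx.
Qed.

Lemma cycle_graph_cons a t : cycle_graph (a :: t) = edge (last a t) a + path_graph a t.
Proof. by []. Qed.

Lemma undirected_path_rev a t :
  undirected (path_graph (last a t) (rev (belast a t))) = undirected (path_graph a t).
Proof.
elim: t a => [|b t IHt] a //=; rewrite rev_cons path_graph_rcons last_rev_belast.
by rewrite !undirectedD IHt undirected_edgeC addrC.
Qed.

Lemma parity_path_rev a t : uniq (a :: t) ->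
  parity (path_graph (last a t) (rev (belast a t))) = odd (size t) (+) parity (path_graph a t).
Proof.
elim: t a => [|b t IHt] a //=; rewrite rev_cons path_graph_rcons last_rev_belast.
rewrite inE negb_or -andbA => /and3P[ab _ ut]; rewrite !parityD IHt //.
by rewrite (parity_edgeC (a := b)) 1?eq_sym //; case: (odd _); case: (parity _); case: (parity _).
Qed.

Lemma undirected_cycle_rev w : undirected (cycle_graph (rev w)) = undirected (cycle_graph w).
Proof.
case: w => [|a t] //; rewrite rev_cons_last /= last_rev_belast !undirectedD.
by rewrite undirected_path_rev undirected_edgeC.
Qed.

Lemma parity_cycle_rev w : uniq w -> size w != 1%N ->
  parity (cycle_graph (rev w)) = odd (size w) (+) parity (cycle_graph w).
Proof.
case: w => [|a [|b t]] // uw _; rewrite rev_cons_last; set s := b :: t in uw *.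
have a_last : a != last a s by apply: contraTneq uw => ->; rewrite /s /= mem_last.
clearbody s; rewrite !cycle_graph_cons last_rev_belast !parityD parity_path_rev // parity_edgeC //.
by rewrite -[size (a :: s)]/(size s).+1 oddS; case: (odd _); case: (parity _); case: (parity _).
Qed.

Lemma path_graph_out a t x y : y \notin a :: t ->
  path_graph a t (x, y) = 0%N /\ path_graph a t (y, x) = 0%N.
Proof.
elim: t a => [|b t IHt] a /=; first by rewrite !ffunE.
rewrite inE negb_or => /andP[ya yt]; have [e1 e2] := IHt b yt.
rewrite !graphDE e1 e2 !ffunE !xpair_eqE (negPf ya) andbC.
by move: yt; rewrite inE negb_or => /andP[/negPf-> _].
Qed.

Lemma undirected_cycle_out w x y : x \notin w -> undirected (cycle_graph w) (x, y) = 0%N.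
Proof.
case: w => [|a t] xw; first by rewrite !ffunE.
have [e1 e2] := path_graph_out y xw; rewrite undirectedE /= !graphDE e1 e2 !ffunE !xpair_eqE.
have /negPf-> : x != last a t by apply: contraNneq xw => ->; apply: mem_last.
by move: xw; rewrite inE negb_or andbC => /andP[_ /negPf->]; rewrite andbF.
Qed.

Lemma undirected_cycles_cons w ws :
  undirected (cycles_graph (w :: ws)) = undirected (cycle_graph w) + undirected (cycles_graph ws).
Proof. by rewrite /cycles_graph big_cons undirectedD. Qed.

Lemma undirected_cycles_out ws x y : x \notin flatten ws ->
  undirected (cycles_graph ws) (x, y) = 0%N.
Proof.
elim: ws => [|w ws IHws] /=; first by rewrite /cycles_graph big_nil !ffunE.
rewrite mem_cat negb_or undirected_cycles_cons graphDE => /andP[xw xws].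
by rewrite undirected_cycle_out // IHws.
Qed.

Lemma undirected_cycle_head y b q x : y \notin b :: q ->
  undirected (cycle_graph [:: y, b & q]) (y, x) = ((x == b) + (x == last b q))%N.
Proof.
move=> yq; have [e1 e2] := path_graph_out x yq.
rewrite undirectedE /= !graphDE e1 e2 !ffunE !xpair_eqE !eqxx /=.
have yb : (y == b) = false by apply: contraNF yq => /eqP->; rewrite mem_head.
have yl : (y == last b q) = false by apply: contraNF yq => /eqP->; rewrite mem_last.
rewrite yb yl /= !andbT !addn0 andbF !add0n; lia.
Qed.

Definition valid_words ws := uniq (flatten ws) && ([::] \notin ws).

Lemma valid_words_cons w ws : valid_words (w :: ws) ->
  [/\ w != [::], uniq w, valid_words ws & forall x, x \in w -> x \notin flatten ws].
Proof.
case/andP; rewrite inE negb_or /= cat_uniq => /and3P[uw /hasPn dis uws] /andP[w0 n0].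
split=> //; [by rewrite eq_sym | exact/andP | move=> x xw].
by apply: contraL xw => /dis.
Qed.

Lemma cycle_graph_catC u v : cycle_graph (u ++ v) = cycle_graph (v ++ u).
Proof.
exact/rot_invariant_catC/cycle_graph_rot.
Qed.

Lemma cycle_neighbours p z y t rs : valid_words ((p ++ [:: z; y] ++ t) :: rs) -> forall x,
  undirected (cycles_graph ((p ++ [:: z; y] ++ t) :: rs)) (y, x) =
  ((x == head (head z p) t) + (x == z))%N.
Proof.
move=> /valid_words_cons[_ ut _ out] x.
rewrite undirected_cycles_cons graphDE [X in (_ + X)%N]undirected_cycles_out ?addn0; last first.
  by apply: out; rewrite !mem_cat !inE eqxx !orbT.
have e : p ++ [:: z; y] ++ t = rcons p z ++ y :: t by rewrite cat_rcons.
rewrite e cycle_graph_catC /=; move: ut; rewrite e uniq_catC /= => /andP[].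
case qE : (t ++ rcons p z) => [|b q].
  by move/eqP: qE; rewrite -size_eq0 size_cat size_rcons addnS.
move=> yq _; rewrite undirected_cycle_head //.
have -> : last b q = z by rewrite -[last b q]/(last y (b :: q)) -qE last_cat last_rcons.
have -> : b = head (head z p) t by move: qE; case: (t) => [|? ?] []; case: (p) => [|? ?] [].
by [].
Qed.

(** The two neighbours of [y] in its cycle are read off the graph; one is the
previous letter [z], the other is the next letter, or the first letter of the
word when the word ends. *)
Lemma walk_determined p y z s s' ws ws' :
  valid_words ((p ++ [:: z; y] ++ s) :: ws) -> valid_words ((p ++ [:: z; y] ++ s') :: ws') ->
  undirected (cycles_graph ((p ++ [:: z; y] ++ s) :: ws)) =
  undirected (cycles_graph ((p ++ [:: z; y] ++ s') :: ws')) -> s = s'.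
Proof.
elim: s p y z s' => [|b s IHs] p y z s' v1 v2 e.
  have := cycle_neighbours v2 (head z p); rewrite -e cycle_neighbours // eqxx => /addIn.
  case: s' v2 {e} => [|b s'] //= v2.
  have -> // : (head z p == b) = false.
  have [_ us' _ _] := valid_words_cons v2; apply: contraTF us' => /eqP<-.
  by case: (p) => [|a p'] /=; rewrite ?mem_cat !inE eqxx ?orbT ?andbF.
have := cycle_neighbours v1 b; rewrite e (cycle_neighbours v2) eqxx => /addIn.
case: s' v2 e => [|b' s'] //= v2 e.
  have -> // : (b == head z p) = false.
  have [_ us _ _] := valid_words_cons v1; apply: contraTF us => /eqP->.
  by case: (p) => [|a p'] /=; rewrite ?mem_cat !inE eqxx ?orbT ?andbF.
case: eqP => // bb' _; congr (_ :: _); first by [].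
have cat1 (q : seq L) : (p ++ [:: z; y] ++ b :: q) = (rcons p z ++ [:: y; b] ++ q).
  by rewrite cat_rcons.
have v2' : valid_words ((p ++ [:: z; y] ++ b :: s') :: ws') by rewrite bb'.
rewrite -bb' -[[:: z, y, b & s]]/([:: z; y] ++ b :: s) -[[:: z, y, b & s']]/([:: z; y] ++ b :: s') in e.
by rewrite !cat1 in v1 v2' e; apply: IHs v1 v2' e.
Qed.

(** The second letter of one word is a neighbour of [a], so it is the second or
the last letter of the other word; from there on the walk is determined. *)
Lemma word_determined a t t' ws ws' :
  valid_words ((a :: t) :: ws) -> valid_words ((a :: t') :: ws') ->
  undirected (cycles_graph ((a :: t) :: ws)) = undirected (cycles_graph ((a :: t') :: ws')) ->
  t' = t \/ t' = rev t.
Proof.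
move=> v1 v2 e.
have [_ u1 _ out1] := valid_words_cons v1; have [_ u2 _ out2] := valid_words_cons v2.
have one b s vs : valid_words ((a :: b :: s) :: vs) -> forall x,
    undirected (cycles_graph ((a :: b :: s) :: vs)) (a, x) = ((x == b) + (x == last b s))%N.
  move=> /valid_words_cons[_ us _ out] x; rewrite undirected_cycles_cons graphDE.
  rewrite undirected_cycle_head; last by case/andP: us.
  by rewrite undirected_cycles_out ?addn0 // out ?mem_head.
have loop vs : valid_words ([:: a] :: vs) -> forall x, x != a ->
    undirected (cycles_graph ([:: a] :: vs)) (a, x) = 0%N.
  move=> /valid_words_cons[_ _ _ out] x /negPf xa; rewrite undirected_cycles_cons graphDE.
  rewrite undirected_cycles_out ?out ?mem_head // addn0 undirectedD graphDE undirected_edge.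
  by rewrite !ffunE xa /= andbF.
case: t v1 u1 e out1 => [|b s] v1 u1 e out1; case: t' v2 u2 e out2 => [|b' s'] v2 u2 e out2.
- by left.
- have := one _ _ _ v2 b'; rewrite -e eqxx loop //.
  by move: u2; rewrite /= inE eq_sym negb_or => /andP[/andP[]].
- have := one _ _ _ v1 b; rewrite e eqxx loop //.
  by move: u1; rewrite /= inE eq_sym negb_or => /andP[/andP[]].
have := one _ _ _ v1 b; rewrite e (one _ _ _ v2) eqxx.
have [bb' _|_] := eqVneq b b'.
  by left; rewrite -bb' in v2 e *; rewrite (@walk_determined [::] b a s s' ws ws').
case: eqP => // b_last _; right.
have rev_s' : rev (b' :: s') = b :: rev (belast b' s') by rewrite rev_cons_last -b_last.
have v2' : valid_words ((a :: rev (b' :: s')) :: ws').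
  move: v2; rewrite /valid_words !inE => /andP[uq ->]; rewrite andbT.
  rewrite (perm_uniq (s2 := flatten ((a :: b' :: s') :: ws'))) //=.
  by rewrite perm_cons -cat_cons perm_cat2r perm_rev.
have e' : undirected (cycles_graph ((a :: b :: s) :: ws)) =
    undirected (cycles_graph ((a :: rev (b' :: s')) :: ws')).
  rewrite e !undirected_cycles_cons; congr (_ + _).
  by rewrite -undirected_cycle_rev rev_cons -cats1 cycle_graph_catC.
rewrite -[LHS]revK; congr (rev _); rewrite rev_s' in v2' e' *; congr (_ :: _).
by apply: esym; apply: (@walk_determined [::] b a) e'.
Qed.
End Undirected.

(** * From traces to functions on graphs *)

Section GraphFunction.
Variables (L : finType) (Q : zmodType) (f : seq (seq L) -> Q).
Implicit Types (g h : graph L) (a b c d x y z : L) (w u v s t : seq L) (ws us : seq (seq L)).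
Hypothesis Q2 : forall x : Q, x + x = 0 -> x = 0.
Hypothesis ft : trace f.

Lemma trace_loop a ws : f ([:: a] :: ws) = 0.
Proof.
have e : f ([:: a] :: ws) = - f ([:: a] :: ws) := tr_rev ft [:: a] ws.
by apply: Q2; rewrite {1}e addNr.
Qed.

Lemma cycle_graph_rotn k w : cycle_graph (rot k w) = cycle_graph w.
Proof. exact/rot_invariant/cycle_graph_rot. Qed.

(** The normalisation by [parity] depends only on the undirected graph of the
words, see [word_value_unique]. *)
Definition word_value ws : Q := signed (parity (cycles_graph ws)) (f ws).

Lemma word_value_perm ws ws' : perm_eq ws ws' -> word_value ws = word_value ws'.
Proof.
by move=> eq_ws; rewrite /word_value (tr_perm ft eq_ws) /cycles_graph (perm_big _ eq_ws).
Qed.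

Lemma word_value_rot k w ws : word_value (rot k w :: ws) = word_value (w :: ws).
Proof.
apply: (rot_invariant (F := fun w => word_value (w :: ws))) => {}w.
by rewrite /word_value (tr_rot ft) /cycles_graph !big_cons cycle_graph_rot.
Qed.

Lemma word_value_rev w ws : uniq w -> word_value (rev w :: ws) = word_value (w :: ws).
Proof.
move=> uw; have [sz|sz] := eqVneq (size w) 1%N.
  by case: w sz {uw} => [|a []].
rewrite /word_value (tr_rev ft) /cycles_graph !big_cons !parityD parity_cycle_rev //.
by rewrite signed_signed; congr (signed _ _); case: (odd _); case: (parity _); case: (parity _).
Qed.

Lemma valid_words_perm ws ws' : perm_eq ws ws' -> valid_words ws = valid_words ws'.
Proof.
move=> eq_ws; rewrite /valid_words (perm_mem eq_ws); congr (_ && _).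
exact/perm_uniq/perm_flatten.
Qed.

Lemma cycles_graph_perm ws ws' : perm_eq ws ws' -> cycles_graph ws = cycles_graph ws'.
Proof. exact: perm_big. Qed.

Lemma bring_front a ws : a \in flatten ws -> exists t ws',
  [/\ perm_eq (flatten ((a :: t) :: ws')) (flatten ws),
      valid_words ws -> valid_words ((a :: t) :: ws'),
      cycles_graph ((a :: t) :: ws') = cycles_graph ws &
      forall us, word_value ((a :: t) :: ws' ++ us) = word_value (ws ++ us)].
Proof.
case/flattenP => w w_ws a_w; have [k t rotE] := rot_to a_w.
case/splitPr: w_ws => p q; exists t, (p ++ q).
have prm : perm_eq (w :: p ++ q) (p ++ w :: q) by apply: permEl (perm_catCA [:: w] p q).
have flat : perm_eq (flatten ((a :: t) :: p ++ q)) (flatten (p ++ w :: q)).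
  by rewrite -(permPr (perm_flatten prm)) /= -cat_cons perm_cat2r -rotE perm_rot.
split=> //.
- case/andP=> u n; rewrite /valid_words (perm_uniq flat) u inE negb_or /=.
  by move: n; rewrite -(perm_mem prm) inE negb_or => /andP[].
- by rewrite -(cycles_graph_perm prm) -rotE /cycles_graph !big_cons cycle_graph_rotn.
- move=> us; rewrite -rotE word_value_rot; apply: word_value_perm.
  by rewrite -cat_cons perm_cat2r.
Qed.

(** A letter of the first word lies on one word of the other list, which equals
the first word up to rotation and reversal. This common word is moved to [us]. *)
Lemma word_value_unique ws ws' us :
  valid_words (ws ++ us) -> valid_words ws -> valid_words ws' ->
  perm_eq (flatten ws) (flatten ws') ->
  undirected (cycles_graph ws) = undirected (cycles_graph ws') ->
  word_value (ws ++ us) = word_value (ws' ++ us).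
Proof.
elim: ws ws' us => [|w ws IHws] ws' us v_us v v' prm e.
  case: ws' v' prm {e} => [|w ws'] // v'; have [w0 _ _ _] := valid_words_cons v'.
  by rewrite perm_sym => /perm_size/esym; case: w w0 {v'}.
have [w0 uw v_ws _] := valid_words_cons v; case: w w0 uw v v_us prm e => // a t _ uw v v_us prm e.
have [|t' [ws1 [prm1 v1 e1 val1]]] := @bring_front a ws'.
  by rewrite -(perm_mem prm) mem_head.
rewrite -val1; have {}v1 := v1 v'; rewrite -e1 in e.
have [_ ut' v_ws1 _] := valid_words_cons v1.
have [val2 cyc2 prm2] : [/\ word_value ((a :: t') :: ws1 ++ us) = word_value ((a :: t) :: ws1 ++ us),
    undirected (cycle_graph (a :: t')) = undirected (cycle_graph (a :: t)) & perm_eq t' t].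
  have [->|t'E] := word_determined v v1 e; first by split.
  have t'E' : a :: t' = rotr 1 (rev (a :: t)) by rewrite t'E rev_cons rotr1_rcons.
  split; last by rewrite t'E perm_rev.
    by rewrite -(word_value_rot 1 (a :: t')) t'E' rotrK word_value_rev.
  by rewrite -(cycle_graph_rotn 1) t'E' rotrK undirected_cycle_rev.
rewrite val2 !(word_value_perm (ws := (a :: t) :: _ ++ us) (permEl (perm_catCA [:: _] _ us))).
apply: IHws => //.
- by rewrite (valid_words_perm (permEl (perm_catCA ws [:: _] us))).
- have := perm_trans prm (_ : perm_eq _ (flatten ((a :: t') :: ws1))).
  rewrite perm_sym prm1 => /(_ isT) /=; rewrite perm_cons => prm3.
  by rewrite -(perm_cat2l t) (perm_trans prm3) // perm_cat2r.
- by move: e; rewrite !undirected_cycles_cons cyc2 => /graph_addI.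
Qed.

Definition represents g ws : Prop :=
  [/\ valid_words ws, perm_eq (flatten ws) (enum L)
    & undirected (cycles_graph ws) = undirected g].

Definition graph_function g : Q :=
  if pselect (exists ws, represents g ws) is left rep
  then signed (parity g) (word_value (projT1 (cid rep))) else 0.

Lemma graph_function_rep g ws : represents g ws ->
  graph_function g = signed (parity g) (word_value ws).
Proof.
move=> gws; rewrite /graph_function; case: pselect => [rep|[]]; last by exists ws.
have [v p e] := gws; have [v' p' e'] := projT2 (cid rep).
congr (signed _ _); rewrite -[projT1 _]cats0 -[ws]cats0; apply: word_value_unique => //.
- by rewrite cats0.
- by rewrite (permPl p') perm_sym.
- by rewrite e.
Qed.

Lemma graph_function_out g : ~ (exists ws, represents g ws) -> graph_function g = 0.
Proof. by rewrite /graph_function; case: pselect. Qed.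

Lemma locate_edge a b ws : valid_words ws -> (0 < undirected (cycles_graph ws) (a, b))%N ->
  exists s ws', [/\ last b s = a, perm_eq (flatten ((b :: s) :: ws')) (flatten ws),
    valid_words ((b :: s) :: ws')
    & undirected (cycles_graph ((b :: s) :: ws')) = undirected (cycles_graph ws)].
Proof.
move=> v ab; have [a_ws|a_ws] := boolP (a \in flatten ws); last first.
  by rewrite undirected_cycles_out in ab.
have [t [ws' [prm /(_ v) v' e _]]] := bring_front a_ws.
have [_ ut _ out] := valid_words_cons v'.
have {}ab : (0 < undirected (cycle_graph (a :: t)) (a, b))%N.
  by rewrite -e undirected_cycles_cons graphDE (undirected_cycles_out b (out a _)) ?mem_head ?addn0 in ab.
have rebuild s : perm_eq (b :: s) (a :: t) ->
    undirected (cycle_graph (b :: s)) = undirected (cycle_graph (a :: t)) ->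
    [/\ perm_eq (flatten ((b :: s) :: ws')) (flatten ws), valid_words ((b :: s) :: ws')
      & undirected (cycles_graph ((b :: s) :: ws')) = undirected (cycles_graph ws)].
  move=> prm_s e_s; have prm' : perm_eq (flatten ((b :: s) :: ws')) (flatten ((a :: t) :: ws')).
    by rewrite /= -!cat_cons perm_cat2r.
  split; first exact: perm_trans prm' prm.
    by move: v'; rewrite /valid_words (perm_uniq prm') !inE.
  by rewrite -e !undirected_cycles_cons e_s.
case: t {prm e v' out} ut ab rebuild => [|d t] ut ab rebuild.
  have ba : b = a.
    apply/eqP; move: ab; rewrite undirectedD graphDE undirected_edge !ffunE addn0 andbC.
    by case: (b == a); rewrite ?andbF.
  have [] := rebuild [::]; rewrite ?ba //.
  by exists [::], ws'.
move: ab; rewrite undirected_cycle_head; last by case/andP: ut.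
have [bd _|_] := eqVneq b d.
  have rotE : b :: rcons t a = rot 1 [:: a, d & t] by rewrite rot1_cons bd.
  have [] := rebuild (rcons t a); rewrite ?rotE ?perm_rot ?cycle_graph_rotn // => p1 v1 e1.
  by exists (rcons t a), ws'; rewrite last_rcons rotE.
rewrite add0n lt0b => /eqP bE.
have revE : b :: rev (belast a (d :: t)) = rev [:: a, d & t] by rewrite rev_cons_last bE.
have [] := rebuild (rev (belast a (d :: t))); rewrite ?revE ?perm_rev ?undirected_cycle_rev //.
move=> p1 v1 e1; exists (rev (belast a (d :: t))), ws'; rewrite revE; split=> //.
by rewrite bE; apply: (last_rev_belast a (d :: t)).
Qed.

(** Exchanging the closing edges of two cycles joins them, with or without a
reversal of the first. *)
Lemma graph_function_join h b s d t ws :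
  valid_words ((b :: s) :: (d :: t) :: ws) ->
  perm_eq (flatten ((b :: s) :: (d :: t) :: ws)) (enum L) ->
  undirected h = undirected (path_graph b s + path_graph d t + cycles_graph ws) ->
  let a := last b s in let c := last d t in
  graph_function (h + (edge a b + edge c d)) =
  graph_function (h + (edge a d + edge c b)) + graph_function (h + (edge a c + edge b d)).
Proof.
move=> v prm e a c.
pose h0 := path_graph b s + path_graph d t + cycles_graph ws; rewrite -/h0 in e.
have ac : a != c.
  have [_ _ _ out] := valid_words_cons v; have := out a (mem_last b s).
  by apply: contraNneq => ->; rewrite -[flatten _]/((d :: t) ++ flatten ws) mem_cat mem_last.
have us : uniq (b :: s) by have [] := valid_words_cons v.
have cyc1 : cycles_graph ((b :: s) :: (d :: t) :: ws) = h0 + (edge a b + edge c d).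
  by rewrite /h0 /cycles_graph !big_cons /= -/a -/c; apply/ffunP => z; rewrite !graphDE; lia.
have cyc2 : cycles_graph (((b :: s) ++ d :: t) :: ws) = h0 + (edge a d + edge c b).
  rewrite /h0 /cycles_graph !big_cons /= path_graph_cat last_cat /= -/a -/c.
  by apply/ffunP => z; rewrite !graphDE; lia.
have cyc3 : cycles_graph ((rev (b :: s) ++ d :: t) :: ws) =
    (path_graph a (rev (belast b s)) + path_graph d t + cycles_graph ws) + (edge c a + edge b d).
  rewrite rev_cons_last /cycles_graph !big_cons /= path_graph_cat last_cat /= last_rev_belast -/a -/c.
  by apply/ffunP => z; rewrite !graphDE; lia.
have prm12 : perm_eq (flatten (((b :: s) ++ d :: t) :: ws)) (flatten ((b :: s) :: (d :: t) :: ws)).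
  by rewrite /= -!catA.
have prm13 : perm_eq (flatten ((rev (b :: s) ++ d :: t) :: ws)) (flatten ((b :: s) :: (d :: t) :: ws)).
  by rewrite [flatten _]/= [X in perm_eq _ X]/= -catA -cat_cons perm_cat2r perm_rev.
have v' w : w != [::] -> perm_eq (flatten (w :: ws)) (flatten ((b :: s) :: (d :: t) :: ws)) ->
    valid_words (w :: ws).
  move=> w0 /perm_uniq u; case/andP: v => uf n; rewrite /valid_words u uf inE negb_or eq_sym w0.
  by move: n; rewrite !inE.
rewrite (@graph_function_rep _ ((b :: s) :: (d :: t) :: ws)); last first.
  by split=> //; rewrite cyc1 (undirectedD h0) (undirectedD h) e.
rewrite (@graph_function_rep _ (((b :: s) ++ d :: t) :: ws)); last first.
  by split; rewrite ?(permPl prm12) //; [apply: v' | rewrite cyc2 (undirectedD h0) (undirectedD h) e].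
rewrite (@graph_function_rep _ ((rev (b :: s) ++ d :: t) :: ws)); last first.
  split; rewrite ?(permPl prm13) //; first by apply: (v' _ _ prm13); rewrite rev_cons_last.
  rewrite cyc3 !undirectedD e /h0 !undirectedD undirected_path_rev.
  by rewrite (undirected_edgeC c a).
rewrite /word_value cyc1 cyc2 cyc3 (tr_join ft) !signed_signed !parityD.
rewrite parity_path_rev // (parity_edgeC ac) signedD signed_signed.
congr (signed _ _ + signed _ _).
  by repeat match goal with |- context [parity ?g] => case: (parity g) end.
rewrite [size (b :: s)]/= oddS; case: (odd (size s));
  by repeat match goal with |- context [parity ?g] => case: (parity g) end.
Qed.

Lemma graph_function_loop h a : graph_function (h + edge a a) = 0.
Proof.
have [[ws [v prm e]]|] := pselect (exists ws, represents (h + edge a a) ws); last exact: graph_function_out.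
have [|s [ws' [s_last prm' v' e']]] := @locate_edge a a ws v.
  by rewrite e undirectedD graphDE undirected_edge !eqxx; lia.
rewrite (@graph_function_rep _ ((a :: s) :: ws')); last first.
  by split=> //; [rewrite (permPl prm') | rewrite e'].
have [_ us _ _] := valid_words_cons v'.
case: s s_last us {prm' v' e'} => [|b s] s_last us.
  by rewrite /word_value trace_loop; case: parity; case: parity; rewrite /= ?oppr0.
by move: us; rewrite -{1}s_last /= mem_last.
Qed.

Lemma graph_function_sign h a b : graph_function (h + edge a b) = - graph_function (h + edge b a).
Proof.
have [<-|ab] := eqVneq a b; first by rewrite graph_function_loop oppr0.
have same : undirected (h + edge a b) = undirected (h + edge b a).
  by rewrite !undirectedD undirected_edgeC.
have [[ws gws]|ng] := pselect (exists ws, represents (h + edge a b) ws); last first.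
  rewrite !graph_function_out ?oppr0 // => -[ws [v prm e]].
  by apply: ng; exists ws; split; rewrite // e same.
have gws' : represents (h + edge b a) ws by case: gws => v prm e; split; rewrite // e same.
rewrite (graph_function_rep gws) (graph_function_rep gws') !parityD (parity_edgeC ab).
by case: (parity h); case: (parity (edge b a)); rewrite /= ?opprK.
Qed.

(** The two edges lie either on different words, or on the same word, which they
cut in two. In the second case the relation of [graph_function_join] is read from
another of its terms. *)
Lemma graph_function_exchange_rep h a b c d :
  (exists ws, represents (h + (edge a b + edge c d)) ws) ->
  graph_function (h + (edge a b + edge c d)) =
  graph_function (h + (edge a d + edge c b)) + graph_function (h + (edge a c + edge b d)).
Proof.
case=> ws [v prm e].
have [|s [ws1 [s_last prm1 v1 e1]]] := @locate_edge a b ws v.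
  by rewrite e !undirectedD !graphDE undirected_edge !eqxx; lia.
have e2 : undirected (h + edge c d) = undirected (path_graph b s + cycles_graph ws1).
  apply: (@graph_addI _ (undirected (edge a b))).
  have -> : undirected (edge a b) + undirected (path_graph b s + cycles_graph ws1) =
      undirected (cycles_graph ((b :: s) :: ws1)).
    by rewrite -undirectedD /cycles_graph big_cons /= s_last addrA.
  rewrite e1 e -undirectedD; congr undirected.
  by apply/ffunP => z; rewrite !graphDE; lia.
have e2' x y g (eg : undirected (h + edge x y) = undirected g) :
    undirected (edge x y) + undirected h = undirected g.
  by rewrite addrC -undirectedD.
have prm1' : perm_eq (flatten ((b :: s) :: ws1)) (enum L) by rewrite (permPl prm1).
have [us uws1 n1] : [/\ uniq (b :: s), valid_words ws1 & forall x, x \in b :: s -> x \notin flatten ws1].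
  by have [] := valid_words_cons v1.
have [cd|cd] := posnP (undirected (cycles_graph ws1) (c, d)); last first.
  have [t [ws2 [t_last prm2 v2 e3]]] := locate_edge uws1 cd.
  have prm12 : perm_eq (flatten ((b :: s) :: (d :: t) :: ws2)) (flatten ((b :: s) :: ws1)).
    by rewrite -[flatten _]/((b :: s) ++ flatten ((d :: t) :: ws2)) perm_cat2l.
  have := @graph_function_join h b s d t ws2; rewrite /= s_last t_last; apply.
  - case/andP: v1 => u1 nn1; rewrite /valid_words (perm_uniq prm12) u1 !inE.
    by case/andP: v2 => _; rewrite inE.
  - by rewrite (permPl prm12).
  apply: (@graph_addI _ (undirected (edge c d))); apply: etrans (e2' _ _ _ e2) _.
  rewrite undirectedD.
  rewrite -e3 -!undirectedD /cycles_graph big_cons /= t_last; congr undirected.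
  by apply/ffunP => z; rewrite !graphDE; lia.
(* both edges lie on the word b :: s *)
have path_edge : (0 < undirected (path_graph b s) (c, d))%N.
  move/ffunP: e2 => /(_ (c, d)); rewrite !undirectedD !graphDE cd undirected_edge !eqxx; lia.
have split_path x y b1 s1 : (0 < path_graph b1 s1 (x, y))%N -> exists u t,
    [/\ b1 :: s1 = (b1 :: u) ++ y :: t, last b1 u = x &
        path_graph b1 s1 = path_graph b1 u + edge x y + path_graph y t].
  elim: s1 b1 => [|z s1 IHs] b1 /=; first by rewrite ffunE.
  have [xy _|nxy] := eqVneq (x, y) (b1, z).
    by case: xy => -> ->; exists [::], s1; rewrite /= add0r.
  rewrite graphDE ffunE (negPf nxy) => /IHs[u [t [-> ux ->]]].
  by exists (z :: u), t; rewrite /= !addrA.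
have same_word c' d' : (0 < path_graph b s (c', d'))%N ->
    undirected (h + edge c' d') = undirected (path_graph b s + cycles_graph ws1) ->
    graph_function (h + (edge a b + edge c' d')) =
    graph_function (h + (edge a d' + edge c' b)) + graph_function (h + (edge a c' + edge b d')).
  move=> /split_path[u [t [sE u_last pE]]] e3.
  have t_last : last d' t = a by rewrite -s_last -[last b s]/(last b (b :: s)) sE last_cat.
  have := @graph_function_join h b u d' t ws1; rewrite /= u_last t_last => jn.
  have {}jn : graph_function (h + (edge c' b + edge a d')) =
      graph_function (h + (edge c' d' + edge a b)) + graph_function (h + (edge c' a + edge b d')).
    apply: jn.
    - case/andP: v1 => u1 nn1; rewrite /valid_words; apply/andP; split.
        by move: u1; rewrite -[flatten _]/((b :: s) ++ flatten ws1) sE -catA.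
      by move: nn1; rewrite !inE.
    - by have := prm1'; rewrite -[flatten _]/((b :: s) ++ flatten ws1) sE -catA.
    apply: (@graph_addI _ (undirected (edge c' d'))); apply: etrans (e2' _ _ _ e3) _.
    rewrite pE -undirectedD; congr undirected; by apply/ffunP => z; rewrite !graphDE; lia.
  rewrite (addrC (edge a b)) (addrC (edge a d')) jn (addrC (edge c' a)) (addrC (edge a c')).
  by rewrite !(addrA h) (graph_function_sign _ c' a) addrNK.
move: path_edge; rewrite undirectedE addn_gt0 => /orP[/same_word|]; first exact.
move=> /same_word; rewrite -e2 !undirectedD [undirected (edge d c)]undirected_edgeC => /(_ erefl) jn.
move: jn; rewrite !(addrA h) => jn.
rewrite (graph_function_sign _ c d) jn (graph_function_sign _ c b) (graph_function_sign _ b d).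
by rewrite opprD; apply: addrC.
Qed.

(** If one of the three graphs of a Pluecker relation is a union of cycles then
so are the others. When none of them is, the relation is 0 = 0 + 0. *)
Theorem graph_function_plucker : plucker graph_function.
Proof.
split; [exact: graph_function_loop | exact: graph_function_sign | move=> h a b c d].
pose rep (g : graph L) := exists ws, represents (h + g) ws.
have [|n1] := pselect (rep (edge a b + edge c d)); first exact: graph_function_exchange_rep.
have [r2|n2] := pselect (rep (edge a d + edge c b)).
  rewrite (graph_function_exchange_rep r2) !(addrA h) (graph_function_sign _ d b).
  by rewrite addrNK.
have [r3|n3] := pselect (rep (edge a c + edge b d)).
  rewrite (graph_function_exchange_rep r3) !(addrA h) (graph_function_sign _ c b).
  by rewrite addrA addNr add0r.
by rewrite !graph_function_out // addr0.
Qed.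
End GraphFunction.

(** * The union of two matchings *)

Section TwoMatchings.
Variable L : finType.
Implicit Types (g h : graph L) (a b c d : L) (w u v s t x y : seq L) (ws us : seq (seq L)).

Lemma undirected_signed (A : zmodType) (f : graph L -> A) g g' : plucker f ->
  undirected g = undirected g' -> f g = signed (parity g (+) parity g') (f g').
Proof.
move=> fp; have [m] := ubnP (\sum_e (g e - g' e))%N; elim: m g => // m IHm g lt_m e.
have eE z : undirected g z = undirected g' z by rewrite e.
have [/existsP[[a b] gt_ab]|] := boolP [exists e, (g' e < g e)%N]; last first.
  rewrite negb_exists => /forallP le_g; suff -> : g = g' by rewrite addbb.
  apply/ffunP => -[a b]; have eab := eE (a, b); rewrite !undirectedE in eab.
  have le z : (g z <= g' z)%N by rewrite leqNgt.
  have sum_le (p q r s : nat) : (p <= r -> q <= s -> p + q = r + s -> p = r)%N by lia.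
  exact: sum_le (le (a, b)) (le (b, a)) eab.
have eab := eE (a, b); rewrite !undirectedE in eab.
have ab : a != b by apply: contraTneq gt_ab => ab; rewrite ab in eab *; lia.
pose k : graph L := [ffun e => (g e - edge a b e)%N].
have gE : g = k + edge a b.
  apply/ffunP => z; rewrite graphDE [k z]ffunE subnK // ffunE.
  by case: eqP => // ->; apply: leq_ltn_trans gt_ab.
have eq_und : undirected (k + edge b a) = undirected g'.
  by rewrite -e gE !undirectedD undirected_edgeC.
rewrite gE (pl_sign fp) (IHm (k + edge b a)) //; last first.
  rewrite ltnS in lt_m; apply: leq_trans lt_m.
  rewrite (bigD1 (a, b)) //= [X in (_ <= X)%N](bigD1 (a, b)) //= -addSn leq_add //.
    rewrite graphDE [k _]ffunE !ffunE !xpair_eqE !eqxx (negPf ab) /=.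
    by move: gt_ab; lia.
  apply: leq_sum => z; rewrite graphDE [k z]ffunE !ffunE => /negPf->.
  case: eqP => [->|_]; last by rewrite addn0 subn0.
  by move: gt_ab eab; rewrite subn0; lia.
rewrite !parityD (parity_edgeC ab) -signed_neg; congr (signed _ _).
by case: (parity k); case: (parity (edge b a)); case: (parity g').
Qed.

Lemma path_graph_matchings a t : path_graph a t = matching_graph (a :: t) + matching_graph t.
Proof. by elim: t a => [|b t IHt] a //=; rewrite ?addr0 // IHt addrAC addrA. Qed.

Lemma matching_graph_rcons b t a : even_word t ->
  matching_graph (rcons (b :: t) a) = matching_graph (b :: t) + edge (last b t) a.
Proof.
move=> ev; elim/even_word_ind: t / ev b => [|c d t _ IHt] b; first by rewrite /= addr0 add0r.
by rewrite [LHS](_ : _ = edge b c + matching_graph (rcons (d :: t) a)) // IHt /= addrA.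
Qed.

Lemma cycle_graph_matchings w : even_word w ->
  cycle_graph w = matching_graph w + matching_graph (rot 1 w).
Proof.
case: w => [|a [|b t]] // ev; first by rewrite /= addr0.
rewrite rot1_cons matching_graph_rcons; last first.
  by move: ev; rewrite /even_word /= negbK.
by rewrite cycle_graph_cons path_graph_matchings [LHS]addrC -addrA.
Qed.

Lemma cycles_graph_matchings ws : all_even ws ->
  cycles_graph ws = matchings_graph ws + matchings_graph (map (rot 1) ws).
Proof.
move=> ev; rewrite /cycles_graph /matchings_graph big_map -big_split !big_seq.
by apply: eq_bigr => w w_ws; apply: cycle_graph_matchings; apply: (allP ev).
Qed.

Lemma matching_graph_rot_even k w : even_word w -> ~~ odd k ->
  matching_graph (rot k w) = matching_graph w.
Proof.
move=> ev odk; have [le_k|lt_k] := leqP k (size w); last by rewrite rot_oversize // ltnW.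
have ev_take : even_word (take k w) by rewrite /even_word size_takel.
have ev_drop : even_word (drop k w).
  by move: ev; rewrite -{1}(cat_take_drop k w) even_word_cat ev_take => /eqP<-.
by rewrite /rot matching_graph_cat // -{3}(cat_take_drop k w) matching_graph_cat // addrC.
Qed.

Lemma pair_front x a : even_word x -> a \in x -> exists c x1,
  [/\ even_word x1, perm_eq x [:: a, c & x1] &
      undirected (matching_graph x) = undirected (matching_graph [:: a, c & x1])].
Proof.
move=> ev; elim/even_word_ind: x / ev => // p q t ev_t IHt; rewrite !inE => /or3P[/eqP->|/eqP->|].
- by exists q, t.
- exists p, t; split=> //; first by apply: permEl (perm_catCA [:: p] [:: q] t).
  by rewrite /= !undirectedD undirected_edgeC.
move=> /IHt[c [x1 [ev1 prm e]]]; exists c, [:: p, q & x1]; split.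
- by move: ev1; rewrite /even_word /= negbK.
- rewrite (perm_trans (_ : perm_eq _ ([:: p; q] ++ [:: a; c] ++ x1))) //; first by rewrite !perm_cons.
  exact: permEl (perm_catCA [:: p; q] [:: a; c] x1).
- by move: e; rewrite /= !undirectedD => ->; rewrite addrCA.
Qed.

Lemma locate_pair c d ws : all_even ws -> (0 < undirected (matchings_graph ws) (c, d))%N ->
  exists c' d' t ws1, [/\ (c', d') = (c, d) \/ (c', d') = (d, c),
    all_even ([:: c', d' & t] :: ws1), perm_eq (flatten ([:: c', d' & t] :: ws1)) (flatten ws),
    matchings_graph ([:: c', d' & t] :: ws1) = matchings_graph ws &
    matchings_graph (map (rot 1) ([:: c', d' & t] :: ws1)) = matchings_graph (map (rot 1) ws)]
    /\ ([::] \notin ws -> [::] \notin ws1).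
Proof.
move=> ev cd.
have [w [ws1 [prm cd_w]]] : exists w ws1, perm_eq ws (w :: ws1) /\
    (0 < undirected (matching_graph w) (c, d))%N.
  elim: ws cd {ev} => [|w ws IHws]; first by rewrite /matchings_graph big_nil !ffunE.
  rewrite matchings_graph_cons undirectedD graphDE addn_gt0 => /orP[cd|/IHws[v [vs [prm cd]]]].
    by exists w, ws.
  exists v, (w :: vs); split=> //.
  rewrite (perm_trans (_ : perm_eq _ (w :: v :: vs))) ?perm_cons //.
  exact: permEl (perm_catCA [:: w] [:: v] vs).
have := ev; rewrite /all_even (perm_all _ prm) => /= /andP[ev_w ev1].
have [p [c' [d' [t [cd' ev_p wE]]]]] : exists p c' d' t,
    [/\ (c', d') = (c, d) \/ (c', d') = (d, c), even_word p & w = p ++ [:: c', d' & t]].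
  elim/even_word_ind: w / ev_w cd_w {prm} => [|a b t _ IHt] /=; first by rewrite !ffunE.
  rewrite undirectedD graphDE undirected_edge addn_gt0 => /orP[|/IHt[p [c' [d' [t' [e ev_p ->]]]]]].
    rewrite addn_gt0 !lt0b => /orP[] /andP[/eqP-> /eqP->].
      by exists [::], a, b, t; split=> //; left.
    by exists [::], a, b, t; split=> //; right.
  by exists [:: a, b & p], c', d', t'; split=> //; move: ev_p; rewrite /even_word /= negbK.
have rotE : [:: c', d' & t] ++ p = rot (size p) w by rewrite wE rot_size_cat.
have odp : ~~ odd (size p) by [].
exists c', d', (t ++ p), ws1; rewrite -!cat_cons rotE; split; last first.
  by rewrite (perm_mem prm) inE negb_or => /andP[].
split=> //.
- by rewrite /= even_word_rot ev_w.
- by rewrite (permPr (perm_flatten prm)) /= perm_cat2r perm_rot.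
- rewrite !matchings_graph_cons matching_graph_rot_even // -matchings_graph_cons.
  exact/esym/perm_big.
- rewrite /= !matchings_graph_cons rot_rot matching_graph_rot_even ?even_word_rot //.
  by rewrite -matchings_graph_cons; apply/esym/perm_big/(perm_map (rot 1) prm).
Qed.

(** Induction on the number of edges. Let ab be an edge of [y]. If [x] contains
it too, it is a cycle. Otherwise the edges ac and bd of [x] and the edge ab of [y]
are contracted to an edge cd of [x], and [a] and [b] are inserted again in the
cycle where cd occurs. *)
Lemma pair_cycles x y : even_word y -> perm_eq x y -> uniq x -> exists ws,
  [/\ all_even ws, [::] \notin ws, perm_eq (flatten ws) x,
      undirected (matchings_graph ws) = undirected (matching_graph x) &
      undirected (matchings_graph (map (rot 1) ws)) = undirected (matching_graph y)].
Proof.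
move=> ev; elim/even_word_ind: y / ev x => [|a b y ev_y IHy] x prm ux.
  by exists [::]; rewrite (perm_small_eq _ prm) // /matchings_graph !big_nil.
have ev_x : even_word x by rewrite /even_word (perm_size prm) /= negbK.
have a_x : a \in x by rewrite (perm_mem prm) mem_head.
have [c [x1 [ev1 prm1 e1]]] := pair_front ev_x a_x.
have prm2 : perm_eq (c :: x1) (b :: y).
  by rewrite -(perm_cons a) -(permPl prm1).
have u1 : uniq [:: a, c & x1] by rewrite -(perm_uniq prm1).
have [cb|cb] := eqVneq c b.
  have [||ws [ev_ws n0 prm_ws e2 e3]] := IHy x1.
  - by rewrite -(perm_cons b) -{1}cb.
  - by case/and3P: u1.
  exists ([:: a; b] :: ws); split=> //.
  - by rewrite (permPr prm1) /= cb !perm_cons.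
  - by rewrite matchings_graph_cons undirectedD e2 e1 cb /= addr0 !undirectedD.
  - rewrite /= matchings_graph_cons undirectedD e3 rot1_cons /= addr0 !undirectedD.
    by rewrite undirected_edgeC.
have b_x1 : b \in x1.
  by have := perm_mem prm2 b; rewrite mem_head inE eq_sym (negPf cb).
have [d [x2 [ev2 prm3 e2]]] := pair_front ev1 b_x1.
have prm4 : perm_eq [:: c, d & x2] y.
  rewrite -(perm_cons b) -(permPr prm2) (perm_trans (_ : perm_eq _ [:: c, b, d & x2])) //.
    exact: permEl (perm_catCA [:: b] [:: c] _).
  by rewrite perm_cons perm_sym.
have [|ws [ev_ws n0 prm_ws e3 e4]] := IHy _ prm4.
  rewrite (perm_uniq prm4); have : uniq (c :: x1) by case/andP: u1.
  by rewrite (perm_uniq prm2) => /andP[].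
have [|c' [d' [t [ws1 [[cd ev5 prm5 e5 e6] n5]]]]] := @locate_pair c d ws ev_ws.
  by rewrite e3 /= undirectedD graphDE undirected_edge !eqxx.
have target : undirected (matching_graph x) =
    undirected (edge a c) + undirected (edge b d) + undirected (matching_graph x2).
  by rewrite e1 /= undirectedD e2 /= undirectedD addrA.
have prm_x s : perm_eq s ([:: a; b] ++ flatten ws) -> perm_eq s x.
  move=> prm_s; rewrite (permPr prm) (perm_trans prm_s) // /= !perm_cons.
  exact: perm_trans prm_ws prm4.
have ev_t : even_word t by case/andP: ev5; rewrite /even_word /= negbK.
have ev_ws1 : all_even ws1 by case/andP: ev5.
rewrite -e5 matchings_graph_cons /= !undirectedD -addrA in e3.
rewrite -e6 /= matchings_graph_cons !undirectedD in e4.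
have x2E : undirected (matching_graph t) + undirected (matchings_graph ws1) =
    undirected (matching_graph x2).
  apply: (@graph_addI _ (undirected (edge c d))); rewrite -e3.
  by case: cd => -[-> ->] //; rewrite undirected_edgeC.
have word_even p q : even_word [:: p, a, b, q & t] /\ even_word [:: p, b, a, q & t].
  by move: ev_t; rewrite /even_word /= !negbK.
have rest_nil w : w != [::] -> [::] \notin w :: ws1.
  by move=> w0; rewrite inE negb_or eq_sym w0 n5.
have [ev_new1 ev_new2] := word_even c' d'.
case: cd prm5 e4 ev_new1 ev_new2 => -[-> ->] prm5 e4 ev_new1 ev_new2.
  exists ([:: c, a, b, d & t] :: ws1); split=> //.
  - by rewrite /= ev_new1.
  - exact: rest_nil.
  - apply: prm_x; rewrite (perm_trans (_ : perm_eq _ ([:: a; b] ++ [:: c, d & t ++ flatten ws1]))) //.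
      exact: permEl (perm_catCA [:: c] [:: a; b] _).
    by rewrite perm_cat2l.
  - rewrite target -x2E matchings_graph_cons /= !undirectedD (undirected_edgeC c a).
    by rewrite !addrA.
  - rewrite map_cons matchings_graph_cons rot1_cons undirectedD undirectedD.
    by rewrite [RHS]undirectedD -e4 rot1_cons addrA.
exists ([:: d, b, a, c & t] :: ws1); split=> //.
- by rewrite /= ev_new2.
- exact: rest_nil.
- apply: prm_x; rewrite (perm_trans (_ : perm_eq _ ([:: b; a] ++ [:: d, c & t ++ flatten ws1]))) //.
    exact: permEl (perm_catCA [:: d] [:: b; a] _).
  rewrite (perm_trans (_ : perm_eq _ ([:: a; b] ++ [:: d, c & t ++ flatten ws1]))) ?perm_cat2l //.
  exact: permEl (perm_catCA [:: b] [:: a] _).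
- rewrite target -x2E matchings_graph_cons /= !undirectedD (undirected_edgeC d b).
  by rewrite [undirected (edge b d) + _]addrCA !addrA.
- rewrite map_cons matchings_graph_cons rot1_cons undirectedD undirectedD.
  by rewrite [RHS]undirectedD -e4 rot1_cons addrA (undirected_edgeC b a).
Qed.

Lemma count_cover x : (forall v : L, count_mem v x = 1%N) -> perm_eq x (enum L).
Proof.
move=> count1; have x_all (v : L) : v \in x by rewrite -has_pred1 has_count count1.
apply: uniq_perm; [|exact: enum_uniq|by move=> v; rewrite mem_enum x_all].
by apply: count_mem_uniq => v; rewrite count1 x_all.
Qed.

Lemma regular_matching g : regular_of_degree 1 g -> exists x,
  [/\ even_word x, perm_eq x (enum L) & matching_graph x = g].
Proof.
move=> g1; pose es := enum [pred e | (0 < g e)%N].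
pose x := flatten [seq [:: e.1; e.2] | e <- es].
have [ev_x sumE] : even_word x /\ matching_graph x = \sum_(e <- es) edge e.1 e.2.
  rewrite /x; elim: (es) => [|e s [ev_s IHs]] /=; first by rewrite big_nil.
  by rewrite big_cons IHs; move: ev_s; rewrite /even_word /= negbK.
have g_le1 e : (g e <= 1)%N.
  by case: e => a b; rewrite -(g1 a) /valence (bigD1 b) //= -addnA leq_addr.
have matchE : matching_graph x = g.
  apply/ffunP => z; rewrite sumE sum_ffunE.
  have -> : (\sum_(e <- es) edge e.1 e.2 z)%R = (z \in es) :> nat.
    rewrite -(count_uniq_mem z (enum_uniq _)) -sum1_count [RHS]big_mkcond.
    by apply: eq_bigr => e _; rewrite ffunE -surjective_pairing /= (eq_sym z); case: (e == z).
  by rewrite mem_enum inE; have := g_le1 z; case: (g z) => [|[]].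
exists x; split=> //.
by apply: count_cover => v; rewrite -valence_matching // matchE g1.
Qed.
End TwoMatchings.

(** * Quadratic elements and their values in the ring *)

Section Evaluation.
Variable L : finType.
Implicit Types (g h : graph L) (ws es os : seq (seq L)).

Definition color_class ws : Sym (matching_space L) := color_trace (@pair_class L) ws.

Lemma valence_matchings_rot ws (v : L) : all_even ws ->
  valence (matchings_graph (map (rot 1) ws)) v = valence (matchings_graph ws) v.
Proof.
move=> ev; rewrite !valence_matchings //; last first.
  by rewrite /all_even all_map; apply: sub_all ev => w; rewrite /= even_word_rot.
elim: ws {ev} => //= w ws IHws; rewrite !count_cat IHws; congr (_ + _)%N.
by rewrite addnC -count_cat cat_take_drop.
Qed.

Lemma graph_value_union g h : (forall v, valence g v = valence h v) ->
  graph_value 1 g * graph_value 1 h = graph_value 2 (g + h).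
Proof.
move=> gh; have [g1|ng1] := pselect (regular_of_degree 1 g); last first.
  rewrite (graph_value_out ng1) mul0r graph_value_out // => r2; apply: ng1 => v.
  by have := r2 v; rewrite valenceD -gh; lia.
have h1 : regular_of_degree 1 h by move=> v; rewrite -gh g1.
have [m mE] := regular_graph_of g1; have [m' m'E] := regular_graph_of h1.
have r2 : regular_of_degree 2 (graph_of (mmul m m')).
  by move=> v; rewrite /= graph_unionE -[graph_of m]/(val m) -[graph_of m']/(val m') mE m'E valenceD g1 h1.
have <- : graph_of (mmul m m') = g + h by rewrite /= graph_unionE -mE -m'E.
by rewrite -mE -m'E !graph_value_class ?mE ?m'E // graph_classM.
Qed.

Lemma Sym_to_Rring_pair g h : (forall v, valence g v = valence h v) ->
  Sym_to_Rring (pair_class g h) = graph_value 2 (g + h).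
Proof.
by move=> gh; rewrite -graph_value_union // /pair_class rmorphM /= /Sym_to_Rring !sym_lift_sym.
Qed.

Lemma Sym_to_Rring_color ws : all_even ws ->
  Sym_to_Rring (color_class ws) = graph_trace (graph_value 2) ws.
Proof.
move=> ev; rewrite /color_class /color_trace ev.
apply: etrans (raddfMn (@Sym_to_Rring L) _ _) _.
rewrite /graph_trace cycles_graph_matchings //.
apply: (congr1 (fun x => x *+ _)); apply: Sym_to_Rring_pair => v.
by rewrite valence_matchings_rot.
Qed.

Lemma pair_up_color_out os es :
  ~~ perm_eq (flatten os ++ flatten es) (enum L) -> pair_up color_class os es = 0.
Proof.
apply: (pair_up_uncovered (c := [::])) => fs /=; apply: contraNeq.
rewrite /color_class /color_trace; case: ifP => [ev nz|]; last by rewrite eqxx.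
apply: count_cover => v; rewrite -valence_matchings //.
have [r|nr] := pselect (regular_of_degree 1 (matchings_graph fs)); first exact: r.
by rewrite /pair_class (matching_class_out nr) raddf0 mul0r mul0rn eqxx in nz.
Qed.

Lemma extend_color_out ws : ~~ perm_eq (flatten ws) (enum L) -> extend_trace color_class ws = 0.
Proof.
move=> nws; apply: pair_up_color_out; rewrite -flatten_cat; apply: contra nws.
by rewrite (permPl (perm_flatten (odds_evens_perm ws))).
Qed.

Lemma Sym_to_Rring_trace : ~~ odd #|L| ->
  trace (fun ws => Sym_to_Rring (extend_trace color_class ws)).
Proof.
move=> L_even; have Xt := graph_trace_trace (graph_value_plucker L 2).
apply: (trace_restrict (r := enum L) Xt) => [ws c|ws n]; last by rewrite extend_color_out // raddf0.
apply: etrans (pair_up_morph (@Sym_to_Rring L) _ _ _) _.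
apply: (extend_trace_eq Xt) => [es ev|]; first exact: Sym_to_Rring_color.
by rewrite (perm_size c) -cardE.
Qed.

Lemma color_class_part ws : color_class ws \in @sym_part (matching_space L) 2.
Proof.
rewrite /color_class /color_trace; case: ifP => _; last exact: rpred0.
apply: rpredMn; apply: mem_zspan.
exists (fun i : 'I_2 => if i == 0 then matching_class (matchings_graph ws)
  else matching_class (matchings_graph (map (rot 1) ws))).
by rewrite big_ord_recl big_ord1.
Qed.

Lemma extend_color_part ws : extend_trace color_class ws \in @sym_part (matching_space L) 2.
Proof. exact: (pair_up_in (S := @sym_part (matching_space L) 2) _ _ color_class_part). Qed.

(** The images in [R_L] satisfy the relations of a trace, so the differences
are quadratic relations, which [phi] kills. *)
Lemma trace_lift (Q : zmodType) (phi : {additive Sym (matching_space L) -> Q}) :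
  (forall s, s \in @relation_ideal2 L -> phi s = 0) -> ~~ odd #|L| ->
  trace (fun ws => phi (extend_trace color_class ws)).
Proof.
move=> phi0 L_even; have Xt := Sym_to_Rring_trace L_even.
have in2 := extend_color_part.
have eq_phi s t : s \in @sym_part (matching_space L) 2 -> t \in @sym_part (matching_space L) 2 ->
    Sym_to_Rring s = Sym_to_Rring t -> phi s = phi t.
  move=> s2 t2 st; apply/eqP; rewrite -subr_eq0 -raddfB; apply/eqP/phi0/andP; split.
    by apply/eqP; rewrite raddfB /= st subrr.
  exact: rpredB.
have signed_phi (A A' : zmodType) (f : {additive A -> A'}) b x : f (signed b x) = signed b (f x).
  by case: b; rewrite //= raddfN.
have signed_in b s : s \in @sym_part (matching_space L) 2 -> signed b s \in @sym_part (matching_space L) 2.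
  by case: b => // s2; rewrite /= rpredN.
split=> [ws ws' p|w ws|w ws|u v ws].
- exact: (eq_phi _ _ (in2 _) (in2 _) (tr_perm Xt p)).
- exact: (eq_phi _ _ (in2 _) (in2 _) (tr_rot Xt w ws)).
- rewrite -signed_phi; apply: (eq_phi _ _ (in2 _) (signed_in _ _ (in2 _))).
  by rewrite (signed_phi _ _ (@Sym_to_Rring L)); apply: (tr_rev Xt w ws).
rewrite -signed_phi -raddfD.
apply: (eq_phi _ _ (in2 _) (rpredD (in2 _) (signed_in _ _ (in2 _)))).
apply: etrans (tr_join Xt u v ws) _; apply: esym; apply: etrans (raddfD (@Sym_to_Rring L) _ _) _.
by rewrite (signed_phi _ _ (@Sym_to_Rring L)).
Qed.

Lemma matching_space_eq (A : zmodType) (f g : matching_space L -> A) :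
  zmod_morphism f -> zmod_morphism g ->
  (forall k, regular_of_degree 1 k -> f (matching_class k) = g (matching_class k)) -> f =1 g.
Proof.
move=> fz gz fg v.
pose f' : {additive matching_space L -> A} := HB.pack f (GRing.isZmodMorphism.Build _ _ f fz).
pose g' : {additive matching_space L -> A} := HB.pack g (GRing.isZmodMorphism.Build _ _ g gz).
have /asboolP[n [c [r [rP vE]]]] := valP v.
have [k kP] : exists k : 'I_n -> graph L, forall i,
    regular_of_degree 1 (k i) /\ r i = val (matching_class (k i)).
  have ex i : exists k : graph L, regular_of_degree 1 k /\ r i = val (matching_class k).
    have [m [m1 rE]] := rP i; exists (graph_of m); split=> //.
    by rewrite rE /= -(graph_value_class m1).
  by exists (fun i => projT1 (cid (ex i))) => i; apply: projT2 (cid (ex i)).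
have -> : v = \sum_(i < n) matching_class (k i) *~ c i.
  apply: val_inj; rewrite vE (raddf_sum (val : matching_space L -> Rring L)).
  apply: eq_bigr => i _; rewrite (raddfMz (val : matching_space L -> Rring L)).
  by rewrite (kP i).2.
have sumE (h : {additive matching_space L -> A}) :
    h (\sum_(i < n) matching_class (k i) *~ c i) = \sum_(i < n) h (matching_class (k i)) *~ c i.
  by rewrite raddf_sum; apply: eq_bigr => i _; rewrite raddfMz.
apply: etrans (sumE f') _; apply: etrans _ (esym (sumE g')); apply: eq_bigr => i _.
by apply: (congr1 (fun x => x *~ c i)); apply: fg; exact: (kP i).1.
Qed.
End Evaluation.

(** * Adding fixed edges to graphs on a subset *)

Section Embedding.
Variables (N : nat) (L : finType) (A : {set L}) (k : graph L).
Hypothesis k_off : matching_on (~: A) k.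
Local Notation L' := {x : L | x \in A}.
Implicit Types (g h : graph L') (x y : L').

Definition extend_graph g : graph L := [ffun e =>
  if (insub e.1 : option L') is Some x then
    if (insub e.2 : option L') is Some y then g (x, y) else 0%N
  else 0%N].

Lemma extend_graph_val g x y : extend_graph g (val x, val y) = g (x, y).
Proof. by rewrite ffunE /= !valK. Qed.

Lemma extend_graph_out g (u v : L) : (u \notin A) || (v \notin A) -> extend_graph g (u, v) = 0%N.
Proof.
rewrite ffunE /=; case: insubP => // x xA _; case: insubP => // y yA _.
by rewrite xA yA.
Qed.

Lemma extend_graphD g h : extend_graph (g + h) = extend_graph g + extend_graph h.
Proof.
by apply/ffunP => e; rewrite graphDE !ffunE; case: insub => // x; case: insub => // y; rewrite ffunE.
Qed.

Lemma extend_graph0 : extend_graph 0 = 0.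
Proof. by apply/ffunP => e; rewrite !ffunE; case: insub => // x; case: insub => // y; rewrite ffunE. Qed.

Lemma extend_graph_edge x y : extend_graph (edge x y) = edge (val x) (val y).
Proof.
apply/ffunP => -[u v]; have [uA|uA] := boolP (u \in A); last first.
  rewrite extend_graph_out ?uA // ffunE xpair_eqE.
  by case: eqP uA => // ->; rewrite (valP x).
have [vA|vA] := boolP (v \in A); last first.
  rewrite extend_graph_out ?vA ?orbT // ffunE xpair_eqE andbC.
  by case: eqP vA => // ->; rewrite (valP y).
rewrite -[u]/(val (exist _ u uA : L')) -[v]/(val (exist _ v vA : L')) extend_graph_val.
by rewrite !ffunE !xpair_eqE !(inj_eq val_inj).
Qed.

Lemma sum_extend (F : L -> nat) : (forall v, v \notin A -> F v = 0%N) ->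
  (\sum_(v : L) F v = \sum_(x : L') F (val x))%N.
Proof.
move=> F0; rewrite (bigID (mem A)) /= [X in (_ + X)%N]big1 ?addn0; last exact: F0.
by rewrite big_sub.
Qed.

Lemma valence_extend g x : valence (extend_graph g) (val x) = valence g x.
Proof.
rewrite /valence !sum_extend; first by congr (_ + _)%N; apply: eq_bigr => y _; rewrite extend_graph_val.
  by move=> v vA; rewrite extend_graph_out ?vA.
by move=> v vA; rewrite extend_graph_out ?vA ?orbT.
Qed.

Lemma valence_extend_out g (v : L) : v \notin A -> valence (extend_graph g) v = 0%N.
Proof.
by move=> vA; rewrite /valence !big1 // => w _; rewrite extend_graph_out ?vA ?orbT.
Qed.

Lemma extend_regular g : regular_of_degree 1 (extend_graph g + k) <-> regular_of_degree 1 g.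
Proof.
split=> r => [x|v].
  by have := r (val x); rewrite valenceD valence_extend k_off in_setC (valP x) addn0.
rewrite valenceD k_off in_setC; have [vA|vA] := boolP (v \in A); last by rewrite valence_extend_out.
by rewrite -[v]/(val (exist _ v vA : L')) valence_extend r.
Qed.

Definition extend_class g : matching_space L := matching_class (extend_graph g + k).

Lemma extend_class_plucker : plucker extend_class.
Proof.
have [lp sg ex] := matching_class_plucker L.
have swap (h1 h2 : graph L) : h1 + h2 + k = h1 + k + h2 by rewrite addrAC.
split=> *; rewrite /extend_class !extend_graphD !extend_graph_edge !swap; [exact: lp | exact: sg | exact: ex].
Qed.

Definition extend_matching (v : matching_space L') : matching_space L :=
  Rring_lift extend_class (val v).

Lemma extend_matching_zmod : zmod_morphism extend_matching.
Proof.
move=> u v; rewrite /extend_matching (raddfB (val : matching_space L' -> Rring L')).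
exact: (Rring_lift_zmod extend_class_plucker).
Qed.
HB.instance Definition _ := GRing.isZmodMorphism.Build (matching_space L') (matching_space L)
  extend_matching extend_matching_zmod.

Lemma extend_matching_class g : extend_matching (matching_class g) = extend_class g.
Proof.
have [r|nr] := pselect (regular_of_degree 1 g); last first.
  rewrite matching_class_out // raddf0 /extend_class matching_class_out //.
  by move/extend_regular.
have [m mE] := regular_graph_of r.
rewrite /extend_matching /= -mE graph_value_class ?mE //.
by rewrite (Rring_lift_class extend_class_plucker) -[graph_of m]/(val m) mE.
Qed.

Definition extend_sym : Sym (matching_space L') -> Sym (matching_space L) :=
  sym_lift (@sym (matching_space L) \o extend_matching).
HB.instance Definition _ := GRing.RMorphism.copy extend_sym
  (sym_lift (@sym (matching_space L) \o extend_matching)).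

Lemma extend_sym_sym v : extend_sym (sym v) = sym (extend_matching v).
Proof. exact: sym_lift_sym. Qed.

Lemma extend_pair_class g h :
  extend_sym (pair_class g h) = pair_class (extend_graph g + k) (extend_graph h + k).
Proof. by rewrite /pair_class rmorphM /= !extend_sym_sym !extend_matching_class. Qed.

Lemma is_class_of_extend g v : is_class_of g v -> is_class_of (extend_graph g + k) (extend_matching v).
Proof.
move=> [m [mE g1 vE]]; have -> : v = matching_class g.
  by apply: val_inj; rewrite vE /= -mE graph_value_class ?mE.
rewrite extend_matching_class; apply: matching_class_is; exact/extend_regular.
Qed.

(** The added edges [k] belong to both matchings outside of [U]. *)
Lemma extend_simple_binomial s : simple_binomial s -> simple_binomial (extend_sym s).
Proof.
case=> U [D [D' [G [G' [x [y [z [t [U4 [DU DU'] [GU GU'] [cx cy cz ct] ->]]]]]]]]].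
pose U1 := [set val u | u in U].
have inU1 u : (val u \in U1) = (u \in U) by rewrite mem_imset //; apply: val_inj.
have outU1 v : v \notin A -> v \notin U1.
  by apply: contra => /imsetP[u _ ->]; apply: valP.
have cases (v : L) : (exists u : L', v = val u) \/ v \notin A.
  by have [vA|] := boolP (v \in A); [left; exists (exist _ v vA) | right].
have DU1 E : matching_on U E -> matching_on U1 (extend_graph E).
  move=> EU v; have [[u ->]|vA] := cases v; first by rewrite valence_extend EU inU1.
  by rewrite valence_extend_out // (negPf (outU1 v vA)).
have GU1 H : matching_on (~: U) H -> matching_on (~: U1) (extend_graph H + k).
  move=> HU v; rewrite valenceD k_off !in_setC; have [[u ->]|vA] := cases v.
    by rewrite valence_extend HU inU1 in_setC (valP u) addn0.
  by rewrite valence_extend_out // vA (outU1 v vA).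
have cls H E w : is_class_of (graph_union H E) w ->
    is_class_of (graph_union (extend_graph H + k) (extend_graph E)) (extend_matching w).
  by move/is_class_of_extend; rewrite !graph_unionE extend_graphD addrAC.
exists U1, (extend_graph D), (extend_graph D'), (extend_graph G + k), (extend_graph G' + k).
exists (extend_matching x), (extend_matching y), (extend_matching z), (extend_matching t).
split.
- by rewrite card_imset //; apply: val_inj.
- by split; apply: DU1.
- by split; apply: GU1.
- by split; apply: cls.
by rewrite rmorphB !rmorphM /= !extend_sym_sym.
Qed.

Lemma extend_saturated s : s \in @saturated N L' -> extend_sym s \in @saturated N L.
Proof.
move=> /asboolP[n /asboolP[l [c [g [Pg sE]]]]]; apply/asboolP; exists n.
apply/asboolP; exists l, c, (fun i => extend_sym (g i)); split=> [i|].
  exact: extend_simple_binomial.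
apply: etrans (esym (raddfMn extend_sym _ _)) _; rewrite sE.
apply: etrans (raddf_sum extend_sym _ _ _) _; apply: eq_bigr => i _.
exact: raddfMz.
Qed.
End Embedding.

(** * The induction step for sets *)

Section Generation.
Variables (N : nat) (L : finType).
Hypothesis N_gt0 : (0 < N)%N.

Lemma generated_saturated : generated_by_simple_binomials N L ->
  forall s, s \in @relation_ideal2 L -> s \in @saturated N L.
Proof.
move=> gen s s_in; have N2 : (0 < 2 * N)%N by rewrite muln_gt0.
have [k /asboolP[n [c [g [gP e]]]]] := generates_span N2 gen (MkI2 s_in).
apply/asboolP; exists k; apply/asboolP; exists n, c, (fun i => val (g i)); split=> //.
apply: etrans (esym (raddfMn (val : I2 L -> Sym (matching_space L)) _ (MkI2 s_in))) _.
rewrite e; apply: etrans (raddf_sum (val : I2 L -> Sym (matching_space L)) _ _ _) _.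
by apply: eq_bigr => i _; apply: (raddfMz (val : I2 L -> Sym (matching_space L))).
Qed.

Lemma saturated_generated : (forall s, s \in @relation_ideal2 L -> s \in @saturated N L) ->
  generated_by_simple_binomials N L.
Proof.
move=> sat; have N2 : (0 < 2 * N)%N by rewrite muln_gt0.
apply: (span_generates N2) => r.
have /asboolP[k /asboolP[n [c [g [gP e]]]]] := sat _ (valP r); exists k.
apply/asboolP; exists n, c, (fun i => MkI2 (simple_binomial_relation (gP i))); split=> //.
apply: val_inj; apply: etrans (raddfMn (val : I2 L -> Sym (matching_space L)) _ _) _.
apply: etrans e _; apply: esym.
apply: etrans (raddf_sum (val : I2 L -> Sym (matching_space L)) _ _ _) _.
by apply: eq_bigr => i _; apply: etrans (raddfMz (val : I2 L -> Sym (matching_space L)) _ _) _.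
Qed.

Definition color_value : seq (seq L) -> Squot N L := color_trace (@pair_value N L).

Lemma color_value_class ws : color_value ws = \pi_(Squot N L) (color_class ws).
Proof.
rewrite /color_value /color_class /color_trace; case: ifP => _; last exact/esym/raddf0.
exact/esym/raddfMn.
Qed.

Lemma extend_color_value ws :
  extend_trace color_value ws = \pi_(Squot N L) (extend_trace (@color_class L) ws).
Proof.
apply: esym; apply: etrans (pair_up_morph (\pi_(Squot N L)) _ _ _) _.
by apply: pair_up_ext => es; rewrite /= color_value_class.
Qed.

Lemma color_value_colored : colored_trace color_value.
Proof. exact: pair_color_trace. Qed.

Section OnePair.
Variables (a b : L).
Local Notation A := (~: [set a; b]).
Local Notation L' := {x : L | x \in A}.
Hypothesis ab : a != b.
Hypothesis gen : forall s, s \in @relation_ideal2 L' -> s \in @saturated N L'.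
Hypothesis L'_even : ~~ odd #|{: L'}|.

Lemma edge_off : matching_on (~: A) (edge a b).
Proof.
move=> v; rewrite valence_edge setCK !inE; have [->|] := eqVneq v a.
  by rewrite (negPf ab).
by rewrite add0n.
Qed.

Let phi : {additive Sym (matching_space L') -> Squot N L} :=
  \pi_(Squot N L) \o @extend_sym L A (edge a b).

Lemma pair_trace_sub : trace (fun ws => phi (extend_trace (@color_class L') ws)).
Proof.
apply: trace_lift => // s /gen s_sat; apply/eqP; rewrite /= Squot_eq0.
exact: (extend_saturated edge_off).
Qed.

Lemma matching_graph_val (w : seq L') :
  matching_graph (map val w) = extend_graph (matching_graph w).
Proof.
have [m] := ubnP (size w); elim: m w => // m IHm [|x [|y w]] /= lt_m; rewrite ?extend_graph0 //.
by rewrite extend_graphD extend_graph_edge IHm //; lia.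
Qed.

Lemma matchings_graph_val (ws : seq (seq L')) :
  matchings_graph (map (map val) ws) = extend_graph (matchings_graph ws).
Proof.
elim: ws => [|w ws IHws]; first by rewrite /matchings_graph !big_nil extend_graph0.
by rewrite /= !matchings_graph_cons IHws matching_graph_val extend_graphD.
Qed.

(** Both colours of the word [ab] are the edge ab, with opposite directions:
hence the square of this edge and the sign. *)
Lemma color_value_pair (ws : seq (seq L')) :
  color_value ([:: a; b] :: map (map val) ws) = - phi (color_class ws).
Proof.
have pp := pair_value_plucker N.
rewrite /color_class /color_value /color_trace.
have -> : all_even ([:: a; b] :: map (map val) ws) = all_even ws.
  by rewrite /= /all_even all_map; apply: eq_all => w; rewrite /even_word /= size_map.
case: ifP => ev; last by rewrite raddf0 oppr0.
rewrite raddfMn -mulNrn; have -> : nil_weight ([:: a; b] :: map (map val) ws) = nil_weight ws.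
  rewrite nil_weight_cons mul1n /nil_weight count_map; congr (2 ^ _)%N.
  by apply: eq_count => w; rewrite /nilp /= size_map.
congr (_ *+ _); rewrite map_cons !matchings_graph_cons.
have -> : map (rot 1) (map (map val) ws) = map (map val) (map (rot 1) ws).
  by rewrite -!map_comp; apply: eq_map => w; rewrite /= map_rot.
rewrite !matchings_graph_val.
have -> : matching_graph [:: a; b] = edge a b by rewrite /= addr0.
have -> : matching_graph (rot 1 [:: a; b]) = edge b a by rewrite /= addr0.
rewrite (addrC (edge b a)) (pl_sign (pp _ _)) (addrC (edge a b)).
by congr (- _); rewrite /pair_value -(extend_pair_class edge_off).
Qed.

Lemma enum_pair : perm_eq (enum L) ([:: a; b] ++ enum A).
Proof.
apply: uniq_perm => [||v]; first exact: enum_uniq.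
  rewrite /= !inE !mem_enum !inE !eqxx (negPf ab) orbT /= enum_uniq //.
by rewrite mem_enum /= !inE mem_enum !inE; case: (v == a); case: (v == b).
Qed.

(** Lists that share no letter with [ab] are words on the smaller set, to which
a retraction [r] of the vertices carries them. *)
Lemma pair_trace (x0 : L') : trace (fun ws => extend_trace color_value ([:: a; b] :: ws)).
Proof.
pose r (v : L) : L' := insubd x0 v.
apply: (trace_restrict (r := enum A) (traceN (trace_map r pair_trace_sub))) => ws; last first.
  move=> n; rewrite extend_color_value extend_color_out ?raddf0 //.
  by apply: contra n; rewrite (permPr enum_pair) perm_cat2l.
move=> c; pose vs := map (map r) ws.
have wsE : ws = map (map val) vs.
  have in_A v : v \in flatten ws -> v \in A by rewrite (perm_mem c) mem_enum.
  rewrite /vs -map_comp -[LHS]map_id; apply/eq_in_map => w w_ws.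
  rewrite /= -map_comp -[LHS]map_id; apply/eq_in_map => v v_w /=.
  by rewrite insubdK //; apply: in_A; apply/flattenP; exists w.
rewrite -/vs wsE /extend_trace.
have odd_map : odds (map (map val) vs) = map (map val) (odds vs).
  by rewrite /odds filter_map; congr map; apply: eq_filter => w; rewrite /= /even_word size_map.
have even_map : evens (map (map val) vs) = map (map val) (evens vs).
  by rewrite /evens filter_map; congr map; apply: eq_filter => w; rewrite /= /even_word size_map.
rewrite -[odds (_ :: _)]/(odds (map (map val) vs)) odd_map.
rewrite -[evens (_ :: _)]/([:: a; b] :: evens (map (map val) vs)) even_map.
pose psi : {additive Sym (matching_space L') -> Squot N L} := -%R \o phi.
apply: (pair_up_map (phi := psi)) => [us us' p|us]; first exact: (ct_perm color_value_colored p).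
exact: color_value_pair.
Qed.
End OnePair.

Lemma pair_trace_loop a : trace (fun ws => extend_trace color_value ([:: a; a] :: ws)).
Proof.
have zero ws : extend_trace color_value ([:: a; a] :: ws) = 0.
  rewrite extend_color_value extend_color_out ?raddf0 //.
  by apply: contraT; rewrite negbK => /perm_uniq; rewrite enum_uniq /= inE eqxx.
by split=> *; rewrite !zero // /signed; case: odd; rewrite ?oppr0 ?addr0.
Qed.
End Generation.

Section Conclusion.
Variables (N : nat) (L : finType).
Hypotheses (N_gt0 : (0 < N)%N) (color_traced : trace (extend_trace (@color_value N L))).

Let Psi : graph L -> Squot N L := graph_function (extend_trace (@color_value N L)).

Lemma Psi_plucker : plucker Psi.
Proof. by apply: graph_function_plucker color_traced; apply: Squot_half. Qed.

Lemma Psi_pair g h : regular_of_degree 1 g -> regular_of_degree 1 h ->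
  Psi (g + h) = pair_value N g h.
Proof.
move=> g1 h1; have [x [ev_x prm_x gE]] := regular_matching g1.
have [y [ev_y prm_y hE]] := regular_matching h1.
have prm_xy : perm_eq x y by rewrite (permPl prm_x) perm_sym.
have [|ws [ev n0 prm e1 e2]] := pair_cycles ev_y prm_xy.
  by rewrite (perm_uniq prm_x) enum_uniq.
rewrite gE in e1; rewrite hE in e2.
have cyc := cycles_graph_matchings ev.
have rep : represents (g + h) ws.
  split; last by rewrite cyc !undirectedD e1 e2.
    by rewrite /valid_words n0 (perm_uniq prm) (perm_uniq prm_x) enum_uniq.
  by rewrite (permPl prm).
rewrite /Psi (graph_function_rep color_traced rep) /word_value extend_even // cyc.
rewrite /color_value /color_trace ev.
have -> : nil_weight ws = 1%N.
  rewrite /nil_weight (_ : count _ ws = 0%N) //; apply/eqP; rewrite eqn0Ngt -has_count.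
  by apply: contra n0 => /hasP[[]].
have pp := @pair_value_plucker N L.
rewrite (undirected_signed (pp g) (esym e2)).
rewrite (pair_valueC N g) (undirected_signed (pp _) (esym e1)) pair_valueC mulr1n.
rewrite !signed_signed !parityD; congr (signed _ _).
by case: (parity g); case: (parity h); case: (parity _); case: (parity _).
Qed.

Lemma relation_saturated s : s \in @relation_ideal2 L -> s \in @saturated N L.
Proof.
move=> /andP[/eqP s0 s2]; rewrite -Squot_eq0; apply/eqP.
pose F : {additive Rring L -> Squot N L} :=
  HB.pack (Rring_lift Psi) (GRing.isZmodMorphism.Build _ _ _ (Rring_lift_zmod Psi_plucker)).
have F_class m : F (graph_class m) = Psi m by exact: (Rring_lift_class Psi_plucker).
have pair_eq (u v : matching_space L) :
    \pi_(Squot N L) (sym u * sym v) = F (val u * val v).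
  have val_class k : regular_of_degree 1 k -> exists2 m : regular_graph L,
      graph_of m = k & val (matching_class k) = graph_class m.
    move=> k1; have [m mE] := regular_graph_of k1; exists m => //.
    by rewrite /= -mE graph_value_class ?mE.
  apply: (@matching_space_eq L _ (fun u => \pi_(Squot N L) (sym u * sym v)) (fun u => F (val u * val v))).
  - by move=> x y; rewrite raddfB mulrBl raddfB.
  - move=> x y; rewrite (raddfB (val : matching_space L -> Rring L)) mulrBl; exact: raddfB.
  move=> g g1; apply: (@matching_space_eq L _
    (fun v => \pi_(Squot N L) (sym (matching_class g) * sym v))
    (fun v => F (val (matching_class g) * val v))).
  - by move=> x y; rewrite raddfB mulrBr raddfB.
  - move=> x y; rewrite (raddfB (val : matching_space L -> Rring L)) mulrBr; exact: raddfB.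
  move=> h h1; have [m mE ->] := val_class g g1; have [m' m'E ->] := val_class h h1.
  rewrite -graph_classM F_class /= graph_unionE mE m'E; apply: esym; exact: Psi_pair.
have /asboolP[n [c [t [tP sE]]]] := s2.
have -> : \pi_(Squot N L) s = F (Sym_to_Rring s).
  rewrite sE; apply: etrans (raddf_sum (\pi_(Squot N L)) _ _ _) _.
  apply: esym; apply: etrans (congr1 F (raddf_sum (@Sym_to_Rring L) _ _ _)) _.
  apply: etrans (raddf_sum F _ _ _) _; apply: eq_bigr => i _.
  apply: etrans (congr1 F (raddfMz (@Sym_to_Rring L) _ _)) _.
  apply: etrans (raddfMz F _ _) _; apply: esym; apply: etrans (raddfMz (\pi_(Squot N L)) _ _) _.
  apply: (congr1 (fun x => x *~ c i)); have [v ->] := tP i.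
  rewrite big_ord_recl big_ord1; apply: etrans (pair_eq _ _) _; congr (F _).
  apply: esym; apply: etrans (rmorphM (@Sym_to_Rring L) _ _) _.
  by rewrite /= /Sym_to_Rring !sym_lift_sym.
by rewrite s0 raddf0.
Qed.
End Conclusion.

Local Close Scope ring_scope.

Theorem theorem1p3 (N : nat) (L : finType)
    (N_gt0 : 0 < N) (L_even : ~~ odd #|L|)
    (L_ge10 : 10 <= #|L|) (L_neq12 : #|L| != 12)
    (IH : forall L' : finType, 0 < #|L'| -> ~~ odd #|L'| -> #|L'| < #|L| ->
      generated_by_simple_binomials N L') :
  generated_by_simple_binomials N L.
Proof.
apply: saturated_generated => //; apply: relation_saturated => //.
apply: (@extend_trace_trace _ _ #|L| (@color_value N L)) => //; last exact: ltnW (ltnW L_ge10).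
- exact: Squot_half.
- exact: color_value_colored.
- by move=> ws sz; apply: color_trace_size => //; apply: pair_value_regular.
move=> a b; have [<-|ab] := eqVneq a b; first exact: pair_trace_loop.
have cardL' : #|{: {x : L | x \in ~: [set a; b]}}| = (#|L| - 2)%N.
  by rewrite card_sig -(cardsC [set a; b]) cards2 ab addKn; apply: eq_card => v; rewrite !inE.
have L'_even : ~~ odd #|{: {x : L | x \in ~: [set a; b]}}|.
  by rewrite cardL' oddB ?(leq_trans _ L_ge10) // (negPf L_even).
have /card_gt0P[x0 _] : (0 < #|{: {x : L | x \in ~: [set a; b]}}|)%N by rewrite cardL'; lia.
apply: (pair_trace N_gt0 ab _ L'_even x0) => s; apply: generated_saturated => //.
by apply: IH => //; rewrite cardL'; lia.
Qed.
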